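(* Let $P\ge2$ and let $X^{p,q}$ be a Damek–Ricci space of dimension $n=p+q+1\ge1+P(P-1)$. Let $o\in X^{p,q}$, $r=d(o,\cdot)$, $h:=(p+2q)/2$, $\Lambda_P(X^{p,q}):=(h/P)^P$, and $$g(r):=\coth(r/2)-\frac{2}{p+2q}\Big(\frac{q}{\sinh(r)}+\frac1r\Big).$$ Then $g(r)\ge\frac{p+q-1}{h\,r}$ for all $r>0$, $g(r)\to1$ as $r\to\infty$, and for all $\phi\in C_c^\infty(X^{p,q})$, $$\int_{X^{p,q}}|\nabla\phi|^Pdx-\Lambda_P(X^{p,q})\int_{X^{p,q}}g(r)^{P-2}|\phi|^Pdx\ge\frac{h^{P-2}(P-1)^2}{P^P}\int_{X^{p,q}}\frac{g(r)^{P-2}}{r^2}|\phi|^Pdx+\frac{h^{P-1}(P-2)}{P^P}\int_{X^{p,q}}\frac{g(r)^{P-2}\big(g(r)+\frac1{hr}\big)}{r}|\phi|^Pdx$$ $$+\frac{h^{P-2}}{P^P}\int_{X^{p,q}}g(r)^{P-2}\Big(\frac{q^2-qP(P-1)}{\sinh^2(r)}+\frac{p(2h-P(P-1))}{4\sinh^2(r/2)}\Big)|\phi|^Pdx.$$ Moreover, all integrands on the right-hand side of this inequality are non-negative functions.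
   Context: Damek–Ricci space $X^{p,q}$: let $\mathfrak n=\mathfrak v\oplus\mathfrak z$ be a real 2-step nilpotent Lie algebra with centre $\mathfrak z$ and an inner product making the decomposition orthogonal, $\dim\mathfrak v=p$, $\dim\mathfrak z=q\ge1$, with $J_Z:\mathfrak v\to\mathfrak v$ defined by $\langle J_ZV,V'\rangle=\langle Z,[V,V']\rangle$ satisfying $J_Z^2=-\|Z\|^2\mathrm{Id}$. Let $\mathfrak s=\mathfrak n\oplus\mathbb RH$ with $[H,V]=\frac12V$, $[H,Z]=Z$, $\|H\|=1$, $H\perp\mathfrak n$; $X^{p,q}$ is the connected simply connected Lie group with Lie algebra $\mathfrak s$ and left-invariant metric given by this inner product at the identity. It is a complete simply connected harmonic manifold of dimension $p+q+1$; its volume element in geodesic polar coordinates about any point is $f(r)\,dr\,d\theta$ with $f(r)=2^p\sinh^p(r/2)\sinh^q(r)$, and $h=(p+2q)/2$ is its Cheeger constant. *)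

(* Defs.v *)
From HB Require Import structures.
From mathcomp Require Import all_boot all_order all_algebra.
From mathcomp Require Import all_classical all_reals all_analysis.
Set Implicit Arguments. Unset Strict Implicit. Unset Printing Implicit Defensive.
Import Order.TTheory GRing.Theory Num.Theory.
Import numFieldNormedType.Exports.
Local Open Scope classical_set_scope.
Local Open Scope ring_scope.

Section DR.
Variable R : realType.

Definition sinh (x : R) : R := (expR x - expR (- x)) / 2.
Definition cosh (x : R) : R := (expR x + expR (- x)) / 2.
Definition coth (x : R) : R := cosh x / sinh x.

(* Euclidean inner product and squared norm on row vectors (coordinates in
   orthonormal bases of v and z) *)
Definition dotv n (u v : 'rV[R]_n) : R := \sum_(i < n) u 0 i * v 0 i.
Definition sqn n (u : 'rV[R]_n) : R := dotv u u.

(* A bracket [.,.] : v x v -> z (all other brackets of n vanish),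
   with the Damek–Ricci (H-type) condition J_Z^2 = -|Z|^2 Id where
   <J_Z V, V'> = <Z, [V, V']>. *)
Definition Jop p q (br : 'rV[R]_p -> 'rV[R]_p -> 'rV[R]_q)
  (Z : 'rV[R]_q) (V : 'rV[R]_p) : 'rV[R]_p :=
  \row_(i < p) dotv Z (br V (delta_mx 0 i)).

Definition is_DR_bracket p q (br : 'rV[R]_p -> 'rV[R]_p -> 'rV[R]_q) : Prop :=
  [/\ (forall (a : R) V V' W, br (a *: V + V') W = a *: br V W + br V' W),
      (forall V W, br V W = - br W V) &
      (forall Z V, Jop br Z (Jop br Z V) = - (sqn Z *: V))].

(* Global coordinates (V, Z, t) on X^{p,q} = N \rtimes A: the point
   (V,Z,t) is exp(V+Z) exp(tH).  Group law:
   (V,Z,t)(V',Z',t') = (V + e^{t/2}V', Z + e^t Z' + 1/2 e^{t/2}[V,V'], t+t'). *)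
Definition DRpt p q := ('rV[R]_p * 'rV[R]_q * R)%type.

(* left-invariant orthonormal frame at x = (V,Z,t):
   E_i(x) = (e^{t/2} e_i, 1/2 e^{t/2} [V, e_i], 0), F_j(x) = (0, e^t f_j, 0),
   H(x) = (0,0,1) *)
Definition frameE p q (br : 'rV[R]_p -> 'rV[R]_p -> 'rV[R]_q)
  (x : DRpt p q) (i : 'I_p) : DRpt p q :=
  (expR (x.2 / 2) *: delta_mx 0 i,
   (expR (x.2 / 2) / 2) *: br x.1.1 (delta_mx 0 i), 0).
Definition frameF p q (x : DRpt p q) (j : 'I_q) : DRpt p q :=
  (0, expR x.2 *: delta_mx 0 j, 0).
Definition frameH p q : DRpt p q := (0, 0, 1).

Definition grad_norm p q (br : 'rV[R]_p -> 'rV[R]_p -> 'rV[R]_q)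
  (f : DRpt p q -> R) (x : DRpt p q) : R :=
  Num.sqrt (\sum_(i < p) ('D_(frameE br x i) f x) ^+ 2
          + \sum_(j < q) ('D_(frameF x j) f x) ^+ 2
          + ('D_(frameH p q) f x) ^+ 2).

(* Riemannian speed of a tangent vector w at x (norm in the left-invariant
   metric): coefficients in the frame are
   a = e^{-t/2} V', b = e^{-t} (Z' - 1/2 [V,V']), c = t'. *)
Definition speed p q (br : 'rV[R]_p -> 'rV[R]_p -> 'rV[R]_q)
  (x w : DRpt p q) : R :=
  Num.sqrt (expR (- x.2) * sqn w.1.1
          + expR (- (2 * x.2)) * sqn (w.1.2 - 2^-1 *: br x.1.1 w.1.1)
          + w.2 ^+ 2).

Definition C1_curve p q (a b : DRpt p q) (c : R -> DRpt p q) : Prop :=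
  [/\ (forall s, differentiable c s), continuous ('D_1 c), c 0 = a & c 1 = b].

Definition curve_length p q (br : 'rV[R]_p -> 'rV[R]_p -> 'rV[R]_q)
  (c : R -> DRpt p q) : R :=
  Rintegral lebesgue_measure `[0, 1] (fun s => speed br (c s) ('D_1 c s)).

Definition DRdist p q (br : 'rV[R]_p -> 'rV[R]_p -> 'rV[R]_q)
  (a b : DRpt p q) : R :=
  inf [set L | exists c, C1_curve a b c /\ L = curve_length br c].

(* Lebesgue integral over R^n (iterated one-dimensional Lebesgue integrals,
   used for non-negative integrands) *)
Fixpoint lebN (n : nat) : ('rV[R]_n -> \bar R) -> \bar R :=
  match n return ('rV[R]_n -> \bar R) -> \bar R with
  | 0 => fun f => f 0
  | n'.+1 => fun f => (\int[lebesgue_measure]_(x in setT)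
               lebN (fun v : 'rV[R]_n' => f (row_mx (const_mx x : 'rV[R]_1) v)))%E
  end.

(* Integral with respect to the Riemannian volume dvol = e^{-(p/2+q) t} dV dZ dt *)
Definition DRint p q (f : DRpt p q -> R) : \bar R :=
  lebN (fun V : 'rV[R]_p => lebN (fun Z : 'rV[R]_q =>
    (\int[lebesgue_measure]_(t in setT)
        (f (V, Z, t) * expR (- ((p%:R / 2 + q%:R) * t)))%:E)%E)).

Fixpoint iter_D p q (vs : seq (DRpt p q)) (f : DRpt p q -> R) : DRpt p q -> R :=
  match vs with
  | [::] => f
  | v :: vs' => 'D_v (iter_D vs' f)
  end.

Definition smooth_cpt p q (f : DRpt p q -> R) : Prop :=
  (forall vs x, differentiable (iter_D vs f) x) /\
  compact (closure [set x | f x != 0]).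

End DR.

Section DR2.
Variable R : realType.
Local Open Scope ring_scope.
Definition DR_h (p q : nat) : R := (p%:R + 2 * q%:R) / 2.
Definition DR_g (p q : nat) (r : R) : R :=
  coth (r / 2) - 2 / (p%:R + 2 * q%:R) * (q%:R / sinh r + r^-1).
End DR2.

(* Main.v *)
(** Let r be the distance to the identity and U = cosh^2 (r / 2), an explicit
    rational function of (V, Z, e^t) with |grad U|^2 = U^2 - U and Laplacian
    (1 + h) U - (1 + q) / 2.  Put s = h g(r) / P and let kappa(U) grad U be the
    radial field of length s^(P-1).  Young's inequality gives pointwise
      |grad phi|^P + div (|phi|^P kappa(U) grad U) >= W |phi|^P
    with W = div (kappa(U) grad U) - (P - 1) s^P, and W is exactly the sum of
    the four weights of the inequality.  Integrating, after cutting the field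
    off near the identity where it is singular, yields the result at the
    identity.  That r is the distance for the length metric follows from
    |grad r| <= 1 along any curve and from the explicit geodesics through the
    identity; left translations, which preserve the volume and the metric,
    move the base point. *)

Require Import Defs.
From HB Require Import structures.
From mathcomp Require Import all_boot all_order all_algebra.
From mathcomp Require Import all_classical all_reals all_analysis.
From mathcomp Require Import measurable_realfun.
From mathcomp Require Import ring lra.
Import Order.TTheory GRing.Theory Num.Theory.
Import numFieldNormedType.Exports.
Local Open Scope classical_set_scope.
Local Open Scope ring_scope.
Set Implicit Arguments. Unset Strict Implicit. Unset Printing Implicit Defensive.

(** The choice of s comes from the trial function psi = (r / f)^(1/P), f being the volume density: h
    g = f'/f - 1/r, so that s = - psi'/psi, and W is minus the P-Laplacian of psi divided by
    psi^(P-1). Working with U rather than r keeps the vector fields explicit and regular at the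
    identity. Two limits have to be taken, and both are arranged so that a one-sided bound suffices.
    The integral of a divergence is reached through difference quotients, whose integrals cancel by
    translation invariance of Lebesgue measure; letting the step tend to 0 then costs only lower
    semicontinuity, which gives an inequality in the required direction. The cut-off is a
    non-decreasing function of U, so the term in which it is differentiated is non-negative and is
    dropped: the singularity at the identity is never estimated, and the cut-off is removed by lower
    semicontinuity again. The subtraction on the left is postponed: the four weights stay on one
    side until finiteness of the energy permits moving one of them across. *)

(* Iterated integrals are only manipulated for non-negative lower
   semicontinuous functions: this class is stable under partial integration,
   so that no measurability on products is ever needed. *)
Definition nnlsc (R : realType) (T : topologicalType) (f : T -> \bar R) :=
  (forall x, 0%E <= f x)%E /\ lower_semicontinuous f.

Lemma cvg_to_pair (S : Type) (F : set_system S) {FF : Filter F}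
    (T U : topologicalType) (f : S -> T) (g : S -> U) (a : T) (b : U) :
  f x @[x --> F] --> a -> g x @[x --> F] --> b ->
  (f x, g x) @[x --> F] --> (a, b).
Proof.
move=> fa gb A [[P Q] /= [aP bQ] PQA].
apply: (@filterS _ _ _ ((f @^-1` P) `&` (g @^-1` Q))) => [x [Px Qx]|].
  by apply: PQA.
by apply: filterI; [exact: (fa _ aP)|exact: (gb _ bQ)].
Qed.

(** * Closure properties of non-negative lower semicontinuous functions *)

Section Nnlsc.
Variables (R : realType) (T : topologicalType).
Implicit Types f g : T -> \bar R.
Local Open Scope ereal_scope.

Lemma nnlsc_ge0 f x : nnlsc f -> 0 <= f x.
Proof. by case=> + _; exact. Qed.

Lemma nnlsc_comp (S : topologicalType) f (g : S -> T) :
  continuous g -> nnlsc f -> nnlsc (f \o g).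
Proof.
move=> cg [f0 lf]; split=> [x|x a /= afx]; first exact: f0.
have [V fxV Va] := lf _ _ afx.
exists (g @^-1` V); first exact: (cg x).
by move=> y /= /Va.
Qed.

(** A level a below f x + g x is split as b + c with b below f x and c below g x. Half of the gap is
    taken from each value; where one value is infinite, the other, being non-negative, lies above
    the level -1. *)
Lemma nnlscD f g : nnlsc f -> nnlsc g -> nnlsc (fun x => f x + g x).
Proof.
move=> [f0 lf] [g0 lg]; split=> [x|x a]; first by rewrite adde_ge0.
have key (b c : R) : (b + c = a)%R -> b%:E < f x -> c%:E < g x ->
    exists2 V, nbhs x V & forall y, V y -> a%:E < f y + g y.
  move=> <- /lf[V xV fV] /lg[W xW gW]; exists (V `&` W); first exact: filterI.
  by move=> y [/fV bf /gW cg]; rewrite EFinD lteD.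
case fxE : (f x) (f0 x) => [u| |] // u0; case gxE : (g x) (g0 x) => [v| |] // v0.
- rewrite -EFinD lte_fin => auv.
  apply: (key (u - (u + v - a) / 2)%R (v - (u + v - a) / 2)%R); first by lra.
  + by rewrite fxE lte_fin; lra.
  + by rewrite gxE lte_fin; lra.
- move=> _; apply: (key (-1)%R (a + 1)%R); first by lra.
  + by rewrite fxE lte_fin; rewrite lee_fin in u0; lra.
  + by rewrite gxE ltry.
- move=> _; apply: (key (a + 1)%R (-1)%R); first by lra.
  + by rewrite fxE ltry.
  + by rewrite gxE lte_fin; rewrite lee_fin in v0; lra.
- move=> _; apply: (key (a + 1)%R (-1)%R); first by lra.
  + by rewrite fxE ltry.
  + by rewrite gxE ltry.
Qed.

(** Zeros cost nothing: a non-negative function is lower semicontinuous wherever it vanishes. A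
    weight that is singular at one point can therefore be set to 0 there and stays in the class. *)
Lemma nnlsc_EFin (f : T -> R) : (forall x, 0 <= f x)%R ->
  (forall x, f x = 0%R \/ {for x, continuous f}) -> nnlsc (fun x => (f x)%:E).
Proof.
move=> f0 cf; split=> [x|x a]; first by rewrite lee_fin.
rewrite lte_fin => afx; have [fx0|cfx] := cf x.
  exists setT; first exact: filterT.
  by move=> y _; rewrite lte_fin (lt_le_trans afx)// fx0.
exists [set y | (a < f y)%R]; last by move=> y.
exact: (cfx [set z | (a < z)%R] (lt_nbhsr afx)).
Qed.

Lemma nnlscZ (k : R) f : (0 <= k)%R -> nnlsc f -> nnlsc (fun x => k%:E * f x).
Proof.
move=> k0 [f0 lf]; split=> [x|x a]; first by rewrite mule_ge0.
move: k0; rewrite le_eqVlt => /predU1P[<-|k0].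
  rewrite mul0e => a0; exists setT; first exact: filterT.
  by move=> y _; rewrite mul0e.
rewrite muleC -lte_pdivrMr// -EFinM => /lf[V xV fV]; exists V => // y /fV.
by rewrite EFinM lte_pdivrMr// muleC.
Qed.

Lemma nnlsc_sum (I : Type) (s : seq I) (F : I -> T -> \bar R) :
  (forall i, nnlsc (F i)) -> nnlsc (fun x => \sum_(i <- s) F i x).
Proof.
move=> lF; elim: s => [|i s ih].
  rewrite (_ : (fun _ => _) = (fun=> 0%R%:E)).
    by apply: nnlsc_EFin => // x; left.
  by apply/funext => x; rewrite big_nil.
rewrite (_ : (fun _ => _) = (fun x => F i x + \sum_(j <- s) F j x)).
  exact: nnlscD.
by apply/funext => x; rewrite big_cons.
Qed.

End Nnlsc.

Lemma nnlsc_measurable (R : realType) (f : R -> \bar R) :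
  nnlsc f -> measurable_fun setT f.
Proof. by case=> _ /lower_semicontinuous_measurable. Qed.

(** * Iterated integrals: lower semicontinuity, affine changes of variables, bounds *)

Section ParametricIntegral.
Variable R : realType.
Local Open Scope ereal_scope.
Local Notation mu := (@lebesgue_measure R).

Lemma nnlsc_slice (S T : topologicalType) (F : S * T -> \bar R) x :
  nnlsc F -> nnlsc (fun t => F (x, t)).
Proof.
move=> lF; apply: (@nnlsc_comp R _ T F (fun t => (x, t))) => //.
by move=> t; apply: cvg_pair; [exact: cvg_cst|exact: cvg_id].
Qed.

Lemma limn_einf_le (u : (\bar R)^nat) (l : \bar R) :
  (forall n, u n <= l) -> limn_einf u <= l.
Proof.
move=> ul; rewrite limn_einf_lim; apply: lime_le; first exact: is_cvg_einfs.
apply: nearW => n; apply: le_trans (ul n); apply: ereal_inf_lbound.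
by exists n => /=.
Qed.

Lemma limn_einf_ge (u : (\bar R)^nat) (l : \bar R) :
  (forall a : R, a%:E < l -> \forall n \near \oo, a%:E <= u n) -> l <= limn_einf u.
Proof.
move=> ul.
have key a : a%:E < l -> a%:E <= limn_einf u.
  move=> /ul[N _ Nu]; rewrite limn_einf_lim.
  apply: lime_ge; first exact: is_cvg_einfs.
  exists N => // n /= Nn; apply: le_ereal_inf_tmp => _ [m /= nm <-].
  by apply: Nu => /=; rewrite (leq_trans Nn).
case: l ul key => [r| |] _ key //.
- apply/lee_subgt0Pr => e e0; rewrite -EFinB; apply: key.
  by rewrite lte_fin ltrBlDr ltrDl.
- by rewrite leye_eq; apply/eqP/eqyP => A A0; apply: key; rewrite ltry.
- exact: leNye.
Qed.

(* Fatou's lemma along a sequence converging to the parameter. *)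
Lemma nnlsc_integral (T : pseudoMetricType R) (F : T * R -> \bar R) :
  nnlsc F -> nnlsc (fun x => \int[mu]_(t in setT) F (x, t)).
Proof.
move=> lF; split=> [x|x a aI].
  by apply: integral_ge0 => t _; exact: nnlsc_ge0.
apply: contrapT => noV.
have /choice[y yP] : forall n : nat, exists y, ball x (n.+1%:R^-1 : R) y /\
    \int[mu]_(t in setT) F (y, t) <= a%:E.
  move=> n; apply: contrapT => noy; apply: noV.
  exists (ball x (n.+1%:R^-1 : R)); first by apply: nbhsx_ballx; rewrite invr_gt0.
  move=> y xy; rewrite ltNge; apply/negP => Ia; apply: noy; by exists y.
have yx : y n @[n --> \oo] --> x.
  apply/cvg_ballP => e e0; near=> n.
  apply: le_ball (yP n).1.
  by apply/ltW; near: n; exact: (near_infty_natSinv_lt (PosNum e0)).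
have mF n : measurable_fun setT (fun t => F (y n, t)).
  by apply: nnlsc_measurable; exact: nnlsc_slice.
have F0 n t : setT t -> 0 <= F (y n, t) by move=> _; exact: nnlsc_ge0.
have := @fatou _ _ R mu setT measurableT (fun n t => F (y n, t)) mF F0.
apply/negP; rewrite -ltNge.
apply: (@le_lt_trans _ _ a%:E).
  by apply: limn_einf_le => n; exact: (yP n).2.
apply: (lt_le_trans aI).
apply: ge0_le_integral => //.
- by move=> t _; exact: nnlsc_ge0.
- by apply: nnlsc_measurable; exact: nnlsc_slice.
- apply: (@emeasurable_fun_cvg _ _ _ _ (fun n t => einfs (fun m => F (y m, t)) n)).
    by move=> n; exact: (measurable_fun_einfs mF).
  by move=> t _; rewrite limn_einf_lim; exact: is_cvg_einfs.
move=> t _; apply: limn_einf_ge => b bF.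
have [V xV FV] := lF.2 (x, t) b bF.
have yxt : (y n, t) @[n --> \oo] --> (x, t).
  by apply: cvg_to_pair => //; exact: cvg_cst.
by apply: (@filterS _ \oo _ (fun k => V (y k, t))) (yxt _ xV) => k /FV /ltW.
Unshelve. all: by end_near. Qed.

Lemma cvg_mx (T : Type) (F : set_system T) {FF : Filter F} m n
    (f : T -> 'M[R]_(m, n)) (M : 'M[R]_(m, n)) :
  (forall i j, f x i j @[x --> F] --> M i j) -> f x @[x --> F] --> M.
Proof.
move=> fM A [P MP PA]; apply: (@filterS _ _ _ (fun x => forall i j, P i j (f x i j))).
  by move=> x Px; exact: PA.
apply: filter_forall => i; apply: filter_forall => j.
exact: (fM i j _ (MP i j)).
Qed.

Lemma row_mx_continuous n :
  continuous (fun z : R * 'rV[R]_n => row_mx (const_mx z.1 : 'rV[R]_1) z.2).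
Proof.
move=> z; apply: cvg_mx => i j.
rewrite -[j]splitK; case: (fintype.split j) => k /=.
  rewrite (_ : (fun _ => _) = fst) => [|]; first by rewrite row_mxEl mxE; exact: cvg_fst.
  by apply/funext => y; rewrite row_mxEl mxE.
rewrite (_ : (fun _ => _) = (fun y : R * 'rV[R]_n => y.2 i k)).
  rewrite row_mxEr; apply: (@cvg_comp _ _ _ snd (fun w : 'rV[R]_n => w i k) _ (nbhs z.2)).
    exact: cvg_snd.
  exact: coord_continuous.
by apply/funext => y; rewrite row_mxEr.
Qed.

(** The induction moves the first coordinate of the row into the parameter, so it runs over all
    parameter spaces [T] at once. Joint lower semicontinuity survives each integration by
    [nnlsc_integral]. *)
Lemma nnlsc_lebN n (T : pseudoMetricType R) (F : T * 'rV[R]_n -> \bar R) :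
  nnlsc F -> nnlsc (fun x => lebN (fun v => F (x, v))).
Proof.
elim: n T F => [|n ih] T F lF /=.
  by apply: (@nnlsc_comp R _ _ F (fun x => (x, 0%R))) => // x; apply: cvg_to_pair => //; exact: cvg_cst.
pose G (y : T * R) := lebN (fun v : 'rV[R]_n => F (y.1, row_mx (const_mx y.2 : 'rV[R]_1) v)).
apply: (@nnlsc_integral T G).
pose H (w : (T * R) * 'rV[R]_n) := F (w.1.1, row_mx (const_mx w.1.2 : 'rV[R]_1) w.2).
apply: (ih _ H); rewrite /H.
have cH : continuous (fun w : (T * R) * 'rV[R]_n => (w.1.1, row_mx (const_mx w.1.2 : 'rV[R]_1) w.2)).
  move=> w; apply: cvg_to_pair.
    by apply: cvg_comp; [exact: cvg_fst|exact: cvg_fst].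
  pose p (w : (T * R) * 'rV[R]_n) := (w.1.2, w.2).
  apply: (@continuous_comp _ _ _ p (fun z => row_mx (const_mx z.1 : 'rV[R]_1) z.2)).
    apply: cvg_to_pair; last exact: cvg_snd.
    by apply: cvg_comp; [exact: cvg_fst|exact: cvg_snd].
  exact: row_mx_continuous.
exact: (nnlsc_comp cH lF).
Qed.

Lemma nnlsc_row n (F : 'rV[R]_n.+1 -> \bar R) (x : R) :
  nnlsc F -> nnlsc (fun v : 'rV[R]_n => F (row_mx (const_mx x : 'rV[R]_1) v)).
Proof.
move=> lF; apply: (@nnlsc_slice R _ (fun z => F (row_mx (const_mx z.1 : 'rV[R]_1) z.2))).
by apply: (nnlsc_comp _ lF); exact: row_mx_continuous.
Qed.

Lemma nnlsc_head n (F : 'rV[R]_n.+1 -> \bar R) :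
  nnlsc F -> nnlsc (fun x : R => lebN (fun v : 'rV[R]_n => F (row_mx (const_mx x : 'rV[R]_1) v))).
Proof.
move=> lF; apply: (@nnlsc_lebN _ _ (fun z => F (row_mx (const_mx z.1 : 'rV[R]_1) z.2))).
by apply: (nnlsc_comp _ lF); exact: row_mx_continuous.
Qed.

Lemma lebN_ge0 n (F : 'rV[R]_n -> \bar R) : (forall v, 0 <= F v) -> 0 <= lebN F.
Proof.
elim: n F => [|n ih] F F0 /=; first exact: F0.
by apply: integral_ge0 => x _; apply: ih => v; exact: F0.
Qed.

Lemma lebN_le n (F G : 'rV[R]_n -> \bar R) : nnlsc F -> nnlsc G ->
  (forall v, F v <= G v) -> lebN F <= lebN G.
Proof.
elim: n F G => [|n ih] F G lF lG FG /=; first exact: FG.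
apply: ge0_le_integral => //.
- by move=> x _; apply: lebN_ge0 => v; exact: nnlsc_ge0.
- by apply: nnlsc_measurable; exact: nnlsc_head.
- by apply: nnlsc_measurable; exact: nnlsc_head.
- by move=> x _; apply: ih => //; exact: nnlsc_row.
Qed.

Lemma lebND n (F G : 'rV[R]_n -> \bar R) : nnlsc F -> nnlsc G ->
  lebN (fun v => F v + G v) = lebN F + lebN G.
Proof.
elim: n F G => [//|n ih] F G lF lG /=.
rewrite -ge0_integralD//.
- by apply: eq_integral => x _; rewrite ih//; exact: nnlsc_row.
- by move=> x _; apply: lebN_ge0 => v; exact: nnlsc_ge0.
- by apply: nnlsc_measurable; exact: nnlsc_head.
- by move=> x _; apply: lebN_ge0 => v; exact: nnlsc_ge0.
- by apply: nnlsc_measurable; exact: nnlsc_head.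
Qed.

Lemma lebNZ n (k : R) (F : 'rV[R]_n -> \bar R) : (0 <= k)%R -> nnlsc F ->
  lebN (fun v => k%:E * F v) = k%:E * lebN F.
Proof.
move=> k0; elim: n F => [//|n ih] F lF /=.
rewrite -ge0_integralZl//.
- by apply: eq_integral => x _; rewrite ih//; exact: nnlsc_row.
- by apply: nnlsc_measurable; exact: nnlsc_head.
- by move=> x _; apply: lebN_ge0 => v; exact: nnlsc_ge0.
Qed.

(** By uniqueness of Lebesgue measure it suffices that a times the push-forward gives each interval
    ]u, v] its length. *)
Lemma lebesgue_measure_affine (a b : R) (A : set R) : (0 < a)%R -> measurable A ->
  mu A = a%:E * mu ((fun t => a * t + b)%R @^-1` A).
Proof.
move=> a0 mA.
have mphi : measurable_fun setT (fun t : measurableTypeR R => a * t + b : measurableTypeR R)%R.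
  by apply: measurable_funD => //; exact: measurable_funM.
pose phi := (fun t : measurableTypeR R => a * t + b : measurableTypeR R)%R.
have /(_ mphi) := @lebesgue_measure_unique R (mscale (NngNum (ltW a0)) (pushforward mu phi)).
move=> /(_ _ A mA) -> // _ [[u v]] _ <- /=.
rewrite /mscale/= /pushforward.
rewrite (_ : phi @^-1` _ = `]((u - b) / a)%R, ((v - b) / a)%R]%classic).
  rewrite !lebesgue_measure_itv/= !lte_fin ltr_pM2r ?invr_gt0// ltrD2r.
  case: ifPn => _; last by rewrite mule0.
  by rewrite -!EFinB -EFinM; congr EFin; field; rewrite gt_eqF.
apply/seteqP; split=> t /=; rewrite !in_itv/= /phi ltr_pdivrMr// ler_pdivlMr// ltrBlDr lerBrDr.
  by rewrite mulrC.
by rewrite mulrC.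
Qed.

Lemma ge0_integral_affine (a b : R) (f : R -> \bar R) : (0 < a)%R ->
  measurable_fun (setT : set (measurableTypeR R)) f -> (forall t, 0 <= f t) ->
  \int[mu]_(t in setT) f t = a%:E * \int[mu]_(t in setT) f (a * t + b)%R.
Proof.
move=> a0 mf f0.
have mphi : measurable_fun setT (fun t : measurableTypeR R => a * t + b : measurableTypeR R)%R.
  by apply: measurable_funD => //; exact: measurable_funM.
pose phi := (fun t : measurableTypeR R => a * t + b : measurableTypeR R)%R.
pose m := mscale (NngNum (ltW a0)) (pushforward mu phi).
transitivity (\int[m mphi]_(t in setT) f t).
  apply: eq_measure_integral => A mA _; exact: lebesgue_measure_affine.
rewrite ge0_integral_mscale// ge0_integral_pushforward//.
Qed.

Lemma nnlsc_affine n (a : R) (b : 'rV[R]_n) (F : 'rV[R]_n -> \bar R) :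
  nnlsc F -> nnlsc (fun v : 'rV[R]_n => F (a *: v + b)%R).
Proof.
move=> lF; apply: (@nnlsc_comp R _ _ F (fun v : 'rV[R]_n => a *: v + b)%R) => // v.
apply: (@continuousD _ _ _ (fun v : 'rV[R]_n => a *: v)%R (fun=> b)); last exact: cst_continuous.
exact: scaler_continuous.
Qed.

(** One coordinate at a time, each contributing a factor a; the tail of b serves for the remaining
    coordinates. The left translations of the group are compositions of such maps. *)
Lemma lebN_affine n (a : R) (b : 'rV[R]_n) (F : 'rV[R]_n -> \bar R) :
  (0 < a)%R -> nnlsc F ->
  lebN F = (a ^+ n)%:E * lebN (fun v : 'rV[R]_n => F (a *: v + b)%R).
Proof.
move=> a0; elim: n b F => [|n ih] b F lF.
  rewrite expr0 mul1e /=; congr F; apply/rowP; case=> //.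
rewrite [LHS]/= (@ge0_integral_affine a (b 0 0)%R)//; last 2 first.
- by apply: nnlsc_measurable; exact: nnlsc_head.
- by move=> t; apply: lebN_ge0 => v; exact: nnlsc_ge0.
rewrite exprS EFinM -muleA; congr (_ * _) => /=.
rewrite -ge0_integralZl//; last 3 first.
- by apply: nnlsc_measurable; exact: nnlsc_head (nnlsc_affine a b lF).
- by move=> t _; apply: lebN_ge0 => v; exact: nnlsc_ge0.
- by rewrite lee_fin exprn_ge0// ltW.
apply: eq_integral => t _.
pose b' : 'rV[R]_n := (\row_j b 0 (lift ord0 j))%R.
rewrite (ih b'); last exact: nnlsc_row.
congr (_ * lebN _); apply/funext => v; congr F.
apply/rowP => j; rewrite !mxE; case: splitP => k jk; rewrite !mxE.
  by congr (_ + b _ _)%R; apply/val_inj; rewrite /= jk ord1.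
by congr (_ + b _ _)%R; apply/val_inj; rewrite /= jk.
Qed.

(** The support lies in a cube of side 2 rho. The purpose is finiteness, which is what allows
    integrals to be subtracted as extended reals. *)
Lemma lebN_bound n (F : 'rV[R]_n -> \bar R) (M rho : R) : (0 <= M)%R -> (0 <= rho)%R ->
  nnlsc F -> (forall v, F v <= M%:E) ->
  (forall (v : 'rV[R]_n) i, (rho <= `|v ord0 i|)%R -> F v = 0) ->
  lebN F <= (M * (2 * rho) ^+ n)%:E.
Proof.
move=> M0 rho0; elim: n F => [|n ih] F lF FM Fsupp /=; first by rewrite expr0 mulr1.
pose c : R := (M * (2 * rho) ^+ n)%R.
have c0 : (0 <= c)%R by rewrite mulr_ge0// exprn_ge0// mulr_ge0.
pose D := `[(- rho)%R, rho]%classic : set R.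
have mD : measurable (D : set (measurableTypeR R)) by exact: measurable_itv.
apply: (@le_trans _ _ (\int[mu]_(t in D) c%:E)).
  rewrite [leRHS]integral_mkcond; apply: ge0_le_integral => //.
  - by move=> t _; apply: lebN_ge0 => v; exact: nnlsc_ge0.
  - by apply: nnlsc_measurable; exact: nnlsc_head.
  - by apply/(measurable_restrictT _ _).1 => //; exact: measurable_cst.
  move=> t _; rewrite patchE; case: ifPn => [_|].
    apply: ih.
    - exact: nnlsc_row.
    - by move=> v; exact: FM.
    - move=> v i vi; apply: (Fsupp _ (rshift 1 i)).
      by rewrite -(row_mxEr (const_mx t : 'rV[R]_1) v) in vi.
  rewrite notin_setE /D /= in_itv/= => /negP; rewrite -ler_norml -ltNge => tr.
  have F0 v : F (row_mx (const_mx t : 'rV[R]_1) v) = 0.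
    apply: (Fsupp _ (lshift n (ord0 : 'I_1))).
    have E : row_mx (const_mx t : 'rV[R]_1) v ord0 (lshift n (ord0 : 'I_1)) = t.
      by rewrite row_mxEl mxE.
    by apply: (le_trans (ltW tr)); rewrite -[in leLHS]E; exact: lexx.
  apply: (@le_trans _ _ (lebN (fun _ : 'rV[R]_n => 0))).
    by under eq_fun do rewrite F0.
  rewrite (_ : lebN _ = 0)//.
  by elim: (n) => //= m ->; exact: integral0.
rewrite integral_cst//= lebesgue_measure_itv/= lte_fin.
case: ifPn => _; last by rewrite mule0 lee_fin mulr_ge0// exprn_ge0// mulr_ge0.
by rewrite -EFinB -EFinM lee_fin /c exprS; lra.
Qed.

End ParametricIntegral.

(** * Directional derivatives and C^1 functions *)

Lemma is_derive_chain (R : realType) (V U W : normedModType R) (f : U -> W) (g : V -> U) (x v : V) :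
  differentiable g x -> differentiable f (g x) ->
  is_derive x v (fun y => f (g y)) ('D_('D_v g x) f (g x)).
Proof.
move=> dg df; have dfg : differentiable (f \o g) x by exact: differentiable_comp.
apply: DeriveDef; first exact: diff_derivable.
by rewrite (deriveE _ dfg) diff_comp//= (deriveE _ df) (deriveE _ dg).
Qed.

Section Calculus.
Variables (R : realType) (V : normedModType R).
Implicit Types (f g : V -> R) (x v : V).

Lemma is_derive_scalel (W : normedModType R) f (w : W) x v df :
  is_derive x v f df -> is_derive x v (fun y => f y *: w) (df *: w).
Proof.
move=> [dfx <-].
have cvgf : h^-1 *: (f (h *: v + x) *: w - f x *: w) @[h --> 0^'] --> 'D_v f x *: w.
  rewrite (_ : (fun h => _) = (fun h => (h^-1 *: (f (h *: v + x) - f x)) *: w)).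
    exact: cvgZr_tmp.
  by apply/funext => h; rewrite -scalerBl scalerA.
by apply: DeriveDef; [apply/cvg_ex; eexists; exact: cvgf|exact: cvg_lim cvgf].
Qed.

Lemma is_derive_mul f g x v df dg : is_derive x v f df -> is_derive x v g dg ->
  is_derive x v (fun y => f y * g y) (df * g x + f x * dg).
Proof.
move=> hf hg; apply: (is_derive_eq (is_deriveM hf hg)).
by rewrite /GRing.scale/= addrC (mulrC df).
Qed.

Lemma is_derive_add f g x v df dg : is_derive x v f df -> is_derive x v g dg ->
  is_derive x v (fun y => f y + g y) (df + dg).
Proof. by move=> hf hg; exact: is_deriveD. Qed.

Lemma is_derive_sub f g x v df dg : is_derive x v f df -> is_derive x v g dg ->
  is_derive x v (fun y => f y - g y) (df - dg).
Proof. by move=> hf hg; exact: is_deriveB. Qed.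

Lemma is_derive_const (c : R) x v : is_derive x v (fun _ => c) 0.
Proof. exact: is_derive_cst. Qed.

Lemma is_derive_bigsum (I : Type) (s : seq I) (F : I -> V -> R) (dF : I -> R) x v :
  (forall i, is_derive x v (F i) (dF i)) ->
  is_derive x v (fun y => \sum_(i <- s) F i y) (\sum_(i <- s) dF i).
Proof.
move=> hF; elim: s => [|i s ih].
  rewrite big_nil (_ : (fun _ => _) = (fun=> 0)); first exact: is_derive_const.
  by apply/funext => y; rewrite big_nil.
rewrite big_cons (_ : (fun _ => _) = (fun y => F i y + \sum_(j <- s) F j y)).
  exact: is_derive_add.
by apply/funext => y; rewrite big_cons.
Qed.

(** Here f only has a derivative along v. The chain rule is applied on the line h -> h v + x, where
    that derivative amounts to differentiability in one variable. *)
Lemma is_derive_comp1 (k : R -> R) f x v dk df :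
  is_derive x v f df -> is_derive (f x) (1 : R) k dk ->
  is_derive x v (fun y => k (f y)) (dk * df).
Proof.
move=> [dfx <-] [dkx <-].
have cv : h^-1 *: (k (f (h *: v + x)) - k (f x)) @[h --> 0^'] --> 'D_1 k (f x) * 'D_v f x.
  have df1 : differentiable (fun h : R => f (h *: v + x)) 0.
    by apply/derivable1_diffP; exact: (derivable1P _ _ _).1 dfx.
  have dk1 : differentiable k (f ((0 : R) *: v + x)).
    by rewrite scale0r add0r; apply/derivable1_diffP.
  have [/= + e] := is_derive_chain (1 : R) df1 dk1.
  rewrite /derivable => /cvg_ex[l hl].
  have el : l = 'D_1 k (f x) * 'D_v f x.
    have <- : 'D_1 (fun h : R => k (f (h *: v + x))) 0 = l by exact: cvg_lim hl.
    rewrite e scale0r add0r.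
    have -> : 'D_1 (fun h : R => f (h *: v + x)) 0 = 'D_v f x.
      rewrite /derive; set g1 := (fun h => _); set g2 := (fun h => _).
      suff -> : g1 = g2 by [].
      apply/funext => h; rewrite /g1 /g2 /=.
      by rewrite addr0 scale0r add0r [_%:A]mulr1.
    move/derivable1_diffP: dkx => dkx.
    rewrite !(deriveE _ dkx) -[X in 'd k _ X = _]mulr1 [LHS]linearZ/=.
    by rewrite mulrC.
  rewrite -el; move: hl; set g1 := (fun h => _).
  have -> // : g1 = (fun h : R => h^-1 *: (k (f (h *: v + x)) - k (f x))).
  by apply/funext => h; rewrite /g1 /= addr0 scale0r add0r [_%:A]mulr1.
by apply: DeriveDef; [apply/cvg_ex; eexists; exact: cv|exact: cvg_lim cv].
Qed.

(** Continuity is asked of each directional derivative separately rather than of the differential: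
    this is what smoothness by iterated directional derivatives provides and what difference
    quotients use. *)
Definition C1 f := (forall x, differentiable f x) /\ (forall v, continuous ('D_v f)).

Lemma C1_derive f x v : C1 f -> is_derive x v f ('D_v f x).
Proof. by case=> df _; apply/derivableP/diff_derivable. Qed.

Lemma C1_continuous f : C1 f -> continuous f.
Proof. by case=> df _ x; exact: differentiable_continuous. Qed.

Lemma C1_intro f (df : V -> V -> R) : (forall x, differentiable f x) ->
  (forall x v, is_derive x v f (df x v)) -> (forall v, continuous (df^~ v)) -> C1 f.
Proof.
move=> hf hd hc; split => // v; rewrite (_ : 'D_v f = df^~ v) //.
by apply/funext => x; have [_ ->] := hd x v.
Qed.

Lemma C1_cst (c : R) : C1 (fun _ => c).
Proof.
apply: (@C1_intro _ (fun _ _ => 0)) => [x|v x].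
  exact: differentiable_cst.
exact: cvg_cst.
Qed.

Lemma C1D f g : C1 f -> C1 g -> C1 (fun y => f y + g y).
Proof.
move=> hf hg; apply: (@C1_intro _ (fun x v => 'D_v f x + 'D_v g x)) => [x|x v|v x].
- by apply: differentiableD; [exact: hf.1|exact: hg.1].
- by apply: is_derive_add; exact: C1_derive.
- by apply: cvgD; [exact: hf.2|exact: hg.2].
Qed.

Lemma C1M f g : C1 f -> C1 g -> C1 (fun y => f y * g y).
Proof.
move=> hf hg; apply: (@C1_intro _ (fun x v => 'D_v f x * g x + f x * 'D_v g x)) => [x|x v|v x].
- by apply: differentiableM; [exact: hf.1|exact: hg.1].
- by apply: is_derive_mul; exact: C1_derive.
- apply: cvgD; apply: cvgM; [exact: hf.2|exact: C1_continuous|exact: C1_continuous|exact: hg.2].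
Qed.

Lemma C1Z (c : R) f : C1 f -> C1 (fun y => c * f y).
Proof. by move=> hf; apply: C1M => //; exact: C1_cst. Qed.

Lemma C1B f g : C1 f -> C1 g -> C1 (fun y => f y - g y).
Proof.
move=> hf /(C1Z (-1)) hg.
rewrite (_ : (fun y => _) = (fun y => f y + -1 * g y)); first exact: C1D.
by apply/funext => y; rewrite mulN1r.
Qed.

Lemma C1_bigsum (I : Type) (s : seq I) (F : I -> V -> R) :
  (forall i, C1 (F i)) -> C1 (fun y => \sum_(i <- s) F i y).
Proof.
move=> hF; elim: s => [|i s ih].
  rewrite (_ : (fun _ => _) = (fun=> 0)); first exact: C1_cst.
  by apply/funext => y; rewrite big_nil.
rewrite (_ : (fun _ => _) = (fun y => F i y + \sum_(j <- s) F j y)).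
  exact: C1D.
by apply/funext => y; rewrite big_cons.
Qed.

Lemma C1_comp (k dk : R -> R) f : (forall y, is_derive y (1 : R) k (dk y)) ->
  continuous dk -> C1 f -> C1 (fun y => k (f y)).
Proof.
move=> hk ck hf; apply: (@C1_intro _ (fun x v => dk (f x) * 'D_v f x)) => [x|x v|v x].
- apply: (@differentiable_comp _ _ _ _ f k); first exact: hf.1.
  by apply/derivable1_diffP; case: (hk (f x)).
- by apply: is_derive_comp1 => //; exact: C1_derive.
- apply: cvgM; last exact: hf.2.
  by apply: (@continuous_comp _ _ _ f dk); [exact: C1_continuous|exact: ck].
Qed.

Lemma linear_C1 f : (forall (a : R) y z, f (a *: y + z) = a * f y + f z) ->
  continuous f -> C1 f /\ forall x v, is_derive x v f (f v).
Proof.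
move=> lf cf.
have lin : linear_for *%R f by move=> a y z; exact: lf.
pose Lm := GRing.isLinear.Build _ _ _ _ _ lin.
pose L : {linear V -> R} := HB.pack f Lm.
have hd x : differentiable f x.
  exact: (@linear_differentiable _ _ _ L).
have hD x v : is_derive x v f (f v).
  apply: DeriveDef; first exact: diff_derivable.
  by rewrite (deriveE _ (hd x)) (@diff_lin _ _ _ L).
split => //; apply: (@C1_intro _ (fun _ v => f v)) => // v x.
exact: cvg_cst.
Qed.

End Calculus.

Lemma continuous_fst_comp (S A B : topologicalType) (f : S -> A * B) x :
  {for x, continuous f} -> {for x, continuous (fun y => (f y).1)}.
Proof. by move=> cf; apply: continuous_comp cf _; exact: cvg_fst. Qed.

Lemma continuous_snd_comp (S A B : topologicalType) (f : S -> A * B) x :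
  {for x, continuous f} -> {for x, continuous (fun y => (f y).2)}.
Proof. by move=> cf; apply: continuous_comp cf _; exact: cvg_snd. Qed.

(** * Integration over the group *)

Section DRIntegral.
Variables (R : realType) (p q : nat).
Local Notation X := (DRpt R p q).
Local Notation mu := (@lebesgue_measure R).
Local Open Scope ereal_scope.

(** Integration in the linear coordinates without the Riemannian density, hence invariant under
    translations of the vector space; the density is carried by the integrand. *)
Definition DRleb (f : X -> \bar R) : \bar R :=
  lebN (fun V : 'rV[R]_p => lebN (fun Z : 'rV[R]_q =>
    \int[mu]_(t in setT) f (V, Z, t))).

Lemma nnlsc_DRt (f : X -> \bar R) V Z : nnlsc f -> nnlsc (fun t => f (V, Z, t)).
Proof. exact: nnlsc_slice. Qed.

Lemma nnlsc_DRVZ (f : X -> \bar R) : nnlsc f ->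
  nnlsc (fun y : 'rV[R]_p * 'rV[R]_q => \int[mu]_(t in setT) f (y, t)).
Proof. exact: nnlsc_integral. Qed.

Lemma nnlsc_DRZ (f : X -> \bar R) V : nnlsc f ->
  nnlsc (fun Z : 'rV[R]_q => \int[mu]_(t in setT) f (V, Z, t)).
Proof. by move=> /nnlsc_DRVZ/nnlsc_slice; exact. Qed.

Lemma nnlsc_DRV (f : X -> \bar R) : nnlsc f ->
  nnlsc (fun V : 'rV[R]_p => lebN (fun Z : 'rV[R]_q => \int[mu]_(t in setT) f (V, Z, t))).
Proof. by move=> /nnlsc_DRVZ/nnlsc_lebN; exact. Qed.

(** The passage to the limit under the integral. It is used twice: for the step of the difference
    quotients and for the cut-off parameter. *)
Lemma nnlsc_DRleb (T : pseudoMetricType R) (F : T * X -> \bar R) :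
  nnlsc F -> nnlsc (fun s => DRleb (fun x => F (s, x))).
Proof.
move=> lF.
pose F1 (w : (T * 'rV[R]_p * 'rV[R]_q) * R) := F (w.1.1.1, (w.1.1.2, w.1.2, w.2)).
have cF1 : continuous (fun w : (T * 'rV[R]_p * 'rV[R]_q) * R =>
    (w.1.1.1, (w.1.1.2, w.1.2, w.2))).
  move=> w.
  have c0 : {for w, continuous (fun w : (T * 'rV[R]_p * 'rV[R]_q) * R => w)} by exact: id.
  have c1 := continuous_fst_comp c0.
  have c2 := continuous_snd_comp c0.
  have c11 := continuous_fst_comp c1.
  have c12 := continuous_snd_comp c1.
  have c111 := continuous_fst_comp c11.
  have c112 := continuous_snd_comp c11.
  exact: (cvg_to_pair c111 (cvg_to_pair (cvg_to_pair c112 c12) c2)).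
have lF1 : nnlsc F1 by exact: (nnlsc_comp cF1 lF).
have := nnlsc_lebN (nnlsc_lebN (nnlsc_integral lF1)).
exact.
Qed.

Lemma DRleb_ge0 (f : X -> \bar R) : (forall x, 0 <= f x) -> 0 <= DRleb f.
Proof.
move=> f0; apply: lebN_ge0 => V; apply: lebN_ge0 => Z; exact: integral_ge0.
Qed.

Lemma DRleb_le (f g : X -> \bar R) : nnlsc f -> nnlsc g ->
  (forall x, f x <= g x) -> DRleb f <= DRleb g.
Proof.
move=> lf lg fg; apply: lebN_le => [||V]; [exact: nnlsc_DRV|exact: nnlsc_DRV|].
apply: lebN_le => [||Z]; [exact: nnlsc_DRZ|exact: nnlsc_DRZ|].
apply: ge0_le_integral => //.
- by move=> t _; exact: nnlsc_ge0.
- by apply: nnlsc_measurable; exact: nnlsc_DRt.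
- by apply: nnlsc_measurable; exact: nnlsc_DRt.
Qed.

Lemma DRlebD (f g : X -> \bar R) : nnlsc f -> nnlsc g ->
  DRleb (fun x => f x + g x) = DRleb f + DRleb g.
Proof.
move=> lf lg; rewrite -lebND; [|exact: nnlsc_DRV|exact: nnlsc_DRV].
congr lebN; apply/funext => V.
rewrite -lebND; [|exact: nnlsc_DRZ|exact: nnlsc_DRZ].
congr lebN; apply/funext => Z.
rewrite ge0_integralD//.
- by move=> t _; exact: nnlsc_ge0.
- by apply: nnlsc_measurable; exact: nnlsc_DRt.
- by move=> t _; exact: nnlsc_ge0.
- by apply: nnlsc_measurable; exact: nnlsc_DRt.
Qed.

Lemma DRlebZ (k : R) (f : X -> \bar R) : (0 <= k)%R -> nnlsc f ->
  DRleb (fun x => k%:E * f x) = k%:E * DRleb f.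
Proof.
move=> k0 lf; rewrite -lebNZ//; last exact: nnlsc_DRV.
congr lebN; apply/funext => V; rewrite -lebNZ//; last exact: nnlsc_DRZ.
congr lebN; apply/funext => Z; rewrite ge0_integralZl//.
- by apply: nnlsc_measurable; exact: nnlsc_DRt.
- by move=> t _; exact: nnlsc_ge0.
Qed.

Lemma DRleb_sum (I : Type) (s : seq I) (F : I -> X -> \bar R) :
  (forall i, nnlsc (F i)) ->
  DRleb (fun x => \sum_(i <- s) F i x) = \sum_(i <- s) DRleb (F i).
Proof.
move=> lF; elim: s => [|i s ih].
  rewrite big_nil (_ : (fun _ => _) = (fun=> 0)); last by apply/funext => x; rewrite big_nil.
  have l0 : nnlsc (fun _ : X => (0%R : R)%:E) by apply: (@nnlsc_EFin R X (fun=> 0%R)) => // x; left.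
  rewrite (_ : (fun=> 0) = (fun x : X => 0%R%:E * (fun=> 0) x)); last by apply/funext => x; rewrite mul0e.
  by rewrite DRlebZ// mul0e.
rewrite big_cons -ih -DRlebD//; last exact: nnlsc_sum.
by congr DRleb; apply/funext => x; rewrite big_cons.
Qed.

Lemma DRleb_shift (f : X -> \bar R) (e : X) : nnlsc f ->
  DRleb (fun x => f (e + x)%R) = DRleb f.
Proof.
case: e => [[a b] c] lf; rewrite /DRleb.
rewrite [RHS](@lebN_affine _ _ 1%R a)//; last exact: nnlsc_DRV.
rewrite expr1n mul1e; congr lebN; apply/funext => V.
rewrite [RHS](@lebN_affine _ _ 1%R b)//; last exact: nnlsc_DRZ.
rewrite expr1n mul1e; congr lebN; apply/funext => Z.
rewrite [RHS](@ge0_integral_affine _ 1%R c)//; last 2 first.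
- by apply: nnlsc_measurable; exact: nnlsc_DRt.
- by move=> t; exact: nnlsc_ge0.
rewrite mul1e; apply: eq_integral => t _; congr f.
by rewrite !scale1r mul1r ![(_ + c)%R]addrC ![(_ + a)%R]addrC ![(_ + b)%R]addrC.
Qed.

Lemma coord_le_norm n (v : 'rV[R]_n) i : (`|v ord0 i| <= `|v|)%R.
Proof.
rewrite [leRHS]/Num.Def.normr/= mx_normrE.
exact: (le_bigmax _ (fun ij : 'I_1 * 'I_n => `|v ij.1 ij.2|%R) (ord0, i)).
Qed.

Lemma DRleb_lty (f : X -> \bar R) (M rho : R) : (0 <= M)%R -> (0 <= rho)%R ->
  nnlsc f -> (forall x, f x <= M%:E) -> (forall x : X, (rho <= `|x|)%R -> f x = 0) ->
  DRleb f < +oo.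
Proof.
move=> M0 r0 lf fM f0.
have nV (x : X) : (`|x.1.1| <= `|x|)%R.
  by rewrite [leRHS]prod_normE le_max prod_normE le_max lexx.
have nZ (x : X) : (`|x.1.2| <= `|x|)%R.
  by rewrite [leRHS]prod_normE le_max prod_normE le_max lexx orbT.
have nt (x : X) : (`|x.2| <= `|x|)%R by rewrite [leRHS]prod_normE le_max lexx orbT.
(* The integral over t is read as an iterated integral over rows of length 1, so that [lebN_bound]
   applies to it too. *)
have fin1 V Z : \int[mu]_(t in setT) f (V, Z, t) <= (M * (2 * rho) ^+ 1)%:E.
  have := @lebN_bound R 1 (fun v : 'rV[R]_1 => f (V, Z, v ord0 ord0)) M rho M0 r0.
  have -> : lebN (fun v : 'rV[R]_1 => f (V, Z, v ord0 ord0)) = \int[mu]_(t in setT) f (V, Z, t).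
    apply: eq_integral => t _ /=; congr (f (V, Z, _)).
    by rewrite !mxE; case: splitP => [k _|[]//]; rewrite mxE.
  apply.
  - by apply: (nnlsc_comp _ (nnlsc_DRt V Z lf)) => v; exact: coord_continuous.
  - by move=> v; exact: fM.
  - by move=> v i; rewrite (ord1 i) => vr; apply: f0; apply: le_trans vr (nt (V, Z, v ord0 ord0)).
have fin2 V : lebN (fun Z : 'rV[R]_q => \int[mu]_(t in setT) f (V, Z, t)) <=
    (M * (2 * rho) ^+ 1 * (2 * rho) ^+ q)%:E.
  apply: lebN_bound => //.
  - by rewrite mulr_ge0// exprn_ge0// mulr_ge0.
  - exact: nnlsc_DRZ.
  - move=> Z i Zr; rewrite (eq_integral (fun=> 0)) ?integral0// => t _.
    by apply: f0; rewrite (le_trans Zr)// (le_trans (coord_le_norm _ _))//; exact: (nZ (V, Z, t)).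
apply: (@le_lt_trans _ _ (M * (2 * rho) ^+ 1 * (2 * rho) ^+ q * (2 * rho) ^+ p)%:E); last exact: ltry.
apply: lebN_bound => //.
- by rewrite mulr_ge0// ?exprn_ge0// mulr_ge0// ?exprn_ge0// ?mulr_ge0.
- exact: nnlsc_DRV.
move=> V i Vr.
have h0 Z : \int[mu]_(t in setT) f (V, Z, t) = 0.
  rewrite (eq_integral (fun=> 0)) ?integral0// => t _.
  by apply: f0; rewrite (le_trans Vr)// (le_trans (coord_le_norm _ _))//; exact: (nV (V, Z, t)).
under eq_fun do rewrite h0.
by elim: (q) => //= m ->; exact: integral0.
Qed.

(** On each line in the t direction the point t0 is negligible. With t0 the height of the base
    point, this frees the singular weights from the value that division by 0 gives them there. *)
Lemma eq_DRleb_mask (f g : X -> \bar R) (t0 : R) : nnlsc g ->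
  (forall x : X, x.2 != t0 -> f x = g x) -> DRleb f = DRleb g.
Proof.
move=> lg fg; congr lebN; apply/funext => V; congr lebN; apply/funext => Z.
have mg : measurable_fun (setT `\ t0) (fun t => g (V, Z, t)).
  by apply: measurable_funS (nnlsc_measurable (nnlsc_DRt V Z lg)).
have mD : measurable (setT `\ t0 : set (measurableTypeR R)).
  by apply: measurableD => //; exact: measurable_set1.
have e t : t \in (setT `\ t0) -> f (V, Z, t) = g (V, Z, t).
  by rewrite inE => -[_ /= tt0]; apply: fg; apply/eqP.
rewrite -(@integral_setD1 _ _ t0)//; last first.
  by apply: eq_measurable_fun mg => t /e.
rewrite -[RHS](@integral_setD1 _ _ t0)//.
exact: eq_integral.
Qed.

(** The difference quotient of b integrates to 0 because translation preserves the integral. As only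
    non-negative functions are integrated, chi is added to make the integrand non-negative and b / s
    is split into its positive and negative parts, whose integrals are finite and can be
    cancelled. *)
Lemma DRleb_translate_cancel (b chi : X -> R) (e : X) (s : R) : (0 < s)%R ->
  continuous b -> continuous chi -> (forall x, 0 <= chi x)%R ->
  (exists2 rho : R, 0 <= rho & forall x : X, rho <= `|x| -> b x = 0)%R ->
  (exists M : R, forall x, `|b x| <= M)%R ->
  (forall x, 0 <= (b (e + x) - b x) / s + chi x)%R ->
  DRleb (fun x => ((b (e + x) - b x) / s + chi x)%:E) = DRleb (fun x => (chi x)%:E).
Proof.
move=> s0 cb cchi chi0 [rho r0 b0] [M bM] q0.
pose bp x := (Num.max (b x) 0 / s)%R; pose bn x := (Num.max (- b x) 0 / s)%R.
have bE x : (bp x - bn x = b x / s)%R.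
  rewrite /bp /bn -mulrBl; congr (_ / _)%R.
  by rewrite !maxEle; case: ifP; case: ifP; lra.
have bp0 x : (0 <= bp x)%R by rewrite divr_ge0 ?(ltW s0)// le_max lexx orbT.
have bn0 x : (0 <= bn x)%R by rewrite divr_ge0 ?(ltW s0)// le_max lexx orbT.
have cmax (h : X -> R) : continuous h -> continuous (fun x => Num.max (h x) 0 / s)%R.
  move=> ch x; apply: (@continuousM _ _ (fun x => Num.max (h x) 0)%R (fun=> s^-1)%R); last exact: cst_continuous.
  by apply: continuous_max; [exact: ch|exact: cst_continuous].
have cbp : continuous bp by exact: cmax.
have cbn : continuous bn by apply: (cmax (fun x => - b x)%R) => x; apply: continuousN; exact: cb.
have lE (h : X -> R) : continuous h -> (forall x, 0 <= h x)%R -> nnlsc (fun x => (h x)%:E).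
  by move=> ch h0; apply: nnlsc_EFin => // x; right; exact: ch.
have csh (h : X -> R) : continuous h -> continuous (fun x => h (e + x)%R).
  move=> ch x; apply: (@continuous_comp _ _ _ (fun x => e + x)%R h); last exact: ch.
  by apply: (@continuousD _ _ _ (fun=> e) (fun x => x)); [exact: cst_continuous|exact: id].
have fin (h : X -> R) : continuous h -> (forall x, 0 <= h x)%R ->
    (forall x, h x <= M / s)%R -> (forall x : X, rho <= `|x| -> h x = 0)%R ->
    DRleb (fun x => (h x)%:E) \is a fin_num.
  move=> ch h0 hM hs; rewrite ge0_fin_numE; last by apply: DRleb_ge0 => x; rewrite lee_fin.
  apply: (@DRleb_lty _ (M / s)%R rho) => //.
  - by rewrite divr_ge0// ?(ltW s0)// (le_trans _ (bM 0%R)).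
  - exact: lE.
  - by move=> x /hs ->.
have M0 : (0 <= M)%R by rewrite (le_trans _ (bM 0%R)).
have fbp : DRleb (fun x => (bp x)%:E) \is a fin_num.
  apply: fin => // x; last by move=> /b0 bx0; rewrite /bp bx0 maxxx mul0r.
  rewrite /bp ler_pM2r ?invr_gt0// ge_max M0 andbT.
  exact: le_trans (ler_norm _) (bM x).
have fbn : DRleb (fun x => (bn x)%:E) \is a fin_num.
  apply: fin => // x; last by move=> /b0 bx0; rewrite /bn bx0 oppr0 maxxx mul0r.
  rewrite /bn ler_pM2r ?invr_gt0// ge_max M0 andbT.
  by apply: le_trans (ler_norm _) _; rewrite normrN; exact: bM.
pose Q (x : X) := ((b (e + x) - b x) / s + chi x)%R.
change (DRleb (fun x => (Q x)%:E) = DRleb (fun x => (chi x)%:E)).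
have Q0 x : (0 <= Q x)%R by exact: q0.
have cQ : continuous Q.
  move=> x; apply: (@continuousD _ _ _ (fun x => (b (e + x) - b x) / s)%R chi); last exact: cchi.
  apply: (@continuousM _ _ (fun x => b (e + x) - b x)%R (fun=> s^-1)%R); last exact: cst_continuous.
  by apply: (@continuousB _ _ _ (fun x => b (e + x))%R b); [exact: csh|exact: cb].
(* Moving the negatively counted terms across yields an identity between sums of non-negative
   functions. *)
have key : DRleb (fun x => (Q x)%:E + ((bn (e + x)%R)%:E + (bp x)%:E)) =
           DRleb (fun x => (chi x)%:E + ((bp (e + x)%R)%:E + (bn x)%:E)).
  congr DRleb; apply/funext => x; rewrite -!EFinD; congr EFin.
  by rewrite /Q mulrBl -!bE; lra.
move: key; rewrite !DRlebD//; try (by apply: lE => //; exact: csh);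
  try (by apply: nnlscD; apply: lE => //; exact: csh).
rewrite (@DRleb_shift (fun x => (bn x)%:E)); last exact: lE.
rewrite (@DRleb_shift (fun x => (bp x)%:E)); last exact: lE.
rewrite [X in _ + X = _]addeC => /eqP.
have fbb : DRleb (fun x => (bp x)%:E) + DRleb (fun x => (bn x)%:E) \is a fin_num by rewrite fin_numD fbp.
by move=> /eqP /(congr1 (fun z => z - (DRleb (fun x => (bp x)%:E) + DRleb (fun x => (bn x)%:E)))); rewrite !addeK.
Qed.

End DRIntegral.

(** * Difference quotients and the divergence inequality *)

Section DifferenceQuotient.
Variables (R : realType) (V : normedModType R).
Implicit Types (b : V -> R) (e x : V).

(** The value at s = 0 is the limit, so that for C^1 functions the quotient is continuous jointly in
    the step and the point. *)
Definition dquot b e (s : R) x : R :=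
  if s == 0 then 'D_e b x else (b (s *: e + x) - b x) / s.

Lemma is_derive_line b e x (u : R) : C1 b ->
  is_derive u (1 : R) (fun s : R => b (s *: e + x)) ('D_e b (u *: e + x)).
Proof.
move=> cb.
have hg : is_derive u (1 : R) (fun s : R => s *: e + x) e.
  apply: is_derive_eq; last exact: addr0.
  apply: is_deriveD; rewrite -[X in is_derive _ _ _ X]scale1r.
  exact: is_derive_scalel.
have dg : differentiable (fun s : R => s *: e + x) u.
  by apply/derivable1_diffP; case: hg.
have := is_derive_chain (1 : R) dg (cb.1 (u *: e + x)).
by case: hg => _ ->.
Qed.

Lemma dquot_mvt b e s x : C1 b ->
  exists2 th : R, `|th| <= `|s| & dquot b e s x = 'D_e b (th *: e + x).
Proof.
move=> cb; rewrite /dquot; case: eqVneq => [->|s0].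
  by exists 0; rewrite ?normr0// scale0r add0r.
pose phi (u : R) := b (u *: e + x).
have hphi u : is_derive u (1 : R) phi ('D_e b (u *: e + x)) by exact: is_derive_line.
have cphi : continuous phi.
  by move=> u; apply/differentiable_continuous/derivable1_diffP; case: (hphi u).
have phi0 : phi 0 = b x by rewrite /phi scale0r add0r.
have [s_lt0|s_ge0] := ltP s 0.
  have [th] := MVT s_lt0 (fun u _ => hphi u) (continuous_subspaceT cphi).
  rewrite in_itv/= => /andP[s_th th0]; rewrite phi0 /phi => E.
  exists th; first by rewrite !ltr0_norm// lerN2 ltW.
  have -> : b (s *: e + x) - b x = 'D_e b (th *: e + x) * s by lra.
  by rewrite mulfK.
have s_gt0 : 0 < s by rewrite lt_def s0.
have [th] := MVT s_gt0 (fun u _ => hphi u) (continuous_subspaceT cphi).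
rewrite in_itv/= => /andP[th0 th_s]; rewrite phi0 /phi subr0 => E.
exists th; first by rewrite !gtr0_norm// ltW.
by rewrite E mulfK.
Qed.

(** Away from s = 0 this is continuity of a quotient. At s = 0 the mean value theorem turns the
    quotient into a derivative at th e + x with |th| <= |s|, a point close to x0. *)
Lemma dquot_continuous b e : C1 b ->
  continuous (fun w : R * V => dquot b e w.1 w.2).
Proof.
move=> cb [s0 x0]; have [->|s0N] := eqVneq s0 0.
  apply/cvgrPdist_lt => eps eps0 /=.
  have dq0 : dquot b e 0 x0 = 'D_e b x0 by rewrite /dquot eqxx.
  have /cvgrPdist_lt/(_ _ eps0)/nbhs_ballP[d /= d0 dP] := cb.2 e x0.
  (* A step shorter than [d1] moves the point by less than d / 2. *)
  pose d1 := d / 2 / (`|e| + 1).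
  have e1 : 0 < `|e| + 1 by rewrite ltr_wpDl.
  have d10 : 0 < d1 by rewrite !divr_gt0.
  exists (ball (0 : R) d1, ball x0 (d / 2)).
    by split; apply: nbhsx_ballx; rewrite // divr_gt0.
  move=> [s x] [/=]; rewrite -!ball_normE/= sub0r normrN => sd xd.
  have [th ths ->] := dquot_mvt e s x cb; rewrite dq0.
  apply: dP; rewrite -ball_normE/= opprD addrCA addrC.
  apply: le_lt_trans (ler_normB _ _) _; rewrite normrZ.
  rewrite (splitr d) ltrD// (@le_lt_trans _ _ (`|s| * (`|e| + 1)))//.
    by rewrite ler_pM// lerDl.
  by rewrite -ltr_pdivlMr.
have near0 : \forall w \near (s0, x0), w.1 != 0.
  exists ([set s | s != 0], setT) => /=; last by move=> [s x] [].
  split; last exact: filterT.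
  have : open [set s : R | s != 0] by exact: open_neq.
  by rewrite openE => /(_ _ s0N).
have E : \forall w \near (s0, x0),
    (b (w.1 *: e + w.2) - b w.2) / w.1 = dquot b e w.1 w.2.
  by apply: filterS near0 => w; rewrite /dquot => /negbTE ->.
apply: cvg_trans (near_eq_cvg E) _.
rewrite /dquot (negbTE s0N).
have cfst : {for (s0, x0), continuous (fun w : R * V => w.1)} by exact: cvg_fst.
have csnd : {for (s0, x0), continuous (fun w : R * V => w.2)} by exact: cvg_snd.
apply: (@continuousM _ _ (fun w : R * V => b (w.1 *: e + w.2) - b w.2) (fun w => w.1^-1)).
  apply: continuousB.
    apply: (@continuous_comp _ _ _ (fun w : R * V => w.1 *: e + w.2) b).
      by apply: continuousD => //; apply: continuousZr_tmp.
    exact: C1_continuous.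
  apply: (@continuous_comp _ _ _ (fun w : R * V => w.2) b) => //.
  exact: C1_continuous.
exact: continuousV.
Qed.

End DifferenceQuotient.

Section CompactSupport.
Variables (R : realType) (V : normedModType R) (K : set V).
Hypothesis cptK : compact K.

Lemma compact_norm_le : exists2 rho : R, 0 <= rho & forall x, K x -> `|x| <= rho.
Proof.
have [M [_ MK]] := compact_bounded cptK.
exists (Num.max 0 (M + 1)); first by rewrite le_max lexx.
move=> x Kx; apply: (MK (Num.max 0 (M + 1))) => //.
by rewrite lt_max ltrDl ltr01 orbT.
Qed.

Lemma compact_support_norm_le (h : V -> R) : continuous h -> (forall x, ~ K x -> h x = 0) ->
  exists2 M : R, 0 <= M & forall x, `|h x| <= M.
Proof.
move=> ch hK.
have := continuous_compact (continuous_subspaceT ch) cptK.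
move=> /compact_bounded[M [_ MK]].
exists (Num.max 0 (M + 1)); first by rewrite le_max lexx.
move=> x; have [Kx|/hK ->] := pselect (K x); last by rewrite normr0 le_max lexx.
apply: (MK (Num.max 0 (M + 1))); first by rewrite lt_max ltrDl ltr01 orbT.
by exists x.
Qed.

End CompactSupport.

Section Divergence.
Variables (R : realType) (p q : nat).
Local Notation X := (DRpt R p q).

Lemma derive_off_support (b : X -> R) (K : set X) (e x : X) : closed K ->
  (forall y, ~ K y -> b y = 0) -> ~ K x -> 'D_e b x = 0.
Proof.
move=> cK bK Kx.
rewrite (@near_eq_derive _ _ _ b (fun=> 0)); first exact: derive_cst.
have := closed_openC cK; rewrite openE => /(_ x Kx).
by apply: filterS => y /bK.
Qed.

(** Each derivative is replaced by a difference quotient of step t, which integrates to 0. Compactly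
    supported bumps [chi i] keep the integrands non-negative, so for 0 < t <= 1 the integral of H
    (t, .) is exactly that of F plus the constant S. Lower semicontinuity in t bounds the integral
    at t = 0, where derivatives appear, and the finite S is cancelled. *)
Lemma divergence_le (I : Type) (s : seq I) (e : I -> X) (b : I -> X -> R) (K : set X) (F G : X -> R) :
  compact K -> (forall i x, ~ K x -> b i x = 0) -> (forall i, C1 (b i)) ->
  continuous F -> (forall x, 0 <= F x) ->
  nnlsc (fun x => (G x)%:E) ->
  (forall x, G x <= F x + \sum_(i <- s) 'D_(e i) (b i) x) ->
  (DRleb (fun x => (G x)%:E) <= DRleb (fun x => (F x)%:E))%E.
Proof.
move=> cptK bK cb cF F0 lG GF.
have clK : closed K by apply: compact_closed cptK; exact: norm_hausdorff.
have [rho r0 Krho] := compact_norm_le cptK.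
have /choice[M MP] : forall i, exists M : R, 0 <= M /\ forall x, `|'D_(e i) (b i) x| <= M.
  move=> i; have [|M M0 hM] := compact_support_norm_le cptK ((cb i).2 (e i)); last by exists M.
  by move=> x Kx; exact: (derive_off_support (e i) clK (bK i) Kx).
(* For |t| <= 1 the quotient of [b i] vanishes outside the ball of radius rho + |e i| and is at most
   M i in absolute value; on that ball this tent is at least M i. *)
pose chi i (x : X) := M i * Num.max 0 (rho + `|e i| + 1 - `|x|).
have chi0 i x : 0 <= chi i x.
  by rewrite mulr_ge0//; [exact: (MP i).1|rewrite le_max lexx].
have cchi i : continuous (chi i).
  move=> x; apply: (@continuousM _ _ (fun=> M i) (fun x : X => Num.max 0 (rho + `|e i| + 1 - `|x|))).
    exact: cst_continuous.
  apply: continuous_max; first exact: cst_continuous.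
  apply: (@continuousB _ _ _ (fun=> rho + `|e i| + 1) (fun x : X => `|x|)).
    exact: cst_continuous.
  exact: norm_continuous.
have Qchi i t x : `|t| <= 1 -> 0 <= dquot (b i) (e i) t x + chi i x.
  move=> t1; have [th tht ->] := dquot_mvt (e i) t x (cb i).
  have [Ky|Ky] := pselect (K (th *: e i + x)); last first.
    by rewrite (derive_off_support (e i) clK (bK i) Ky) add0r.
  have xr : `|x| <= rho + `|e i|.
    rewrite -(addKr (th *: e i) x) addrC (le_trans (ler_normB _ _))// lerD ?Krho//.
    by rewrite normrZ -[leRHS]mul1r ler_wpM2r// (le_trans tht).
  have c1 : M i <= chi i x.
    rewrite /chi -[leLHS]mulr1 ler_wpM2l ?(MP i).1// le_max; apply/orP; right.
    by lra.
  have := (MP i).2 (th *: e i + x); rewrite ler_norml => /andP[+ _].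
  by lra.
have lE (h : X -> R) : continuous h -> (forall x, 0 <= h x) -> nnlsc (fun x => (h x)%:E).
  by move=> ch h0; apply: nnlsc_EFin => // x; right; exact: ch.
pose Tr i (x : X) : \bar R := (chi i x)%:E.
have lTr i : nnlsc (Tr i) by exact: lE.
(* The maximum with 0 makes H non-negative for every real t; by [Qchi] it changes nothing when |t|
   <= 1. *)
pose H (w : R * X) := (F w.2 + \sum_(i <- s) Num.max 0 (dquot (b i) (e i) w.1 w.2 + chi i w.2))%R.
have lH : nnlsc (fun w => (H w)%:E).
  apply: nnlsc_EFin => [w|w].
    by rewrite addr_ge0// sumr_ge0// => i _; rewrite le_max lexx.
  right; apply: (@continuousD _ _ _ (fun w : R * X => F w.2)).
    by apply: (@continuous_comp _ _ _ (fun w : R * X => w.2) F); [exact: cvg_snd|exact: cF].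
  rewrite (_ : (fun _ => _) = \sum_(i <- s) (fun w : R * X => Num.max 0 (dquot (b i) (e i) w.1 w.2 + chi i w.2))); last first.
    by apply/funext => z; rewrite fct_sumE.
  elim: (s) => [|i l ih]; first by rewrite big_nil; exact: cst_continuous.
  rewrite big_cons; apply: continuousD ih.
  apply: continuous_max; first exact: cst_continuous.
  apply: continuousD; first exact: dquot_continuous.
  by apply: (@continuous_comp _ _ _ (fun w : R * X => w.2) (chi i)); [exact: cvg_snd|exact: cchi].
have JH t : 0 < t -> t <= 1 -> DRleb (fun x => (H (t, x))%:E) =
    (DRleb (fun x => (F x)%:E) + \sum_(i <- s) DRleb (Tr i))%E.
  move=> t0 t1.
  pose dq i (x : X) := (b i (t *: e i + x) - b i x) / t + chi i x.
  have dqE i x : dquot (b i) (e i) t x + chi i x = dq i x by rewrite /dq /dquot gt_eqF.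
  have dq0 i x : 0 <= dq i x by rewrite -dqE; apply: Qchi; rewrite gtr0_norm.
  have cdq i : continuous (dq i).
    move=> x; rewrite (_ : dq i = (fun x => dquot (b i) (e i) t x + chi i x)); last by apply/funext => y; rewrite dqE.
    apply: continuousD; last exact: cchi.
    apply: (@continuous_comp _ _ _ (fun x => (t, x)) (fun w : R * X => dquot (b i) (e i) w.1 w.2)).
      by apply: cvg_to_pair; [exact: cvg_cst|exact: cvg_id].
    exact: dquot_continuous.
  transitivity (DRleb (fun x => (F x)%:E + \sum_(i <- s) (dq i x)%:E)%E).
    congr DRleb; apply/funext => x; rewrite /H EFinD sumEFin; congr (_ + (_)%:E)%E.
    by apply: eq_bigr => i _ /=; rewrite dqE; apply/max_idPr; exact: dq0.
  rewrite DRlebD; [|exact: lE|by apply: nnlsc_sum => i; exact: lE].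
  rewrite DRleb_sum; last by move=> i; exact: lE.
  congr (_ + _)%E; apply: eq_bigr => i _.
  apply: DRleb_translate_cancel => //; first exact: C1_continuous.
  - exists (rho + 1); first by rewrite addr_ge0.
    move=> x xr; apply: bK => /Krho; lra.
  - by have [||B B0 hB] := @compact_support_norm_le _ _ K cptK (b i) => //; [exact: C1_continuous|move=> x /bK|exists B].
  - by move=> x; exact: dq0.
set S := (\sum_(i <- s) DRleb (Tr i))%E in JH.
have S0 : (0 <= S)%E by apply: sume_ge0 => i _; apply: DRleb_ge0 => x; rewrite lee_fin.
have Sfin : S \is a fin_num.
  apply: (big_ind (fun z => z \is a fin_num)) => [//|y z fy fz|i _].
    by rewrite fin_numD fy.
  rewrite ge0_fin_numE; last by apply: DRleb_ge0 => x; rewrite lee_fin.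
  apply: (@DRleb_lty _ _ _ _ (M i * (rho + `|e i| + 1)) (rho + `|e i| + 1)) => //.
  - by rewrite mulr_ge0 ?(MP i).1// !addr_ge0.
  - by rewrite !addr_ge0.
  - move=> x; rewrite lee_fin ler_wpM2l ?(MP i).1// ge_max !addr_ge0//= gerBl//.
  - by move=> x xr; rewrite /Tr /chi; congr EFin; rewrite (max_idPl _) ?mulr0// subr_le0.
(* A larger value at t = 0 would persist for all small steps, whereas for steps in ]0, 1] the
   integral equals the constant given by [JH]. *)
have JH0 : (DRleb (fun x => (H (0, x))%:E) <= DRleb (fun x => (F x)%:E) + S)%E.
  rewrite leNgt; apply/negP => lt.
  have JF0 : (0 <= DRleb (fun x => (F x)%:E))%E by apply: DRleb_ge0 => x; rewrite lee_fin.
  have Tfin : (DRleb (fun x => (F x)%:E) + S)%E \is a fin_num.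
    by rewrite ge0_fin_numE ?adde_ge0//; apply: lt_le_trans lt (leey _).
  have := (nnlsc_DRleb lH).2 0; rewrite -(fineK Tfin) in lt.
  move=> /(_ _ lt)[W /nbhs_ballP[d /= d0 dW] HW].
  have t0 : 0 < Num.min (d / 2) 1 by rewrite lt_min ltr01 divr_gt0.
  have := HW (Num.min (d / 2) 1); rewrite JH//; last by rewrite ge_min lexx orbT.
  rewrite (fineK Tfin) ltxx => /(_ _)/wrap[]// .
  apply: dW; rewrite -ball_normE/= sub0r normrN gtr0_norm//.
  by rewrite gt_min; apply/orP; left; lra.
rewrite -(leeD2rE _ _ Sfin); apply: le_trans JH0.
rewrite /S -DRleb_sum// -DRlebD//; last by apply: nnlsc_sum.
apply: DRleb_le.
- by apply: nnlscD => //; apply: nnlsc_sum.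
- apply: (nnlsc_slice 0 lH).
move=> x; rewrite /H /= sumEFin -EFinD lee_fin.
have -> : \sum_(i <- s) Num.max 0 (dquot (b i) (e i) 0 x + chi i x) =
   \sum_(i <- s) 'D_(e i) (b i) x + \sum_(i <- s) chi i x.
  rewrite -big_split/=; apply: eq_bigr => i _.
  rewrite (max_idPr _); last by apply: Qchi; rewrite normr0.
  by rewrite /dquot eqxx.
by rewrite addrA lerD2r.
Qed.

End Divergence.

(** * The bracket and the function U *)

Section Dot.
Variable R : realType.

Lemma dotvC n (u v : 'rV[R]_n) : dotv u v = dotv v u.
Proof. by apply: eq_bigr => i _; rewrite mulrC. Qed.

Lemma dotvDl n (u v w : 'rV[R]_n) : dotv (u + v) w = dotv u w + dotv v w.
Proof. by rewrite -big_split; apply: eq_bigr => i _; rewrite mxE mulrDl. Qed.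

Lemma dotvZl n (a : R) (v w : 'rV[R]_n) : dotv (a *: v) w = a * dotv v w.
Proof. by rewrite mulr_sumr; apply: eq_bigr => i _; rewrite mxE mulrA. Qed.

Lemma dotvDr n (u v w : 'rV[R]_n) : dotv u (v + w) = dotv u v + dotv u w.
Proof. by rewrite dotvC dotvDl !(dotvC u). Qed.

Lemma dotvZr n (a : R) (v w : 'rV[R]_n) : dotv v (a *: w) = a * dotv v w.
Proof. by rewrite dotvC dotvZl dotvC. Qed.

Lemma dotv0l n (v : 'rV[R]_n) : dotv 0 v = 0.
Proof. by rewrite -(scale0r 0) dotvZl mul0r. Qed.

Lemma dotvNl n (u v : 'rV[R]_n) : dotv (- u) v = - dotv u v.
Proof. by rewrite -scaleN1r dotvZl mulN1r. Qed.

Lemma dotvNr n (u v : 'rV[R]_n) : dotv u (- v) = - dotv u v.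
Proof. by rewrite dotvC dotvNl dotvC. Qed.

Lemma dotv_delta n (v : 'rV[R]_n) i : dotv (delta_mx 0 i) v = v 0 i.
Proof.
rewrite /dotv (bigD1 i)//= mxE !eqxx mul1r big1 ?addr0// => j ji.
by rewrite mxE (negbTE ji) andbF mul0r.
Qed.

Lemma sqnE n (v : 'rV[R]_n) : sqn v = \sum_(i < n) v 0 i ^+ 2.
Proof. by apply: eq_bigr => i _; rewrite expr2. Qed.

Lemma sqn_ge0 n (v : 'rV[R]_n) : 0 <= sqn v.
Proof. by rewrite sqnE sumr_ge0// => i _; rewrite sqr_ge0. Qed.

Lemma sqnZ n (a : R) (v : 'rV[R]_n) : sqn (a *: v) = a ^+ 2 * sqn v.
Proof. by rewrite /sqn dotvZl dotvZr mulrA. Qed.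

Lemma sqnD n (u v : 'rV[R]_n) : sqn (u + v) = sqn u + 2 * dotv u v + sqn v.
Proof. by rewrite /sqn dotvDl !dotvDr (dotvC v u); ring. Qed.

Lemma sqn_eq0 n (v : 'rV[R]_n) : sqn v = 0 -> v = 0.
Proof.
rewrite sqnE => /eqP; rewrite psumr_eq0; last by move=> i _; rewrite sqr_ge0.
move=> /allP h; apply/rowP => i; rewrite mxE; apply/eqP.
by have := h i (mem_index_enum _); rewrite sqrf_eq0.
Qed.

Lemma row_sum_delta_mx n (v : 'rV[R]_n) : v = \sum_(i < n) v 0 i *: delta_mx 0 i.
Proof. exact: row_sum_delta. Qed.

End Dot.

Section Bracket.
Variables (R : realType) (p q : nat) (br : 'rV[R]_p -> 'rV[R]_p -> 'rV[R]_q).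
Hypothesis hbr : is_DR_bracket br.

Lemma brDl V V' W : br (V + V') W = br V W + br V' W.
Proof. by case: hbr => h _ _; have := h 1 V V' W; rewrite !scale1r. Qed.

Lemma br0l W : br 0 W = 0.
Proof. by have := brDl 0 0 W; rewrite addr0 -[LHS]addr0 => /addrI. Qed.

Lemma brZl a V W : br (a *: V) W = a *: br V W.
Proof. by case: hbr => h _ _; have := h a V 0 W; rewrite !addr0 br0l addr0. Qed.

Lemma brC V W : br V W = - br W V.
Proof. by case: hbr. Qed.

Lemma brDr V W W' : br V (W + W') = br V W + br V W'.
Proof. by rewrite brC brDl opprD -!brC. Qed.

Lemma brZr a V W : br V (a *: W) = a *: br V W.
Proof. by rewrite brC brZl -scalerN -brC. Qed.

Lemma br0r V : br V 0 = 0.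
Proof. by rewrite brC br0l oppr0. Qed.

Lemma brNl V W : br (- V) W = - br V W.
Proof. by rewrite -scaleN1r brZl scaleN1r. Qed.

Lemma brVV V : br V V = 0.
Proof.
have := brC V V => /eqP; rewrite -addr_eq0 -mulr2n -scaler_nat scaler_eq0 pnatr_eq0/=.
by move/eqP.
Qed.

Lemma br_sumr V (I : Type) (s : seq I) (W : I -> 'rV[R]_p) :
  br V (\sum_(i <- s) W i) = \sum_(i <- s) br V (W i).
Proof.
elim: s => [|i s ih]; first by rewrite !big_nil br0r.
by rewrite !big_cons brDr ih.
Qed.

Lemma br_suml V (I : Type) (s : seq I) (W : I -> 'rV[R]_p) :
  br (\sum_(i <- s) W i) V = \sum_(i <- s) br (W i) V.
Proof.
elim: s => [|i s ih]; first by rewrite !big_nil br0l.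
by rewrite !big_cons brDl ih.
Qed.

Lemma brE V W j : br V W 0 j =
  \sum_(i < p) \sum_(k < p) V 0 i * W 0 k * br (delta_mx 0 i) (delta_mx 0 k) 0 j.
Proof.
rewrite {1}(row_sum_delta_mx V) br_suml summxE; apply: eq_bigr => i _.
rewrite brZl {1}(row_sum_delta_mx W) br_sumr scaler_sumr summxE.
by apply: eq_bigr => k _; rewrite brZr scalerA mxE.
Qed.

Lemma dotv_Jop Z V W : dotv (Jop br Z V) W = dotv Z (br V W).
Proof.
rewrite {2}(row_sum_delta_mx W) br_sumr /dotv.
transitivity (\sum_(i < p) W 0 i * dotv Z (br V (delta_mx 0 i))).
  by apply: eq_bigr => i _; rewrite mxE mulrC.
transitivity (\sum_(i < p) dotv Z (br V (W 0 i *: delta_mx 0 i))).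
  by apply: eq_bigr => i _; rewrite brZr dotvZr.
elim: (index_enum _) => [|i s ih].
  by rewrite !big_nil big1// => j _; rewrite mxE mulr0.
rewrite big_cons ih -[RHS]/(dotv Z (\sum_(k <- i :: s) br V (W 0 k *: delta_mx 0 k))).
by rewrite big_cons dotvDr.
Qed.

Lemma JopD Z Z' V : Jop br (Z + Z') V = Jop br Z V + Jop br Z' V.
Proof. by apply/rowP => i; rewrite !mxE dotvDl. Qed.

Lemma JopDr Z V V' : Jop br Z (V + V') = Jop br Z V + Jop br Z V'.
Proof. by apply/rowP => i; rewrite !mxE brDl dotvDr. Qed.

Lemma JopZr a Z V : Jop br Z (a *: V) = a *: Jop br Z V.
Proof. by apply/rowP => i; rewrite !mxE brZl dotvZr. Qed.

Lemma JopJop Z V : Jop br Z (Jop br Z V) = - (sqn Z *: V).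
Proof. by case: hbr. Qed.

Lemma dotv_Jop_self Z V : dotv (Jop br Z V) V = 0.
Proof. by rewrite dotv_Jop brVV dotvC dotv0l. Qed.

Lemma sqn_Jop Z V : sqn (Jop br Z V) = sqn Z * sqn V.
Proof.
rewrite /sqn dotv_Jop brC dotvNr -dotv_Jop JopJop dotvNl opprK dotvZl.
by [].
Qed.

(** Polarisation of [sqn_Jop] in the central variable. *)
Lemma dotv_Jop_Jop W Z V : dotv (Jop br W V) (Jop br Z V) = dotv W Z * sqn V.
Proof.
have := sqn_Jop (W + Z) V; rewrite JopD !sqnD !sqn_Jop; lra.
Qed.

(** Pairing with any W of the centre, <W, [V, J_Z V]> = <J_W V, J_Z V> = <W, Z> |V|^2. Through this
    identity the brackets disappear from the gradient of U and from the speed of geodesics. *)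
Lemma br_Jop Z V : br V (Jop br Z V) = sqn V *: Z.
Proof.
apply/rowP => j; rewrite -dotv_delta -dotv_Jop dotv_Jop_Jop dotv_delta mxE.
by rewrite mulrC.
Qed.

End Bracket.

(** * The function U: gradient, Laplacian, frame components *)

Section Radial.
Variables (R : realType) (p q : nat) (br : 'rV[R]_p -> 'rV[R]_p -> 'rV[R]_q).
Hypothesis hbr : is_DR_bracket br.
Local Notation X := (DRpt R p q).
Implicit Types (x v : X).

Let fstc (x : X) : {for x, continuous (fun y : X => y.1)}.
Proof. exact: cvg_fst. Qed.

Lemma DRV_continuous : continuous (fun x : X => x.1.1).
Proof. by move=> x; exact: (continuous_fst_comp (@fstc x)). Qed.

Lemma DRZ_continuous : continuous (fun x : X => x.1.2).
Proof. by move=> x; exact: (continuous_snd_comp (@fstc x)). Qed.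

Lemma DRt_continuous : continuous (fun x : X => x.2).
Proof. by move=> x; exact: cvg_snd. Qed.

Lemma DRVi_lin i : C1 (fun x : X => x.1.1 0 i) /\
  forall x v, is_derive x v (fun x : X => x.1.1 0 i) (v.1.1 0 i).
Proof.
apply: linear_C1 => [a y z|x]; first by rewrite !mxE.
apply: (@continuous_comp _ _ _ (fun x : X => x.1.1) (fun v : 'rV[R]_p => v 0 i)).
  exact: DRV_continuous.
exact: coord_continuous.
Qed.

Lemma DRZj_lin j : C1 (fun x : X => x.1.2 0 j) /\
  forall x v, is_derive x v (fun x : X => x.1.2 0 j) (v.1.2 0 j).
Proof.
apply: linear_C1 => [a y z|x]; first by rewrite !mxE.
apply: (@continuous_comp _ _ _ (fun x : X => x.1.2) (fun v : 'rV[R]_q => v 0 j)).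
  exact: DRZ_continuous.
exact: coord_continuous.
Qed.

Lemma DRt_lin : C1 (fun x : X => x.2) /\
  forall x v, is_derive x v (fun x : X => x.2) v.2.
Proof. by apply: linear_C1 => // x; exact: DRt_continuous. Qed.

Definition DRexp (c : R) (x : X) : R := expR (c * x.2).

Lemma is_derive_DRexp c x v : is_derive x v (DRexp c) (c * v.2 * DRexp c x).
Proof.
have h : is_derive x v (fun x : X => c * x.2) (c * v.2).
  apply: is_derive_eq; first exact: is_derive_mul (is_derive_const c x v) (DRt_lin.2 x v).
  by rewrite mul0r add0r.
apply: is_derive_eq; first exact: (is_derive_comp1 h (is_derive_expR _)).
by rewrite mulrC.
Qed.

Lemma C1_DRexp c : C1 (DRexp c).
Proof.
apply: (@C1_comp _ _ expR expR (fun x : X => c * x.2)).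
- exact: continuous_expR.
- by apply: C1Z; exact: DRt_lin.1.
Qed.

Lemma is_derive_sqnV x v : is_derive x v (fun x : X => sqn x.1.1) (2 * dotv x.1.1 v.1.1).
Proof.
apply: is_derive_eq.
  by apply: is_derive_bigsum => i; apply: is_derive_mul; exact: (DRVi_lin i).2.
by rewrite /dotv mulr_sumr; apply: eq_bigr => i _; ring.
Qed.

Lemma is_derive_sqnZ x v : is_derive x v (fun x : X => sqn x.1.2) (2 * dotv x.1.2 v.1.2).
Proof.
apply: is_derive_eq.
  by apply: is_derive_bigsum => i; apply: is_derive_mul; exact: (DRZj_lin i).2.
by rewrite /dotv mulr_sumr; apply: eq_bigr => i _; ring.
Qed.

Lemma C1_sqnV : C1 (fun x : X => sqn x.1.1).
Proof. by apply: C1_bigsum => i; apply: C1M; exact: (DRVi_lin i).1. Qed.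

Lemma C1_sqnZ : C1 (fun x : X => sqn x.1.2).
Proof. by apply: C1_bigsum => i; apply: C1M; exact: (DRZj_lin i).1. Qed.

Definition DRN (x : X) : R := 1 + DRexp 1 x + 4^-1 * sqn x.1.1.

Lemma is_derive_DRN x v :
  is_derive x v DRN (v.2 * DRexp 1 x + 2^-1 * dotv x.1.1 v.1.1).
Proof.
have h := is_derive_add (is_derive_add (is_derive_const 1 x v) (is_derive_DRexp 1 x v))
  (is_derive_mul (is_derive_const 4^-1 x v) (is_derive_sqnV x v)).
by apply: (is_derive_eq h); field.
Qed.

Lemma C1_DRN : C1 DRN.
Proof.
apply: C1D; last by apply: C1Z; exact: C1_sqnV.
by apply: C1D; [exact: C1_cst|exact: C1_DRexp].
Qed.

(* [cosh^2 (d/2)] for [d] the distance to the identity. *)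
Definition DRU (x : X) : R := 4^-1 * ((DRN x * DRN x + sqn x.1.2) * DRexp (-1) x).

Lemma is_derive_DRU x v : is_derive x v DRU
  (2^-1 * (DRN x * (v.2 * DRexp 1 x + 2^-1 * dotv x.1.1 v.1.1) + dotv x.1.2 v.1.2)
    * DRexp (-1) x - v.2 * DRU x).
Proof.
have hN := is_derive_DRN x v.
have h := is_derive_mul (is_derive_const 4^-1 x v) (is_derive_mul
  (is_derive_add (is_derive_mul hN hN) (is_derive_sqnZ x v)) (is_derive_DRexp (-1) x v)).
by apply: (is_derive_eq h); rewrite /DRU; field.
Qed.

Lemma C1_DRU : C1 DRU.
Proof.
apply: C1Z; apply: C1M; last exact: C1_DRexp.
by apply: C1D; [apply: C1M; exact: C1_DRN|exact: C1_sqnZ].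
Qed.

Lemma DRexpN1 x : DRexp (-1) x = (DRexp 1 x)^-1.
Proof. by rewrite /DRexp mulN1r mul1r expRN. Qed.

Lemma DRexp_gt0 c x : 0 < DRexp c x.
Proof. exact: expR_gt0. Qed.

(** A sum of non-negative terms that vanish together only at (0, 0, 0): both U >= 1 and its case of
    equality are read off from it. *)
Lemma DRU_sub1 x : DRU x - 1 = 4^-1 * DRexp (-1) x *
  ((1 - DRexp 1 x) ^+ 2 + (1 + DRexp 1 x) * sqn x.1.1 / 2 + sqn x.1.1 ^+ 2 / 16 + sqn x.1.2).
Proof.
rewrite /DRU /DRN DRexpN1; have := DRexp_gt0 1 x; move: (DRexp 1 x) => a a0.
by field; rewrite gt_eqF.
Qed.

Lemma DRU_ge1 x : 1 <= DRU x.
Proof.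
rewrite -subr_ge0 DRU_sub1; have := DRexp_gt0 1 x; have := DRexp_gt0 (-1) x => ? ?.
have := sqn_ge0 x.1.1; have := sqn_ge0 x.1.2 => ? ?.
apply: mulr_ge0; first by rewrite mulr_ge0// ltW.
rewrite !addr_ge0// ?divr_ge0 ?sqr_ge0// ?mulr_ge0//; lra.
Qed.

Lemma DRU_eq1 x : DRU x = 1 -> x = (0, 0, 0).
Proof.
move=> /eqP; rewrite -subr_eq0 DRU_sub1.
have := DRexp_gt0 1 x; have a0 := DRexp_gt0 (-1) x => b0.
have V0 := sqn_ge0 x.1.1; have Z0 := sqn_ge0 x.1.2.
rewrite !mulf_eq0 invr_eq0 pnatr_eq0/= gt_eqF//=.
have s1 := sqr_ge0 (1 - DRexp 1 x).
have s2 : 0 <= DRexp 1 x * sqn x.1.1 by rewrite mulr_ge0// ltW.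
have s3 := sqr_ge0 (sqn x.1.1).
move=> /eqP E.
have EV : sqn x.1.1 = 0 by lra.
have EZ : sqn x.1.2 = 0 by lra.
have Et : (1 - DRexp 1 x) ^+ 2 = 0 by lra.
move/eqP : Et; rewrite sqrf_eq0 subr_eq0 eq_sym -expR0 => /eqP/expR_inj.
rewrite expR0 mul1r => t0.
case: x t0 EV EZ {a0 b0 V0 Z0 s1 s2 s3 E} => [[V Z] t] /= -> /sqn_eq0 -> /sqn_eq0 ->.
by [].
Qed.

(** The Riemannian gradient of U, but written in the linear coordinates (V, Z, t), since the
    divergence will be computed coordinate by coordinate. *)
Definition DRgradU (x : X) : X :=
  (4^-1 *: (DRN x *: x.1.1 + Jop br x.1.2 x.1.1),
   (sqn x.1.1 / 8 + DRexp 1 x / 2) *: x.1.2,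
   DRN x / 2 - DRU x).

(** With U = cosh^2 (r/2) one has dU/dr = cosh (r/2) sinh (r/2), whose square is U^2 - U. *)
Lemma is_derive_gradU_U x : is_derive x (DRgradU x) DRU (DRU x ^+ 2 - DRU x).
Proof.
apply: is_derive_eq; first exact: is_derive_DRU.
rewrite /DRgradU/= !dotvZr dotvDr dotvZr (dotvC x.1.1 (Jop _ _ _)) (dotv_Jop_self hbr) addr0.
rewrite -!/(sqn _) /DRU /DRN DRexpN1.
have := DRexp_gt0 1 x; move: (DRexp 1 x) => a a0.
by field; rewrite gt_eqF.
Qed.

Definition DRidx := ('I_p + 'I_q + 'I_1)%type.

Definition DRbasis (k : DRidx) : X :=
  match k with
  | inl (inl i) => (delta_mx 0 i, 0, 0)
  | inl (inr j) => (0, delta_mx 0 j, 0)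
  | inr _ => (0, 0, 1)
  end.

Definition DRcoord (v : X) (k : DRidx) : R :=
  match k with
  | inl (inl i) => v.1.1 0 i
  | inl (inr j) => v.1.2 0 j
  | inr _ => v.2
  end.

Lemma DRbasis_sum (v : X) : v = \sum_(k : DRidx) DRcoord v k *: DRbasis k.
Proof.
rewrite !big_sumType/= big_ord1.
have E1 : \sum_(i < p) v.1.1 0 i *: (delta_mx 0 i, 0, 0) = ((v.1.1, 0, 0) : X).
  rewrite [in RHS](row_sum_delta_mx v.1.1).
  elim: (index_enum _) => [|i s ih]; first by rewrite !big_nil.
  by rewrite !big_cons ih; congr (_, _, _); rewrite /= ?scaler0 ?addr0.
have E2 : \sum_(j < q) v.1.2 0 j *: (0, delta_mx 0 j, 0) = ((0, v.1.2, 0) : X).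
  rewrite [in RHS](row_sum_delta_mx v.1.2).
  elim: (index_enum _) => [|i s ih]; first by rewrite !big_nil.
  by rewrite !big_cons ih; congr (_, _, _); rewrite /= ?scaler0 ?addr0.
rewrite E1 E2; case: v {E1 E2} => [[V Z] t] /=.
by congr (_, _, _); rewrite /= ?scaler0 ?addr0 ?add0r// /GRing.scale/= mulr1.
Qed.

Lemma derive_lin (f : X -> R) x (I : Type) (s : seq I) (c : I -> R) (w : I -> X) :
  differentiable f x -> 'D_(\sum_(k <- s) c k *: w k) f x = \sum_(k <- s) c k * 'D_(w k) f x.
Proof.
move=> df; rewrite (deriveE _ df) linear_sum; apply: eq_bigr => k _.
by rewrite linearZ (deriveE _ df).
Qed.

Lemma derive_coord (f : X -> R) x v : differentiable f x ->
  'D_v f x = \sum_(k : DRidx) DRcoord v k * 'D_(DRbasis k) f x.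
Proof. by move=> df; rewrite {1}(DRbasis_sum v) derive_lin. Qed.

Lemma DRbr_lin (W : 'rV[R]_p) j : C1 (fun x : X => br x.1.1 W 0 j) /\
  forall x v, is_derive x v (fun x : X => br x.1.1 W 0 j) (br v.1.1 W 0 j).
Proof.
apply: linear_C1 => [a y z|].
  by rewrite /= (brDl hbr) (brZl hbr) !mxE.
apply: C1_continuous.
rewrite (_ : (fun x : X => br x.1.1 W 0 j) = (fun x : X => \sum_(i < p) \sum_(k < p)
   x.1.1 0 i * W 0 k * br (delta_mx 0 i) (delta_mx 0 k) 0 j)); last first.
  by apply/funext => x; rewrite (brE hbr).
apply: C1_bigsum => i; apply: C1_bigsum => k.
apply: C1M; last exact: C1_cst.
by apply: C1M; [exact: (DRVi_lin i).1|exact: C1_cst].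
Qed.

Lemma is_derive_Jop i x v : is_derive x v (fun x : X => Jop br x.1.2 x.1.1 0 i)
  (Jop br v.1.2 x.1.1 0 i + Jop br x.1.2 v.1.1 0 i).
Proof.
have h := is_derive_bigsum (index_enum 'I_q)
  (fun j => is_derive_mul ((DRZj_lin j).2 x v) ((DRbr_lin (delta_mx 0 i) j).2 x v)).
rewrite (_ : (fun x : X => Jop br x.1.2 x.1.1 0 i) =
  (fun y => \sum_(j <- index_enum 'I_q) y.1.2 0 j * br y.1.1 (delta_mx 0 i) 0 j)).
  by apply: (is_derive_eq h); rewrite big_split/= !mxE.
by apply/funext => y; rewrite mxE.
Qed.

Lemma C1_Jop i : C1 (fun x : X => Jop br x.1.2 x.1.1 0 i).
Proof.
rewrite (_ : (fun x : X => Jop br x.1.2 x.1.1 0 i) =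
  (fun y => \sum_(j < q) y.1.2 0 j * br y.1.1 (delta_mx 0 i) 0 j)).
  by apply: C1_bigsum => j; apply: C1M; [exact: (DRZj_lin j).1|exact: (DRbr_lin _ j).1].
by apply/funext => y; rewrite mxE.
Qed.

Lemma C1_gradU k : C1 (fun x => DRcoord (DRgradU x) k).
Proof.
case: k => [[i|j]|k] /=.
- rewrite (_ : (fun _ => _) = (fun x : X => 4^-1 * (DRN x * x.1.1 0 i + Jop br x.1.2 x.1.1 0 i))).
    apply: C1Z; apply: C1D; last exact: C1_Jop.
    by apply: C1M; [exact: C1_DRN|exact: (DRVi_lin i).1].
  by apply/funext => x; rewrite !mxE.
- rewrite (_ : (fun _ => _) = (fun x : X => (8^-1 * sqn x.1.1 + 2^-1 * DRexp 1 x) * x.1.2 0 j)).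
    apply: C1M; last exact: (DRZj_lin j).1.
    by apply: C1D; apply: C1Z; [exact: C1_sqnV|exact: C1_DRexp].
  by apply/funext => x; rewrite !mxE; field.
- rewrite (_ : (fun _ => _) = (fun x : X => 2^-1 * DRN x - DRU x)).
    by apply: C1B; [apply: C1Z; exact: C1_DRN|exact: C1_DRU].
  by apply/funext => x; rewrite mulrC.
Qed.

Definition DRvol (x : X) : R := DRexp (- (p%:R / 2 + q%:R)) x.

Lemma dotv_deltar n (v : 'rV[R]_n) i : dotv v (delta_mx 0 i) = v 0 i.
Proof. by rewrite dotvC dotv_delta. Qed.

Lemma sum_cstE n (c : R) : \sum_(i < n) c = n%:R * c.
Proof. by rewrite sumr_const card_ord mulr_natl. Qed.

(** The Euclidean divergence of the gradient. The map J_Z contributes nothing, its diagonal entries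
    being <Z, [e_i, e_i]> = 0. The last summand is kept apart because it cancels against the
    derivative of the volume density. *)
Lemma derive_gradU_sum x :
  \sum_(k : DRidx) 'D_(DRbasis k) (fun y => DRcoord (DRgradU y) k) x =
  (1 + q%:R) * (sqn x.1.1 / 8 + DRexp 1 x / 2 - DRN x / 2) + (1 + (p%:R / 2 + q%:R)) * DRU x
   + (p%:R / 2 + q%:R) * DRcoord (DRgradU x) (inr ord0).
Proof.
rewrite !big_sumType/= big_ord1.
have E1 (i : 'I_p) : 'D_(DRbasis (inl (inl i))) (fun y => DRcoord (DRgradU y) (inl (inl i))) x =
    8^-1 * x.1.1 0 i ^+ 2 + 4^-1 * DRN x.
  pose v := DRbasis (inl (inl i)).
  have h := is_derive_mul (is_derive_const 4^-1 x v) (is_derive_add (is_derive_mul (is_derive_DRN x v) ((DRVi_lin i).2 x v)) (is_derive_Jop i x v)).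
  rewrite (_ : (fun y => _) = (fun x : X => 4^-1 * (DRN x * x.1.1 0 i + Jop br x.1.2 x.1.1 0 i))); last by apply/funext => y /=; rewrite !mxE.
  have [_ ->] := h; rewrite /v/= dotv_deltar !mxE (brVV hbr) !eqxx dotvC dotv0l.
  rewrite (dotvC _ 0) dotv0l /=.
  by field.
have E2 (j : 'I_q) : 'D_(DRbasis (inl (inr j))) (fun y => DRcoord (DRgradU y) (inl (inr j))) x =
    sqn x.1.1 / 8 + DRexp 1 x / 2.
  pose v := DRbasis (inl (inr j)).
  have h := is_derive_mul (is_derive_add (is_derive_mul (is_derive_const 8^-1 x v) (is_derive_sqnV x v)) (is_derive_mul (is_derive_const 2^-1 x v) (is_derive_DRexp 1 x v))) ((DRZj_lin j).2 x v).
  rewrite (_ : (fun y => _) = (fun x : X => (8^-1 * sqn x.1.1 + 2^-1 * DRexp 1 x) * x.1.2 0 j)); last by apply/funext => y /=; rewrite !mxE; field.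
  have [_ ->] := h; rewrite /v/= dotvC dotv0l mxE !eqxx/=.
  by field.
have E3 : 'D_(DRbasis (inr ord0)) (fun y => DRcoord (DRgradU y) (inr ord0)) x =
    DRexp 1 x / 2 - DRN x / 2 + DRU x.
  pose v := DRbasis (inr ord0).
  have h := is_derive_sub (is_derive_mul (is_derive_const 2^-1 x v) (is_derive_DRN x v)) (is_derive_DRU x v).
  rewrite (_ : (fun y => _) = (fun x : X => 2^-1 * DRN x - DRU x)); last by apply/funext => y /=; rewrite mulrC.
  have [_ ->] := h; rewrite /v/= !(dotvC _ 0) !dotv0l !DRexpN1.
  have := DRexp_gt0 1 x; move: (DRexp 1 x) (DRN x) (DRU x) => a N U a0.
  by field; rewrite gt_eqF.
rewrite (eq_bigr _ (fun i _ => E1 i)) (eq_bigr _ (fun j _ => E2 j)) E3.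
rewrite big_split/= -mulr_sumr -sqnE !sum_cstE /DRN.
by field.
Qed.

(* The last factor is the Laplacian of [U]. *)
Lemma divergence_gradU (psi : X -> R) x : C1 psi ->
  \sum_(k : DRidx) 'D_(DRbasis k) (fun y => DRvol y * psi y * DRcoord (DRgradU y) k) x =
  DRvol x * ('D_(DRgradU x) psi x +
    psi x * ((1 + (p%:R / 2 + q%:R)) * DRU x - (1 + q%:R) / 2)).
Proof.
move=> hpsi.
have E k : 'D_(DRbasis k) (fun y => DRvol y * psi y * DRcoord (DRgradU y) k) x =
    DRvol x * (DRcoord (DRgradU x) k * 'D_(DRbasis k) psi x) +
    DRvol x * psi x * 'D_(DRbasis k) (fun y => DRcoord (DRgradU y) k) x +
    DRvol x * psi x * (- (p%:R / 2 + q%:R) * (DRcoord (DRgradU x) k * (DRbasis k).2)).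
  have h := is_derive_mul (is_derive_mul (is_derive_DRexp (- (p%:R / 2 + q%:R)) x (DRbasis k)) (C1_derive x (DRbasis k) hpsi))
    (C1_derive x (DRbasis k) (C1_gradU k)).
  have [_ ->] := h; rewrite -/(DRvol x).
  by ring.
rewrite (eq_bigr _ (fun k _ => E k)) !big_split/= -!mulr_sumr derive_gradU_sum.
rewrite (derive_coord _ (hpsi.1 x)) (_ : \sum_(k : DRidx) DRcoord (DRgradU x) k * (DRbasis k).2 = DRcoord (DRgradU x) (inr ord0)).
  by rewrite /DRN; field.
rewrite !big_sumType/= big_ord1 mulr1 !big1 ?add0r// => k _; by rewrite mulr0.
Qed.

(** Lagrange's identity: the defect is half the sum of the squares of a_i b_j - a_j b_i. *)
Lemma cauchy_schwarz_sum (I : finType) (a b : I -> R) :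
  (\sum_i a i * b i) ^+ 2 <= (\sum_i a i ^+ 2) * (\sum_i b i ^+ 2).
Proof.
rewrite -subr_ge0.
suff -> : (\sum_i a i ^+ 2) * (\sum_i b i ^+ 2) - (\sum_i a i * b i) ^+ 2 =
   2^-1 * \sum_i \sum_j (a i * b j - a j * b i) ^+ 2.
  by rewrite mulr_ge0// sumr_ge0// => i _; rewrite sumr_ge0// => j _; rewrite sqr_ge0.
have -> : \sum_i \sum_j (a i * b j - a j * b i) ^+ 2 =
   \sum_i \sum_j a i ^+ 2 * b j ^+ 2 + \sum_i \sum_j b i ^+ 2 * a j ^+ 2
   - 2 * \sum_i \sum_j (a i * b i) * (a j * b j).
  rewrite mulr_sumr -sumrN -!big_split/=; apply: eq_bigr => i _.
  rewrite mulr_sumr -sumrN -!big_split/=; apply: eq_bigr => j _.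
  by ring.
by rewrite -!big_distrlr/=; field.
Qed.

Definition DRframe (x : X) (k : DRidx) : X :=
  match k with
  | inl (inl i) => frameE br x i
  | inl (inr j) => frameF x j
  | inr _ => frameH R p q
  end.

Lemma grad_normE f x : grad_norm br f x = Num.sqrt (\sum_(k : DRidx) 'D_(DRframe x k) f x ^+ 2).
Proof. by rewrite !big_sumType/= big_ord1. Qed.

(** The components of grad U in the left-invariant orthonormal frame, equivalently the derivatives
    of U along the frame fields ([derive_frame_U]). *)
Definition DRgradU_frame (x : X) (k : DRidx) : R :=
  match k with
  | inl (inl i) => 4^-1 * DRexp (- 2^-1) x * (DRN x * x.1.1 0 i + Jop br x.1.2 x.1.1 0 i)
  | inl (inr j) => x.1.2 0 j / 2
  | inr _ => DRN x / 2 - DRU x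
  end.

Lemma sum_frameE x (W : 'rV[R]_p) : \sum_(i < p) W 0 i *: frameE br x i =
  ((expR (x.2 / 2) *: W, (expR (x.2 / 2) / 2) *: br x.1.1 W, 0) : X).
Proof.
rewrite {2 3}(row_sum_delta_mx W) (br_sumr hbr).
elim: (index_enum _) => [|i s ih]; first by rewrite !big_nil !scaler0.
rewrite !big_cons ih /frameE; congr (_, _, _); rewrite /= ?scaler0 ?addr0//.
  by rewrite scalerDr !scalerA mulrC.
by rewrite scalerDr (brZr hbr) !scalerA mulrC.
Qed.

Lemma sum_frameF x (Z : 'rV[R]_q) : \sum_(j < q) Z 0 j *: frameF x j =
  ((0, expR x.2 *: Z, 0) : X).
Proof.
rewrite {2}(row_sum_delta_mx Z).
elim: (index_enum _) => [|i s ih]; first by rewrite !big_nil !scaler0.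
rewrite !big_cons ih /frameF; congr (_, _, _); rewrite /= ?scaler0 ?addr0//.
by rewrite scalerDr !scalerA mulrC.
Qed.

(** The central components of the fields E_i add up to a multiple of [V, J_Z V] = |V|^2 Z; this is
    the origin of the term |V|^2 / 8 in [DRgradU]. *)
Lemma DRgradU_frameE x : DRgradU x = \sum_(k : DRidx) DRgradU_frame x k *: DRframe x k.
Proof.
rewrite !big_sumType/= big_ord1.
pose W := (4^-1 * DRexp (- 2^-1) x) *: (DRN x *: x.1.1 + Jop br x.1.2 x.1.1).
have e1 : expR (x.2 / 2) * DRexp (- 2^-1) x = 1.
  by rewrite /DRexp -expRD -[RHS]expR0; congr expR; field.
have E1 : \sum_(i < p) (4^-1 * DRexp (- 2^-1) x * (DRN x * x.1.1 0 i + Jop br x.1.2 x.1.1 0 i)) *: frameE br x i =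
    ((expR (x.2 / 2) *: W, (expR (x.2 / 2) / 2) *: br x.1.1 W, 0) : X).
  by rewrite -sum_frameE; apply: eq_bigr => i _; rewrite !mxE.
have E2 : \sum_(j < q) (x.1.2 0 j / 2) *: frameF x j = ((0, (DRexp 1 x / 2) *: x.1.2, 0) : X).
  transitivity (\sum_(j < q) (2^-1 *: x.1.2) 0 j *: frameF x j).
    by apply: eq_bigr => j _; rewrite mxE mulrC.
  by rewrite sum_frameF scalerA /DRexp mul1r.
rewrite E1 E2 /frameH /DRgradU; congr (_, _, _); rewrite /= ?scaler0 ?addr0 ?add0r.
- by rewrite /W scalerA mulrCA e1 mulr1.
- rewrite /W (brZr hbr) (brDr hbr) (brZr hbr) (brVV hbr) scaler0 add0r (br_Jop hbr) !scalerA -scalerDl.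
  have -> : expR (x.2 / 2) / 2 * (4^-1 * DRexp (- 2^-1) x) * sqn x.1.1 =
      sqn x.1.1 / 8 * (expR (x.2 / 2) * DRexp (- 2^-1) x) by field.
  by rewrite e1 mulr1.
- by rewrite /GRing.scale/= mulr1.
Qed.

Lemma DRgradU_frame_norm x : \sum_(k : DRidx) DRgradU_frame x k ^+ 2 = DRU x ^+ 2 - DRU x.
Proof.
rewrite !big_sumType/= big_ord1.
have -> : \sum_(i < p) (4^-1 * DRexp (- 2^-1) x * (DRN x * x.1.1 0 i + Jop br x.1.2 x.1.1 0 i)) ^+ 2 =
   16^-1 * DRexp (-1) x * (DRN x ^+ 2 * sqn x.1.1 + sqn x.1.2 * sqn x.1.1).
  have e1 : DRexp (-1) x = DRexp (- 2^-1) x ^+ 2.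
    by rewrite /DRexp expr2 -expRD; congr expR; field.
  transitivity (16^-1 * DRexp (-1) x * sqn (DRN x *: x.1.1 + Jop br x.1.2 x.1.1)).
    by rewrite sqnE mulr_sumr; apply: eq_bigr => i _; rewrite e1 !mxE; field.
  rewrite sqnD sqnZ dotvZl (dotvC x.1.1) (dotv_Jop_self hbr) (sqn_Jop hbr).
  by ring.
have -> : \sum_(j < q) (x.1.2 0 j / 2) ^+ 2 = 4^-1 * sqn x.1.2.
  by rewrite sqnE mulr_sumr; apply: eq_bigr => j _; field.
rewrite /DRU /DRN DRexpN1.
have := DRexp_gt0 1 x; move: (DRexp 1 x) => a a0.
by field; rewrite gt_eqF.
Qed.

Lemma derive_gradU_le f x : differentiable f x ->
  `|'D_(DRgradU x) f x| <= Num.sqrt (DRU x ^+ 2 - DRU x) * grad_norm br f x.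
Proof.
move=> df; rewrite grad_normE -sqrtrM; last first.
  by rewrite -DRgradU_frame_norm sumr_ge0// => k _; rewrite sqr_ge0.
rewrite -sqrtr_sqr ler_wsqrtr// -DRgradU_frame_norm.
rewrite DRgradU_frameE derive_lin//.
exact: cauchy_schwarz_sum.
Qed.

End Radial.

(** * Radial functions *)

Section Hyperbolic.
Variable R : realType.
Implicit Types r u : R.

Lemma is_derive_inv (V : normedModType R) (f : V -> R) x v df : f x != 0 ->
  is_derive x v f df -> is_derive x v (fun y => (f y)^-1) (- df / f x ^+ 2).
Proof.
move=> fx [dfx <-]; apply: DeriveDef; first exact: derivableV.
by rewrite deriveV// /GRing.scale/= mulNr mulNr mulrC.
Qed.

Lemma sinh_gt0 r : 0 < r -> 0 < sinh r.
Proof. by move=> r0; rewrite divr_gt0// subr_gt0 ltr_expR; lra. Qed.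

Lemma cosh_gt0 r : 0 < cosh r.
Proof. by rewrite divr_gt0// addr_gt0// expR_gt0. Qed.

Lemma is_derive_expRN r : is_derive r (1 : R) (fun x => expR (- x)) (- expR (- r)).
Proof.
have hN : is_derive r (1 : R) (fun x : R => - x) (- 1) by exact: is_deriveN.
apply: (is_derive_eq (is_derive_comp1 hN (is_derive_expR _))).
by rewrite mulrN1.
Qed.

Lemma is_derive_sinh r : is_derive r (1 : R) (@sinh R) (cosh r).
Proof.
have h := is_derive_mul (is_derive_sub (is_derive_expR r) (is_derive_expRN r)) (is_derive_const 2^-1 r 1).
by apply: (is_derive_eq h); rewrite /cosh; field.
Qed.

Lemma is_derive_cosh r : is_derive r (1 : R) (@cosh R) (sinh r).
Proof.
have h := is_derive_mul (is_derive_add (is_derive_expR r) (is_derive_expRN r)) (is_derive_const 2^-1 r 1).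
by apply: (is_derive_eq h); rewrite /sinh; field.
Qed.

Lemma is_derive_continuous (f : R -> R) u df : is_derive u (1 : R) f df -> {for u, continuous f}.
Proof. by case=> df' _; apply/differentiable_continuous/derivable1_diffP. Qed.

(** The function x cosh x - sinh x vanishes at 0 and has derivative x sinh x. *)
Lemma sinh_le_mul_cosh r : 0 < r -> sinh r <= r * cosh r.
Proof.
move=> r0; pose f (x : R) := x * cosh x - sinh x.
have hf x : is_derive x (1 : R) f (x * sinh x).
  have h := is_derive_sub (is_derive_mul (is_derive_id x 1) (is_derive_cosh x)) (is_derive_sinh x).
  by apply: (is_derive_eq h); ring.
have cf : continuous f by move=> x; exact: is_derive_continuous (hf x).
have [c] := MVT r0 (fun x _ => hf x) (continuous_subspaceT cf).
rewrite in_itv/= => /andP[c0 _].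
have -> : f 0 = 0 by rewrite /f /sinh oppr0 subrr !mul0r subr0.
rewrite !subr0 => E; rewrite -subr_ge0 -/(f r) E.
apply: mulr_ge0; last exact: ltW.
by apply: mulr_ge0; apply: ltW => //; exact: sinh_gt0.
Qed.

Lemma coth_ge_inv r : 0 < r -> r^-1 <= coth r.
Proof.
move=> r0; rewrite /coth ler_pdivlMr ?sinh_gt0// mulrC ler_pdivrMr// mulrC.
exact: sinh_le_mul_cosh.
Qed.

(** Combines the term q / sinh r of [DR_g] with coth (r/2) into the coth r of the volume density. *)
Lemma coth_half r : 0 < r -> coth (r / 2) = coth r + (sinh r)^-1.
Proof.
move=> r0; have s2 := sinh_gt0 (divr_gt0 r0 (ltr0n R 2)); have s1 := sinh_gt0 r0.
have E0 := expR_gt0 (r / 2).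
have e1 : expR r = expR (r / 2) ^+ 2 by rewrite expr2 -expRD; congr expR; field.
rewrite /coth; move: s1 s2; rewrite /cosh /sinh !expRN !e1.
move: (expR (r / 2)) E0 => E E0 s1 s2.
have E1 : E ^+ 2 - 1 != 0.
  apply/eqP => E1; have : E - E^-1 = 0 by have -> : E - E^-1 = (E ^+ 2 - 1) / E; [by field; rewrite gt_eqF|rewrite E1 mul0r].
  by move=> E2; move: s2; rewrite E2 mul0r ltxx.
field; rewrite E1 (gt_eqF E0) /=.
rewrite andbT (_ : (E * E) ^+ 2 - 1 = (E ^+ 2 - 1) * (E ^+ 2 + 1)); last by ring.
by rewrite mulf_neq0// gt_eqF// addr_gt0// exprn_gt0.
Qed.

Variables (p q : nat).
Hypothesis q1 : (1 <= q)%N.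
Local Notation h := (DR_h R p q).

Lemma DR_h_gt0 : 0 < h.
Proof.
have p0 : (0 : R) <= p%:R by rewrite ler0n.
have q0 : (1 : R) <= q%:R by rewrite ler1n.
by rewrite /DR_h; lra.
Qed.

(** The two cotangent terms form the logarithmic derivative of the density sinh^p (r/2) sinh^q (r),
    that is, the Laplacian of r. Thus h g is the Laplacian of r minus 1/r. *)
Lemma DR_g_h r : 0 < r -> h * DR_g p q r = p%:R / 2 * coth (r / 2) + q%:R * coth r - r^-1.
Proof.
move=> r0; rewrite /DR_g.
have h0 := DR_h_gt0; have -> : 2 / (p%:R + 2 * q%:R) = h^-1 by rewrite /DR_h invf_div.
have s0 := sinh_gt0 r0.
rewrite mulrBr [h * (h^-1 * _)]mulrA divff ?gt_eqF// mul1r coth_half// /DR_h.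
by move: (coth r) (sinh r) s0 => c s s0; field; rewrite !gt_eqF.
Qed.

(** Both hyperbolic cotangents in [DR_g_h] are at least the inverse of their argument. *)
Lemma DR_g_ge r : 0 < r -> (p%:R + q%:R - 1) / (h * r) <= DR_g p q r.
Proof.
move=> r0; have h0 := DR_h_gt0.
have -> : (p%:R + q%:R - 1) / (h * r) = (p%:R + q%:R - 1) / r / h by field; rewrite !gt_eqF.
rewrite ler_pdivrMr// [_ * h]mulrC DR_g_h//.
have c1 : r^-1 * 2 <= coth (r / 2).
  by have := coth_ge_inv (divr_gt0 r0 (ltr0n R 2)); rewrite invf_div mulrC.
have c2 := coth_ge_inv r0.
have -> : (p%:R + q%:R - 1) / r = p%:R / 2 * (r^-1 * 2) + q%:R * r^-1 - r^-1 by field; rewrite gt_eqF.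
rewrite lerD2r lerD// ler_wpM2l// ?ler0n// divr_ge0// ler0n.
Qed.

Lemma sinh_ge r : 0 < r -> r <= sinh r.
Proof.
move=> r0.
have hf x : is_derive x (1 : R) (@sinh R) (cosh x) by exact: is_derive_sinh.
have cf : continuous (@sinh R) by move=> x; exact: is_derive_continuous (hf x).
have [c] := MVT r0 (fun x _ => hf x) (continuous_subspaceT cf) => _.
have -> : sinh (0 : R) = 0 by rewrite /sinh oppr0 subrr mul0r.
rewrite !subr0 => ->; rewrite ler_pMl// /cosh expRN.
have := expR_gt0 c; move: (expR c) => E E0.
rewrite ler_pdivlMr// mul1r -subr_ge0.
have -> : E + E^-1 - 2 = (E - 1) ^+ 2 / E by field; rewrite gt_eqF.
by rewrite divr_ge0 ?sqr_ge0// ltW.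
Qed.

(** The error is at most C / r, since coth (r/2) - 1 = 2 / (e^r - 1) <= 2 / r and q / sinh r + 1 / r
    <= (q + 1) / r. *)
Lemma DR_g_cvg1 : DR_g p q r @[r --> +oo] --> (1 : R).
Proof.
have h0 := DR_h_gt0.
pose C : R := 2 + h^-1 * (q%:R + 1).
have C0 : 0 < C by rewrite ltr_pwDl// mulr_ge0// ?invr_ge0 ?(ltW h0)// addr_ge0.
have bnd r : 0 < r -> `|1 - DR_g p q r| <= C / r.
  move=> r0; rewrite /DR_g.
  have -> : 2 / (p%:R + 2 * q%:R) = h^-1 by rewrite /DR_h invf_div.
  have s0 := sinh_gt0 r0.
  have c1 : `|coth (r / 2) - 1| <= 2 / r.
    have e1 : expR r = expR (r / 2) ^+ 2 by rewrite expr2 -expRD; congr expR; field.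
    have er : r <= expR r - 1 by have := expR_ge1Dx r; lra.
    have -> : coth (r / 2) - 1 = 2 / (expR r - 1).
      rewrite /coth /cosh /sinh expRN e1; rewrite e1 in er.
      have := expR_gt0 (r / 2); move: (expR (r / 2)) er => E er E0.
      by field; rewrite !gt_eqF//=; lra.
    rewrite ger0_norm; last by rewrite divr_ge0//; lra.
    by rewrite ler_pM2l// lef_pV2// posrE; lra.
  have c2 : `|h^-1 * (q%:R / sinh r + r^-1)| <= h^-1 * ((q%:R + 1) / r).
    rewrite ger0_norm; last by rewrite mulr_ge0 ?invr_ge0 ?(ltW h0)// addr_ge0// ?invr_ge0 ?(ltW r0)// divr_ge0// ltW.
    rewrite ler_pM2l ?invr_gt0// mulrDl mul1r lerD2r ler_wpM2l// lef_pV2 ?posrE//.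
    exact: sinh_ge.
  rewrite -normrN opprB addrAC (le_trans (ler_normB _ _))//.
  have -> : C / r = 2 / r + h^-1 * ((q%:R + 1) / r) by rewrite /C; field; rewrite !gt_eqF.
  exact: lerD.
apply/cvgrPdist_le => eps e0; near=> r.
have r0 : 0 < r by near: r; exact: nbhs_pinfty_gt.
apply: (le_trans (bnd r r0)); rewrite ler_pdivrMr// mulrC -ler_pdivrMr//.
Unshelve. all: by end_near. Qed.

End Hyperbolic.

(** * Radial quantities as functions of U, and the identity for the weight *)

Section RadialFunctions.
Variable R : realType.
Implicit Types u : R.

(* The distance to the identity as a function of [DRU]. *)
Definition DRr u : R := 2 * ln (Num.sqrt u + Num.sqrt (u - 1)).

(** The length of grad U on the level u, that is, dU/dr, equal to half of sinh r. *)
Definition DRw u : R := Num.sqrt (u ^+ 2 - u).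

Lemma DRw_gt0 u : 1 < u -> 0 < DRw u.
Proof. by move=> u1; rewrite sqrtr_gt0 expr2 -{3}(mulr1 u) -mulrBr mulr_gt0//; lra. Qed.

Lemma DRw_sqr u : 1 <= u -> DRw u ^+ 2 = u ^+ 2 - u.
Proof. by move=> u1; rewrite sqr_sqrtr// expr2 -{3}(mulr1 u) -mulrBr mulr_ge0//; lra. Qed.

Lemma DRwE u : 1 <= u -> DRw u = Num.sqrt u * Num.sqrt (u - 1).
Proof. by move=> u1; rewrite -sqrtrM; [congr Num.sqrt; ring|lra]. Qed.

Let y u : R := Num.sqrt u + Num.sqrt (u - 1).

Let y_gt0 u : 1 <= u -> 0 < y u.
Proof. by move=> u1; rewrite ltr_wpDr ?sqrtr_ge0// sqrtr_gt0; lra. Qed.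

Let y_inv u : 1 <= u -> (y u)^-1 = Num.sqrt u - Num.sqrt (u - 1).
Proof.
move=> u1; have y0 := y_gt0 u1.
apply: (mulfI (lt0r_neq0 y0)); rewrite divff ?gt_eqF// /y.
have : Num.sqrt u ^+ 2 = u by rewrite sqr_sqrtr//; lra.
have : Num.sqrt (u - 1) ^+ 2 = u - 1 by rewrite sqr_sqrtr//; lra.
by rewrite mulrC -subr_sqr; lra.
Qed.

Let exp_half u : 1 <= u -> expR (DRr u / 2) = y u.
Proof.
move=> u1; rewrite /DRr mulrAC divff// mul1r lnK//.
exact: y_gt0.
Qed.

Lemma cosh_DRr u : 1 <= u -> cosh (DRr u / 2) = Num.sqrt u.
Proof. by move=> u1; rewrite /cosh expRN exp_half// y_inv// /y; field. Qed.

Lemma sinh_DRr u : 1 <= u -> sinh (DRr u / 2) = Num.sqrt (u - 1).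
Proof. by move=> u1; rewrite /sinh expRN exp_half// y_inv// /y; field. Qed.

Lemma sinh_double (r : R) : sinh r = 2 * (sinh (r / 2) * cosh (r / 2)).
Proof.
have e1 : expR r = expR (r / 2) ^+ 2 by rewrite expr2 -expRD; congr expR; field.
rewrite /sinh /cosh !expRN e1; have := expR_gt0 (r / 2); move: (expR _) => E E0.
by field; rewrite gt_eqF.
Qed.

Lemma sinh_DRr_full u : 1 <= u -> sinh (DRr u) = 2 * DRw u.
Proof. by move=> u1; rewrite sinh_double sinh_DRr// cosh_DRr// DRwE// [_ * Num.sqrt u]mulrC. Qed.

Lemma DRr1 : DRr 1 = 0.
Proof. by rewrite /DRr subrr sqrtr0 sqrtr1 addr0 ln1 mulr0. Qed.

Lemma DRr_gt0 u : 1 < u -> 0 < DRr u.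
Proof.
move=> u1; rewrite /DRr mulr_gt0// ln_gt0// ltr_wpDr ?sqrtr_ge0//.
by rewrite -[X in X < _]sqrtr1 ltr_sqrt//; lra.
Qed.

Lemma DRr_ge0 u : 1 <= u -> 0 <= DRr u.
Proof. by rewrite le_eqVlt => /predU1P[<-|/DRr_gt0/ltW//]; rewrite DRr1. Qed.

Lemma is_derive_sqrt_comp (f : R -> R) u df : 0 < f u -> is_derive u (1 : R) f df ->
  is_derive u (1 : R) (fun x => Num.sqrt (f x)) (df / (2 * Num.sqrt (f u))).
Proof.
move=> fu hf; apply: (is_derive_eq (is_derive_comp1 hf (is_derive1_sqrt fu))).
by rewrite mulrC.
Qed.

Lemma is_derive_DRr u : 1 < u -> is_derive u (1 : R) DRr (DRw u)^-1.
Proof.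
move=> u1.
have u0 : 0 < u by lra.
have um : 0 < u - 1 by lra.
have h1 := is_derive_sqrt_comp u0 (is_derive_id u (1 : R)).
have h2 := @is_derive_sqrt_comp (fun x : R => x - 1) _ _ um (is_derive_sub (is_derive_id u (1 : R)) (is_derive_const 1 u 1)).
have y0 := y_gt0 (ltW u1).
have h := is_derive_mul (is_derive_const 2 u 1) (is_derive_comp1 (is_derive_add h1 h2) (is_derive1_ln y0)).
apply: (is_derive_eq h); rewrite DRwE ?ltW//.
have s1 : 0 < Num.sqrt u by rewrite sqrtr_gt0.
have s2 : 0 < Num.sqrt (u - 1) by rewrite sqrtr_gt0.
rewrite /y in y0 *; move: (Num.sqrt u) (Num.sqrt _) s1 s2 y0 => a b a0 b0 ab0 /=.
by field; rewrite !gt_eqF.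
Qed.

Lemma is_derive_DRw u : 1 < u -> is_derive u (1 : R) DRw ((2 * u - 1) / (2 * DRw u)).
Proof.
move=> u1; have w0 : 0 < u ^+ 2 - u by have := DRw_gt0 u1; rewrite sqrtr_gt0.
have hu := is_derive_id u (1 : R).
have h := is_derive_sub (is_derive_mul hu hu) hu.
have h' : is_derive u (1 : R) (fun x : R => x ^+ 2 - x) (2 * u - 1).
  rewrite (_ : (fun x : R => x ^+ 2 - x) = (fun x : R => x * x - x)); last by apply/funext => z; rewrite expr2.
  by apply: (is_derive_eq h); ring.
exact: (@is_derive_sqrt_comp (fun x : R => x ^+ 2 - x) _ _ w0 h').
Qed.

Variables (p q : nat) (P : R).
Hypothesis q1 : (1 <= q)%N.
Hypothesis P2 : 2 <= P.
Hypothesis dimP : 1 + P * (P - 1) <= (p + q + 1)%:R.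
Local Notation h := (DR_h R p q).

(* [h * g(r)] as a function of [u = cosh^2 (r/2)]. *)
Definition DRG u : R := (h * u - q%:R / 2) / DRw u - (DRr u)^-1.

Lemma DRG_g u : 1 < u -> DRG u = h * DR_g p q (DRr u).
Proof.
move=> u1; have u1' := ltW u1; rewrite /DR_g.
have h0 := DR_h_gt0 R p q1; have -> : 2 / (p%:R + 2 * q%:R) = h^-1 by rewrite /DR_h invf_div.
have r0 := DRr_gt0 u1; have w0 := DRw_gt0 u1.
rewrite /coth cosh_DRr// sinh_DRr// sinh_DRr_full// /DRG.
have s2 : 0 < Num.sqrt (u - 1) by rewrite sqrtr_gt0; lra.
have -> : Num.sqrt u / Num.sqrt (u - 1) = u / DRw u.
  have s1 : 0 < Num.sqrt u by rewrite sqrtr_gt0; lra.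
  have e : Num.sqrt u ^+ 2 = u by rewrite sqr_sqrtr//; lra.
  by rewrite DRwE// -{3}e; field; rewrite !gt_eqF.
by field; rewrite !gt_eqF.
Qed.

Lemma dim_pq : P * (P - 1) <= p%:R + q%:R.
Proof. by move: dimP; rewrite !natrD; lra. Qed.

(** As P >= 2, the dimension bound forces p + q >= 2, which makes the lower bound of [DR_g_ge]
    positive. *)
Lemma DR_g_gt0 (r : R) : 0 < r -> 0 < DR_g p q r.
Proof.
move=> r0; apply: (lt_le_trans _ (DR_g_ge p q1 r0)).
apply: divr_gt0; last by apply: mulr_gt0 => //; exact: DR_h_gt0.
have dim := dim_pq; have P2' := P2.
have : 2 * 1 <= P * (P - 1) by rewrite ler_pM//; lra.
by have p0 := ler0n R p; have q0 := ler1n R q; lra.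
Qed.

Lemma DRG_gt0 u : 1 < u -> 0 < DRG u.
Proof.
by move=> u1; rewrite DRG_g// mulr_gt0 ?DR_h_gt0// DR_g_gt0// DRr_gt0.
Qed.

Definition dDRG u : R :=
  h / DRw u - (h * u - q%:R / 2) * (2 * u - 1) / (2 * DRw u ^+ 3) + (DRr u ^+ 2 * DRw u)^-1.

Lemma is_derive_DRG u : 1 < u -> is_derive u (1 : R) DRG (dDRG u).
Proof.
move=> u1; have r0 := DRr_gt0 u1; have w0 := DRw_gt0 u1.
have hA := is_derive_sub (is_derive_mul (is_derive_const h u 1) (is_derive_id u (1 : R))) (is_derive_const (q%:R / 2) u 1).
have hw := is_derive_inv (lt0r_neq0 w0) (is_derive_DRw u1).
have hr := is_derive_inv (lt0r_neq0 r0) (is_derive_DRr u1).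
have hh := is_derive_sub (is_derive_mul hA hw) hr.
apply: (is_derive_eq hh); rewrite /dDRG.
by move: (DRr u) (DRw u) r0 w0 => r w r0 w0; field; rewrite !gt_eqF.
Qed.

Definition DRs u : R := DRG u / P.

Definition DRkappa u : R := DRs u `^ (P - 1) / DRw u.

Definition dDRkappa u : R :=
  (P - 1) * DRs u `^ (P - 2) * (dDRG u / P) / DRw u
  - DRs u `^ (P - 1) * (2 * u - 1) / (2 * DRw u ^+ 3).

Lemma P_gt0 : 0 < P. Proof. exact: lt_le_trans P2. Qed.

Lemma DRs_gt0 u : 1 < u -> 0 < DRs u.
Proof. by move=> u1; rewrite divr_gt0 ?DRG_gt0 ?P_gt0. Qed.

Lemma is_derive_DRkappa u : 1 < u -> is_derive u (1 : R) DRkappa (dDRkappa u).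
Proof.
move=> u1; have w0 := DRw_gt0 u1; have P0 := P_gt0.
have hs : is_derive u (1 : R) DRs (dDRG u / P).
  by apply: (is_derive_eq (is_derive_mul (is_derive_DRG u1) (is_derive_const P^-1 u 1))); rewrite mulr0 addr0.
have hS := is_derive_comp1 hs (is_derive1_powR (P - 1) (DRs_gt0 u1)).
have hw := is_derive_inv (lt0r_neq0 w0) (is_derive_DRw u1).
apply: (is_derive_eq (is_derive_mul hS hw)); rewrite /dDRkappa.
have -> : P - 1 - 1 = P - 2 by ring.
by move: (DRw u) w0 => w w0; field; rewrite !gt_eqF.
Qed.

Lemma DRkappa_continuous u : 1 < u -> {for u, continuous DRkappa}.
Proof. by move=> u1; exact: is_derive_continuous (is_derive_DRkappa u1). Qed.

Lemma dDRkappa_continuous u : 1 < u -> {for u, continuous dDRkappa}.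
Proof.
move=> u1; have r0 := DRr_gt0 u1; have w0 := DRw_gt0 u1.
have cid : {for u, continuous (fun x : R => x)} by exact: id.
have cc (c : R) : {for u, continuous (fun _ : R => c)} by exact: cst_continuous.
have cw := is_derive_continuous (is_derive_DRw u1).
have cr := is_derive_continuous (is_derive_DRr u1).
have cG := is_derive_continuous (is_derive_DRG u1).
have cs : {for u, continuous DRs} by exact: continuousM cG (cc _).
have cpow a : {for u, continuous (fun x => DRs x `^ a)}.
  exact: (continuous_comp cs (is_derive_continuous (is_derive1_powR a (DRs_gt0 u1)))).
have cX n : {for u, continuous (fun x => DRw x ^+ n)}.
  by apply: (@continuous_comp _ _ _ DRw (fun x => x ^+ n)) => //; exact: exprn_continuous.
have crX n : {for u, continuous (fun x => DRr x ^+ n)}.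
  by apply: (@continuous_comp _ _ _ DRr (fun x => x ^+ n)) => //; exact: exprn_continuous.
have cdG : {for u, continuous dDRG}.
  apply: continuousD; first apply: continuousB.
  - apply: continuousM; first exact: cc.
    by apply: continuousV => //; rewrite gt_eqF.
  - apply: continuousM.
      apply: continuousM; apply: continuousB => //; apply: continuousM => //.
    apply: continuousV; first by rewrite gt_eqF// mulr_gt0// exprn_gt0.
    exact: continuousM.
  - apply: continuousV; first by rewrite gt_eqF// mulr_gt0// exprn_gt0.
    exact: continuousM.
apply: continuousB.
  apply: continuousM; last by apply: continuousV => //; rewrite gt_eqF.
  apply: continuousM; last exact: continuousM.
  exact: continuousM.
apply: continuousM.
  apply: continuousM => //; apply: continuousB => //; exact: continuousM.
apply: continuousV; first by rewrite gt_eqF// mulr_gt0// exprn_gt0.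
exact: continuousM.
Qed.

(* The weight of the inequality, as produced by the divergence of
   [kappa(U) grad U]. *)
Definition DRW u : R :=
  dDRkappa u * (u ^+ 2 - u) + DRkappa u * ((1 + (p%:R / 2 + q%:R)) * u - (1 + q%:R) / 2)
  - (P - 1) * DRs u `^ P.

(** The weight Lambda_P g^(P-2) of the left side is included with the three of the right side, so
    that only sums of non-negative integrals are compared. *)
Definition target_weight (r : R) : R :=
  (h / P) `^ P * DR_g p q r `^ (P - 2)
  + (h `^ (P - 2) * (P - 1) ^+ 2 / P `^ P) * (DR_g p q r `^ (P - 2) / r ^+ 2)
  + (h `^ (P - 1) * (P - 2) / P `^ P) *
      (DR_g p q r `^ (P - 2) * (DR_g p q r + (h * r)^-1) / r)
  + (h `^ (P - 2) / P `^ P) *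
      (DR_g p q r `^ (P - 2) * ((q%:R ^+ 2 - q%:R * P * (P - 1)) / sinh r ^+ 2
         + p%:R * (2 * h - P * (P - 1)) / (4 * sinh (r / 2) ^+ 2))).

(** The algebra behind [DRW_target], with the real powers turned into letters: H, g and T stand for
    the powers of exponent P - 2 of h, of g(r) and of P, while a, b, k and G stand for p, q, h and h
    g(r). *)
Lemma weight_identity (a b r u w H g T : R) : u != 0 -> w != 0 -> w ^+ 2 = u ^+ 2 - u ->
  r != 0 -> T != 0 -> P != 0 -> a + 2 * b != 0 ->
  let k := (a + 2 * b) / 2 in let G := (k * u - b / 2) / w - r^-1 in
  (P - 1) * (H * g / T) * ((k / w - (k * u - b / 2) * (2 * u - 1) / (2 * w ^+ 3) + (r ^+ 2 * w)^-1) / P) / w * (u ^+ 2 - u)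
   - H * g / T * (G / P) * (2 * u - 1) / (2 * w ^+ 3) * (u ^+ 2 - u)
   + H * g / T * (G / P) / w * ((1 + (a / 2 + b)) * u - (1 + b) / 2)
   - (P - 1) * (H * g / T * (G / P) ^+ 2)
  = H / T * (k / P) ^+ 2 * g
    + H * (P - 1) ^+ 2 / (T * P ^+ 2) * (g / r ^+ 2)
    + H * k * (P - 2) / (T * P ^+ 2) * (g * (G / k + (k * r)^-1) / r)
    + H / (T * P ^+ 2) * (g * ((b ^+ 2 - b * P * (P - 1)) / (2 * w) ^+ 2 + a * (2 * k - P * (P - 1)) / (4 * (u - 1)))).
Proof.
move=> u0 w0 w2 r0 T0 PN ab k G; rewrite /G /k {k G}.
(* With v = w / u, that is tanh (r/2), the constraint w^2 = u^2 - u becomes a rational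
   parametrisation by v, and an unconstrained rational identity remains. *)
have : exists v, [/\ v != 0, 1 - v ^+ 2 != 0, u = (1 - v ^+ 2)^-1 & w = v * (1 - v ^+ 2)^-1].
  have e : 1 - (w / u) ^+ 2 = u^-1 by rewrite exprMn w2; field.
  by exists (w / u); rewrite e invrK mulfVK// mulf_neq0 ?invr_neq0.
move=> [v [v0 v1 -> ->]]; field.
rewrite (_ : 1 + -1 * (1 - v ^+ 2) = v ^+ 2); last by ring.
by rewrite v1 expf_neq0// v0 PN T0 r0 ab.
Qed.

Lemma DRW_target u : 1 < u -> DRW u = target_weight (DRr u).
Proof.
move=> u1; have u1' := ltW u1; have r0 := DRr_gt0 u1; have w0 := DRw_gt0 u1.
have P0 := P_gt0; have h0 := DR_h_gt0 R p q1.
have g0 := DR_g_gt0 r0; have s0 := DRs_gt0 u1.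
have sE : DRs u = h * DR_g p q (DRr u) / P by rewrite /DRs DRG_g.
have PP (a : R) : 0 < a -> a `^ P = a `^ (P - 2) * a ^+ 2.
  move=> a0; rewrite -powR_mulrn ?ltW// -powRD; last by apply/implyP => _; rewrite gt_eqF.
  by congr (_ `^ _); ring.
have P1 (a : R) : 0 < a -> a `^ (P - 1) = a `^ (P - 2) * a.
  move=> a0; rewrite -{3}(powRr1 (ltW a0)) -powRD; last by apply/implyP => _; rewrite gt_eqF.
  by congr (_ `^ _); ring.
have pdiv (a b e : R) : 0 < a -> 0 < b -> (a / b) `^ e = a `^ e / b `^ e.
  move=> a0 b0; rewrite powRM ?ltW ?invr_gt0//; congr (_ * _).
  by rewrite -powR_inv1 ?ltW// -powRrM mulN1r powRN.
have sP : DRs u `^ (P - 2) = h `^ (P - 2) * DR_g p q (DRr u) `^ (P - 2) / P `^ (P - 2).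
  by rewrite sE (pdiv _ _ _ (mulr_gt0 h0 g0) P0) (powRM _ (ltW h0) (ltW g0)).
rewrite /target_weight /DRW /DRkappa /dDRkappa.
rewrite (PP _ s0) (P1 _ s0) (PP _ P0) (P1 _ h0) (PP _ (divr_gt0 h0 P0)) sP (pdiv _ _ _ h0 P0).
have -> : DR_g p q (DRr u) = DRG u / h by rewrite DRG_g// mulrAC divff ?mul1r// gt_eqF.
rewrite sinh_DRr_full// sinh_DRr// sqr_sqrtr; last by lra.
have u0 : u != 0 by rewrite gt_eqF//; lra.
have k0 : p%:R + 2 * q%:R != 0 :> R.
  by apply/eqP => k0; move: h0; rewrite /DR_h k0 mul0r ltxx.
have T0 : P `^ (P - 2) != 0 by rewrite gt_eqF// powR_gt0.
rewrite [(_ - _) * (u ^+ 2 - u)]mulrBl.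
exact: (weight_identity (h `^ (P - 2)) ((DRG u / h) `^ (P - 2)) u0 (lt0r_neq0 w0) (DRw_sqr u1')
  (lt0r_neq0 r0) T0 (lt0r_neq0 P0) k0).
Qed.

(** Since sinh r = 2 s c with s = sinh (r/2) and c = cosh (r/2), the common denominator is (2 s c)^2
    and the numerator is q^2 - q A + p (2h - A) c^2 with A = P (P - 1). The coefficient of c^2 is
    non-negative, and c^2 >= 1 bounds the numerator below by (p + q) (p + q - A), which the
    dimension bound makes non-negative. *)
Lemma third_weight_ge0 (r : R) : 0 < r ->
  0 <= (q%:R ^+ 2 - q%:R * P * (P - 1)) / sinh r ^+ 2
        + p%:R * (2 * h - P * (P - 1)) / (4 * sinh (r / 2) ^+ 2).
Proof.
move=> r0; have s0 := sinh_gt0 (divr_gt0 r0 (ltr0n R 2)); have c0 := cosh_gt0 (r / 2).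
rewrite sinh_double; have c1 : 1 <= cosh (r / 2) ^+ 2.
  have -> : cosh (r / 2) ^+ 2 = 1 + sinh (r / 2) ^+ 2.
    rewrite /cosh /sinh expRN; have := expR_gt0 (r / 2); move: (expR _) => E E0.
    by field; rewrite gt_eqF.
  by rewrite lerDl sqr_ge0.
have dim := dim_pq; have p0 := ler0n R p; have q0 := ler0n R q.
have hE : 2 * h = p%:R + 2 * q%:R by rewrite /DR_h; field.
move: (sinh _) (cosh _) s0 c0 c1 => s c s0 c0 c1.
have -> : (q%:R ^+ 2 - q%:R * P * (P - 1)) / (2 * (s * c)) ^+ 2 + p%:R * (2 * h - P * (P - 1)) / (4 * s ^+ 2) =
   ((q%:R ^+ 2 - q%:R * P * (P - 1)) + p%:R * (2 * h - P * (P - 1)) * c ^+ 2) / (2 * (s * c)) ^+ 2.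
  by field; rewrite !gt_eqF.
rewrite divr_ge0 ?sqr_ge0// hE.
have m1 : 0 <= p%:R * (p%:R + 2 * q%:R - P * (P - 1)) by rewrite mulr_ge0//; lra.
have m2 : p%:R * (p%:R + 2 * q%:R - P * (P - 1)) <= p%:R * (p%:R + 2 * q%:R - P * (P - 1)) * c ^+ 2.
  by rewrite ler_peMr.
have m3 : 0 <= (p%:R + q%:R) * (p%:R + q%:R - P * (P - 1)) by rewrite mulr_ge0//; lra.
by lra.
Qed.

Lemma integrands_ge0 (r : R) : 0 < r ->
  [/\ 0 <= DR_g p q r `^ (P - 2) / r ^+ 2,
      0 <= DR_g p q r `^ (P - 2) * (DR_g p q r + (h * r)^-1) / r &
      0 <= DR_g p q r `^ (P - 2) * ((q%:R ^+ 2 - q%:R * P * (P - 1)) / sinh r ^+ 2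
         + p%:R * (2 * h - P * (P - 1)) / (4 * sinh (r / 2) ^+ 2))].
Proof.
move=> r0; have g0 := DR_g_gt0 r0; have h0 := DR_h_gt0 R p q1.
split.
- by rewrite divr_ge0 ?powR_ge0// sqr_ge0.
- apply: divr_ge0; last exact: ltW.
  rewrite mulr_ge0 ?powR_ge0// addr_ge0 ?(ltW g0)// invr_ge0 ltW// mulr_gt0//.
- by rewrite mulr_ge0 ?powR_ge0// third_weight_ge0.
Qed.

Lemma coefficients_ge0 :
  [/\ 0 <= (h / P) `^ P, 0 <= h `^ (P - 2) * (P - 1) ^+ 2 / P `^ P,
     0 <= h `^ (P - 1) * (P - 2) / P `^ P & 0 <= h `^ (P - 2) / P `^ P].
Proof.
have PP := P2; split; first exact: powR_ge0.
- by rewrite divr_ge0 ?powR_ge0// mulr_ge0 ?powR_ge0 ?sqr_ge0.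
- by rewrite divr_ge0 ?powR_ge0// mulr_ge0 ?powR_ge0//; lra.
- by rewrite divr_ge0 ?powR_ge0.
Qed.

Lemma target_weight_ge0 (r : R) : 0 < r -> 0 <= target_weight r.
Proof.
move=> /integrands_ge0[i1 i2 i3]; have [c1 c2 c3 c4] := coefficients_ge0.
by rewrite /target_weight !addr_ge0// mulr_ge0// powR_ge0.
Qed.

End RadialFunctions.

(** * Powers of the absolute value and Young's inequality *)

Section RealC1.
Variable R : realType.

(** Squaring removes the corner of the positive part at c; this is why the cut-off is built from a
    square. *)
Lemma is_derive_sqr_pos (c u : R) :
  is_derive u (1 : R) (fun x => Num.max 0 (x - c) ^+ 2) (2 * Num.max 0 (u - c)).
Proof.
have hu := is_derive_sub (is_derive_id u (1 : R)) (is_derive_const c u 1).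
have hsq : is_derive u (1 : R) (fun x : R => (x - c) ^+ 2) (2 * (u - c)).
  rewrite (_ : (fun x : R => (x - c) ^+ 2) = (fun x => (x - c) * (x - c))); last by apply/funext => x; rewrite expr2.
  by apply: (is_derive_eq (is_derive_mul hu hu)); ring.
have [uc|cu|->] := ltgtP u c.
- rewrite (max_idPl _); last by lra.
  rewrite mulr0; apply: (near_eq_is_derive _ (is_derive_const 0 u 1)).
  near=> x; rewrite (max_idPl _) ?expr0n//=.
  by rewrite subr_le0; apply/ltW; near: x; exact: lt_nbhsl.
- rewrite (max_idPr _); last by lra.
  apply: (near_eq_is_derive _ hsq); near=> x; rewrite (max_idPr _)//.
  by rewrite subr_ge0; apply/ltW; near: x; exact: lt_nbhsr.
rewrite subrr maxxx mulr0.
have cv : h^-1 *: ((fun x : R => Num.max 0 (x - c) ^+ 2) (h *: 1 + c) - (fun x : R => Num.max 0 (x - c) ^+ 2) c) @[h --> 0^'] --> (0 : R).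
  apply: (@cvg_trans _ (Num.max 0 h @[h --> (0 : R)^'])).
    apply: near_eq_cvg; near=> h => /=.
    have h0 : h != 0 by near: h; exact: nbhs_dnbhs_neq.
    rewrite subrr maxxx expr0n/= subr0 /GRing.scale/= mulr1 addrK.
    have [h1|h1] := leP 0 h; last by rewrite expr0n/= mulr0.
    by rewrite expr2 mulKf.
  apply: cvg_within_filter.
  have c0 : {for (0 : R), continuous (fun h : R => Num.max 0 h)}.
    by apply: continuous_max; [exact: cst_continuous|exact: id].
  suff : Num.max 0 h @[h --> (0 : R)] --> Num.max (0 : R) 0 by rewrite maxxx.
  exact: c0.
by apply: DeriveDef; [apply/cvg_ex; eexists; exact: cv|exact: cvg_lim cv].
Unshelve. all: by end_near. Qed.

Variable P : R.
Hypothesis P2 : 2 <= P.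

Definition absP (y : R) : R := `|y| `^ P.
Definition dabsP (y : R) : R := P * `|y| `^ (P - 1) * Num.sg y.

Let powR_small (a y : R) : 1 <= a -> `|y| <= 1 -> `|y| `^ a <= `|y|.
Proof.
move=> a1 y1; have [->|y0] := eqVneq y 0.
  by rewrite normr0 powR0// gt_eqF//; lra.
by apply: ge1r_powR => //; rewrite normr_gt0 y0.
Qed.

(** Only the point 0 is delicate. There the difference quotient is |h|^(P-1) in absolute value, at
    most |h| for |h| <= 1 because P >= 2. *)
Lemma is_derive_absP y : is_derive y (1 : R) absP (dabsP y).
Proof.
have PP := P2; rewrite /dabsP.
have [y0|y0|->] := ltgtP y 0.
- rewrite ltr0_sg// ltr0_norm// mulrN1.
  have h := is_derive_comp1 (is_deriveN (is_derive_id y (1 : R))) (is_derive1_powR P (_ : 0 < - y)).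
  apply: (near_eq_is_derive _ (is_derive_eq (h _) _)); rewrite ?oppr_gt0 ?mulrN1//.
  near=> x; rewrite /absP ltr0_norm//; near: x; exact: lt_nbhsl.
- rewrite gtr0_sg// gtr0_norm// mulr1.
  apply: (near_eq_is_derive _ (is_derive1_powR P y0)).
  near=> x; rewrite /absP gtr0_norm//; near: x; exact: lt_nbhsr.
rewrite sgr0 mulr0.
have cv : h^-1 *: (absP (h *: 1 + 0) - absP 0) @[h --> 0^'] --> (0 : R).
  apply/cvgrPdist_le => e e0; near=> h.
  have h0 : h != 0 by near: h; exact: nbhs_dnbhs_neq.
  have h1 : `|h| <= Num.min e 1.
    near: h; apply: dnbhs0_le; by rewrite lt_min e0 ltr01.
  rewrite sub0r normrN /absP normr0 powR0 ?subr0; last by rewrite gt_eqF//; lra.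
  rewrite addr0 /GRing.scale/= mulr1 normrM normfV (ger0_norm (powR_ge0 _ _)).
  rewrite -(mulr_powRB1 (normr_ge0 h)); last by lra.
  rewrite mulKf ?normr_eq0//.
  move: h1; rewrite le_min => /andP[he h1].
  by apply: le_trans he; apply: powR_small => //; lra.
by apply: DeriveDef; [apply/cvg_ex; eexists; exact: cv|exact: cvg_lim cv].
Unshelve. all: by end_near. Qed.

Lemma dabsP_continuous : continuous dabsP.
Proof.
have PP := P2; move=> y.
have [y0|y0|->] := ltgtP y 0.
- apply: (@cvg_trans _ ((fun x => - (P * (- x) `^ (P - 1))) @ y)).
    apply: near_eq_cvg; near=> x; have x0 : x < 0 by near: x; exact: lt_nbhsl.
    by rewrite /dabsP ltr0_sg// ltr0_norm// mulrN1.
  have -> : dabsP y = - (P * (- y) `^ (P - 1)) by rewrite /dabsP ltr0_sg// ltr0_norm// mulrN1.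
  have ny : 0 < - y by rewrite oppr_gt0.
  have c1 : {for y, continuous (fun x : R => (- x) `^ (P - 1))}.
    exact: is_derive_continuous (is_derive_comp1 (is_deriveN (is_derive_id y (1 : R))) (is_derive1_powR (P - 1) ny)).
  have c2 : {for y, continuous (fun _ : R => P)} by exact: cst_continuous.
  exact: (continuousN (continuousM c2 c1)).
- apply: (@cvg_trans _ ((fun x => P * x `^ (P - 1)) @ y)).
    apply: near_eq_cvg; near=> x; have x0 : 0 < x by near: x; exact: lt_nbhsr.
    by rewrite /dabsP gtr0_sg// gtr0_norm// mulr1.
  have -> : dabsP y = P * y `^ (P - 1) by rewrite /dabsP gtr0_sg// gtr0_norm// mulr1.
  have c2 : {for y, continuous (fun _ : R => P)} by exact: cst_continuous.
  exact: (continuousM c2 (is_derive_continuous (is_derive1_powR (P - 1) y0))).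
rewrite /continuous_at {2}/dabsP sgr0 mulr0.
apply/cvgrPdist_le => e e0.
have near0 : \forall x \near (0 : R), `|x| <= Num.min (e / P) 1.
  by apply: nbhs0_le; rewrite lt_min ltr01 andbT divr_gt0//; lra.
near=> x.
have h1 : `|x| <= Num.min (e / P) 1.
  by near: x; exact: near0.
move: h1; rewrite le_min => /andP[xe x1].
rewrite sub0r normrN /dabsP !normrM [`|P|]gtr0_norm; last by lra.
rewrite [`|_ `^ _|]ger0_norm ?powR_ge0//.
rewrite ler_pdivlMr in xe; last by lra.
rewrite -[leRHS]mulr1 ler_pM//.
- by rewrite mulr_ge0 ?powR_ge0//; lra.
- apply: le_trans xe; rewrite mulrC ler_wpM2r//; first by lra.
  by apply: powR_small => //; lra.
- by rewrite normr_sg; case: (x != 0).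
Unshelve. all: by end_near. Qed.

Lemma absP_continuous : continuous absP.
Proof. by move=> y; exact: is_derive_continuous (is_derive_absP y). Qed.

(** Young's inequality for a and (f s)^(P-1) with the conjugate exponents P and P / (P - 1),
    multiplied by P. *)
Lemma young (a f s : R) : 0 <= a -> 0 <= f -> 0 <= s ->
  P * a * (f `^ (P - 1) * s `^ (P - 1)) <= a `^ P + (P - 1) * (f `^ P * s `^ P).
Proof.
move=> a0 f0 s0; have PP := P2.
have P1 : 0 < P - 1 by lra.
have PN : P != 0 by rewrite gt_eqF//; lra.
have P1N : P - 1 != 0 by rewrite gt_eqF.
have := @conjugate_powR R a ((f * s) `^ (P - 1)) P (P / (P - 1)) a0 (powR_ge0 _ _).
have -> : P^-1 + (P / (P - 1))^-1 = 1 by field; rewrite PN P1N.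
have P0 : 0 < P by lra.
move=> /(_ P0 (divr_gt0 P0 P1) erefl).
rewrite -powRrM (_ : (P - 1) * (P / (P - 1)) = P); last by field.
rewrite !powRM// => H.
have -> : a `^ P + (P - 1) * (f `^ P * s `^ P) =
  P * (a `^ P / P + f `^ P * s `^ P / (P / (P - 1))) by field; rewrite PN P1N.
by rewrite -mulrA ler_wpM2l// ltW.
Qed.

End RealC1.

(** * Cutting the radial field off at the identity *)

Section Cutoff.
Variables (R : realType) (p q : nat) (P : R).
Hypothesis q1 : (1 <= q)%N.
Hypothesis P2 : 2 <= P.
Hypothesis dimP : 1 + P * (P - 1) <= (p + q + 1)%:R.
Local Notation h := (DR_h R p q).
Local Notation kappa := (DRkappa p q P).
Local Notation dkappa := (dDRkappa p q P).

(* On [u > 1] this is C^1 for [0 < eps] and tends to 1 as [eps] decreases to 0. *)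
Definition cutoff (eps u : R) : R := Num.max 0 (u - (1 + eps)) ^+ 2 / (u - 1) ^+ 2.

(** The singular quotient kappa / (u - 1)^2 is kept as one factor. For eps > 0 the other factor
    vanishes near every u <= 1, so the product is C^1 on the whole line. *)
Definition cutkappa (eps u : R) : R :=
  Num.max 0 (u - (1 + eps)) ^+ 2 * (kappa u / (u - 1) ^+ 2).

Definition dcutkappa (eps u : R) : R :=
  2 * Num.max 0 (u - (1 + eps)) * (kappa u / (u - 1) ^+ 2) +
  Num.max 0 (u - (1 + eps)) ^+ 2 * (dkappa u / (u - 1) ^+ 2 - 2 * kappa u / (u - 1) ^+ 3).

Lemma is_derive_kappa2 (u : R) : 1 < u ->
  is_derive u (1 : R) (fun u : R => kappa u / (u - 1) ^+ 2) (dkappa u / (u - 1) ^+ 2 - 2 * kappa u / (u - 1) ^+ 3).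
Proof.
move=> u1; have u0 : u - 1 != 0 by rewrite gt_eqF//; lra.
have hu := is_derive_sub (is_derive_id u (1 : R)) (is_derive_const 1 u 1).
have hi := @is_derive_inv _ _ (fun x : R => x - 1) u 1 _ u0 hu.
have hk := is_derive_DRkappa q1 P2 dimP u1.
have hh := is_derive_mul hk (is_derive_mul hi hi).
rewrite (_ : (fun u => _) = (fun u : R => kappa u * ((u - 1)^-1 * (u - 1)^-1))); last first.
  by apply/funext => z; rewrite expr2 invfM.
by apply: (is_derive_eq hh); field.
Qed.

Lemma dkappa2_continuous (u : R) : 1 < u ->
  {for u, continuous (fun u : R => dkappa u / (u - 1) ^+ 2 - 2 * kappa u / (u - 1) ^+ 3)}.
Proof.
move=> u1; have u0 : u - 1 != 0 by rewrite gt_eqF//; lra.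
have cc (c : R) : {for u, continuous (fun _ : R => c)} by exact: cst_continuous.
have cid : {for u, continuous (fun x : R => x)} by exact: id.
have cu : {for u, continuous (fun x : R => x - 1)} by exact: (continuousB cid (cc 1)).
have cX n : {for u, continuous (fun x : R => ((x - 1) ^+ n)^-1)}.
  apply: continuousV; first by rewrite expf_neq0.
  by apply: (@continuous_comp _ _ _ (fun x : R => x - 1) (fun x => x ^+ n)) => //; exact: exprn_continuous.
have ck := DRkappa_continuous q1 P2 dimP u1.
have cdk := dDRkappa_continuous q1 P2 dimP u1.
apply: continuousB; apply: continuousM => //.
exact: continuousM.
Qed.

Lemma max_eventually0 (eps u : R) : 0 < eps -> u <= 1 ->
  \forall x \near u, Num.max 0 (x - (1 + eps)) = 0.
Proof.
move=> e0 u1; near=> x; apply/max_idPl; rewrite subr_le0 ltW//.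
by near: x; apply: lt_nbhsl; lra.
Unshelve. all: by end_near. Qed.

Lemma is_derive_cutkappa eps u : 0 < eps ->
  is_derive u (1 : R) (cutkappa eps) (dcutkappa eps u).
Proof.
move=> e0; have [u1|u1] := leP u 1.
  have nz := max_eventually0 e0 u1.
  have m0 := nbhs_singleton nz.
  rewrite /dcutkappa m0 mulr0 mul0r add0r expr0n/= mul0r.
  apply: (near_eq_is_derive _ (is_derive_const 0 u 1)).
  by apply: filterS nz => x; rewrite /cutkappa => ->; rewrite expr0n/= mul0r.
exact: (is_derive_eq (is_derive_mul (is_derive_sqr_pos (1 + eps) u) (is_derive_kappa2 u1)) erefl).
Qed.

Lemma dcutkappa_continuous eps : 0 < eps -> continuous (dcutkappa eps).
Proof.
move=> e0 u; have [u1|u1] := leP u 1.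
  have nz := max_eventually0 e0 u1.
  have E : \forall x \near u, (fun=> 0) x = dcutkappa eps x.
    by apply: filterS nz => x; rewrite /dcutkappa => ->; rewrite mulr0 mul0r add0r expr0n/= mul0r.
  rewrite /continuous_at -(nbhs_singleton E).
  by apply: cvg_trans (near_eq_cvg E) _; exact: (cvg_cst (0 : R)).
have cc (c : R) : {for u, continuous (fun _ : R => c)} by exact: cst_continuous.
have cid : {for u, continuous (fun x : R => x)} by exact: id.
have cm : {for u, continuous (fun x => Num.max 0 (x - (1 + eps)))}.
  by apply: continuous_max => //; exact: (continuousB cid (cc _)).
have ck := is_derive_continuous (is_derive_kappa2 u1).
have cdk := dkappa2_continuous u1.
have cm2 : {for u, continuous (fun x => Num.max 0 (x - (1 + eps)) ^+ 2)}.
  exact: is_derive_continuous (is_derive_sqr_pos (1 + eps) u).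
exact: (continuousD (continuousM (continuousM (cc 2) cm) ck) (continuousM cm2 cdk)).
Qed.

Lemma cutoff_itv eps u : 0 <= eps -> 1 < u -> 0 <= cutoff eps u <= 1.
Proof.
move=> e0 u1; rewrite /cutoff divr_ge0 ?sqr_ge0//=.
have u0 : 0 < u - 1 by lra.
rewrite ler_pdivrMr ?exprn_gt0// mul1r ler_sqr ?nnegrE ?le_max ?lexx ?(ltW u0)//.
by rewrite ge_max ltW//; lra.
Qed.

Lemma cutkappaE eps u : cutkappa eps u = cutoff eps u * kappa u.
Proof. by rewrite /cutkappa /cutoff mulrCA mulrC mulrA. Qed.

Lemma kappa_gt0 u : 1 < u -> 0 < kappa u.
Proof. by move=> u1; rewrite divr_gt0 ?DRw_gt0// powR_gt0// DRs_gt0. Qed.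

(** The cut-off is non-decreasing in u and kappa is positive, so differentiating the cut-off adds a
    non-negative term. This sign takes the place of an estimate of the cut-off error. *)
Lemma dcutkappa_ge eps u : 0 <= eps -> 1 < u -> cutoff eps u * dkappa u <= dcutkappa eps u.
Proof.
move=> e0 u1; rewrite /dcutkappa /cutoff; set m := Num.max 0 _.
have u0 : 0 < u - 1 by lra.
have k0 := kappa_gt0 u1.
have m0 : 0 <= m by rewrite le_max lexx.
have mu : 0 <= u - 1 - m by rewrite subr_ge0 ge_max ltW//; lra.
rewrite -subr_ge0 (_ : _ - _ = 2 * m * kappa u * (u - 1 - m) / (u - 1) ^+ 3).
  apply: divr_ge0; last by rewrite exprn_ge0// ltW.
  by apply: mulr_ge0 => //; apply: mulr_ge0; [exact: mulr_ge0|exact: ltW].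
by field; rewrite gt_eqF.
Qed.

End Cutoff.

Lemma continuous_mul (R : realType) (T : topologicalType) (f g : T -> R) x :
  {for x, continuous f} -> {for x, continuous g} -> {for x, continuous (fun y => f y * g y)}.
Proof. by move=> cf cg; exact: continuousM. Qed.

Lemma continuous_sqr (R : realType) (T : topologicalType) (f : T -> R) x :
  {for x, continuous f} -> {for x, continuous (fun y => f y ^+ 2)}.
Proof.
move=> cf; apply: (@continuous_comp _ _ _ f (fun z : R => z ^+ 2)) => //.
exact: exprn_continuous.
Qed.

Lemma cutoff1 (R : realType) (eps u : R) : 0 <= eps -> u <= 1 -> cutoff eps u = 0.
Proof.
move=> e0 u1; rewrite /cutoff (max_idPl _); last by lra.
by rewrite expr0n/= mul0r.
Qed.

(** * The inequality at the identity *)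

Section HardyAtIdentity.
Variables (R : realType) (p q : nat) (br : 'rV[R]_p -> 'rV[R]_p -> 'rV[R]_q) (P : R).
Hypothesis hbr : is_DR_bracket br.
Hypothesis q1 : (1 <= q)%N.
Hypothesis P2 : 2 <= P.
Hypothesis dimP : 1 + P * (P - 1) <= (p + q + 1)%:R.
Local Notation X := (DRpt R p q).
Local Notation U := (@DRU R p q).
Local Notation vol := (@DRvol R p q).

Lemma DRW_ge0 u : 1 < u -> 0 <= DRW p q P u.
Proof. by move=> u1; rewrite DRW_target// target_weight_ge0// DRr_gt0. Qed.

Lemma DRW_continuous u : 1 < u -> {for u, continuous (DRW p q P)}.
Proof.
move=> u1; have PP := P2.
have cc (c : R) : {for u, continuous (fun _ : R => c)} by exact: cst_continuous.
have cid : {for u, continuous (fun x : R => x)} by exact: id.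
have ck := DRkappa_continuous q1 P2 dimP u1.
have cdk := dDRkappa_continuous q1 P2 dimP u1.
have cs : {for u, continuous (DRs p q P)}.
  exact: continuousM (is_derive_continuous (is_derive_DRG p q u1)) (cc _).
have cp : {for u, continuous (fun x => DRs p q P x `^ P)}.
  exact: (continuous_comp cs (is_derive_continuous (is_derive1_powR P (DRs_gt0 q1 P2 dimP u1)))).
have c2 : {for u, continuous (fun x : R => x ^+ 2 - x)}.
  by apply: continuousB => //; exact: exprn_continuous.
exact: (continuousB (continuousD (continuousM cdk c2)
  (continuousM ck (continuousB (continuousM (cc _) cid) (cc _)))) (continuousM (cc _) cp)).
Qed.

Lemma DRframe_coord_continuous k l : continuous (fun x : X => DRcoord (DRframe br x k) l).
Proof.
have ce (c : R) : continuous (fun x : X => expR (c * x.2)).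
  by apply: C1_continuous; exact: C1_DRexp.
have cc (c : R) : continuous (fun _ : X => c) by move=> x; exact: cst_continuous.
case: k => [[i|j]|k]; case: l => [[i'|j']|l] /=.
- rewrite (_ : (fun _ => _) = (fun x : X => expR (2^-1 * x.2) * (delta_mx 0 i : 'rV[R]_p) 0 i')).
    by move=> x; exact: (continuous_mul (ce _ x) (cc _ x)).
  by apply/funext => x; rewrite mxE [_ * 2^-1]mulrC.
- rewrite (_ : (fun _ => _) = (fun x : X => (expR (2^-1 * x.2) / 2) * br x.1.1 (delta_mx 0 i) 0 j')).
    move=> x; have cb := C1_continuous (DRbr_lin hbr (delta_mx 0 i) j').1.
    exact: (continuous_mul (continuous_mul (ce _ x) (cc _ x)) (cb x)).
  by apply/funext => x; rewrite mxE [x.2 * 2^-1]mulrC.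
- exact: cc.
- by under eq_fun do rewrite mxE; exact: cc.
- rewrite (_ : (fun _ => _) = (fun x : X => expR (1 * x.2) * (delta_mx 0 j : 'rV[R]_q) 0 j')).
    by move=> x; exact: (continuous_mul (ce _ x) (cc _ x)).
  by apply/funext => x; rewrite mxE mul1r.
- exact: cc.
- by under eq_fun do rewrite mxE; exact: cc.
- by under eq_fun do rewrite mxE; exact: cc.
- exact: cc.
Qed.

Lemma cvg_bigsum (T : topologicalType) (I : Type) (s : seq I) (F : I -> T -> R) :
  (forall i, continuous (F i)) -> continuous (fun x => \sum_(i <- s) F i x).
Proof.
move=> cF; elim: s => [|i s ih].
  rewrite (_ : (fun _ => _) = (fun=> 0)); first by move=> x; exact: cst_continuous.
  by apply/funext => y; rewrite big_nil.
rewrite (_ : (fun _ => _) = (fun x => F i x + \sum_(j <- s) F j x)).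
  by move=> x; apply: continuousD; [exact: cF|exact: ih].
by apply/funext => y; rewrite big_cons.
Qed.

Lemma grad_norm_continuous (phi : X -> R) : C1 phi -> continuous (grad_norm br phi).
Proof.
move=> hphi.
rewrite (_ : grad_norm br phi = (fun x => Num.sqrt (\sum_(k : DRidx p q) 'D_(DRframe br x k) phi x ^+ 2))); last first.
  by apply/funext => x; rewrite grad_normE.
move=> x; apply: (@continuous_comp _ _ _ (fun x : X => \sum_(k : DRidx p q) 'D_(DRframe br x k) phi x ^+ 2) Num.sqrt); last exact: sqrt_continuous.
apply: cvg_bigsum => k y.
have c1 : {for y, continuous (fun x : X => 'D_(DRframe br x k) phi x)}.
  rewrite (_ : (fun x => _) = (fun x => \sum_(l : DRidx p q) DRcoord (DRframe br x k) l * 'D_(DRbasis R l) phi x)).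
    apply: cvg_bigsum => l z.
    exact: (continuous_mul (@DRframe_coord_continuous k l z) (hphi.2 (DRbasis R l) z)).
  by apply/funext => z; rewrite (derive_coord _ (hphi.1 z)).
exact: (continuous_sqr c1).
Qed.

Lemma grad_norm_ge0 phi x : 0 <= grad_norm br phi x.
Proof. exact: sqrtr_ge0. Qed.

Variables (phi : X -> R) (K : set X).
Hypotheses (hphi : C1 phi) (cptK : compact K) (phiK : forall x, ~ K x -> phi x = 0).

Definition energy (x : X) : R := vol x * grad_norm br phi x `^ P.

(** The cut-off is 0 at the identity for eps = 0 as well, so the singular W is silenced there for
    every eps >= 0. *)
Definition weighted (eps : R) (x : X) : R :=
  vol x * (`|phi x| `^ P * (cutoff eps (U x) * DRW p q P (U x))).

Lemma vol_gt0 (x : X) : 0 < vol x.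
Proof. exact: DRexp_gt0. Qed.

Lemma vol_continuous : continuous vol.
Proof. by apply: C1_continuous; exact: C1_DRexp. Qed.

Lemma U_continuous : continuous U.
Proof. by apply: C1_continuous; exact: C1_DRU. Qed.

Lemma energy_continuous : continuous energy.
Proof.
move=> x.
have cg : {for x, continuous (fun x => absP P (grad_norm br phi x))}.
  apply: (@continuous_comp _ _ _ (grad_norm br phi) (absP P)); first exact: grad_norm_continuous.
  exact: absP_continuous.
rewrite (_ : energy = (fun x => vol x * absP P (grad_norm br phi x))).
  exact: (continuous_mul (@vol_continuous x) cg).
by apply/funext => y; rewrite /energy /absP ger0_norm// grad_norm_ge0.
Qed.

Lemma energy_ge0 x : 0 <= energy x.
Proof. by rewrite mulr_ge0 ?(ltW (vol_gt0 _))// powR_ge0. Qed.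

Lemma weighted_ge0 eps x : 0 <= eps -> 0 <= weighted eps x.
Proof.
move=> e0; rewrite /weighted mulr_ge0 ?(ltW (vol_gt0 _))// mulr_ge0 ?powR_ge0//.
have [U1|U1] := leP (U x) 1; first by rewrite cutoff1// mul0r.
by rewrite mulr_ge0 ?DRW_ge0//; case/andP: (cutoff_itv e0 U1).
Qed.

Lemma weighted_continuous (w : R * X) : 1 < U w.2 ->
  {for w, continuous (fun w : R * X => weighted `|w.1| w.2)}.
Proof.
move=> U1.
have c1 : {for w, continuous (fun w : R * X => w.1)} by exact: cvg_fst.
have c2 : {for w, continuous (fun w : R * X => w.2)} by exact: cvg_snd.
have cc (c : R) : {for w, continuous (fun _ : R * X => c)} by exact: cst_continuous.
have cU : {for w, continuous (fun w : R * X => U w.2)}.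
  by apply: (continuous_comp c2); exact: U_continuous.
have cU1 : {for w, continuous (fun w : R * X => U w.2 - 1)} by exact: (continuousB cU (cc 1)).
have cn : {for w, continuous (fun w : R * X => `|w.1|)}.
  by apply: (continuous_comp c1); exact: norm_continuous.
have cm : {for w, continuous (fun w : R * X => Num.max 0 (U w.2 - (1 + `|w.1|)))}.
  apply: continuous_max => //; exact: (continuousB cU (continuousD (cc 1) cn)).
have ccut : {for w, continuous (fun w : R * X => cutoff `|w.1| (U w.2))}.
  apply: continuous_mul; first exact: continuous_sqr.
  apply: continuousV; last exact: continuous_sqr.
  by rewrite expf_neq0// gt_eqF// subr_gt0.
have cW : {for w, continuous (fun w : R * X => DRW p q P (U w.2))}.
  by apply: (continuous_comp cU); exact: DRW_continuous.
have cphi : {for w, continuous (fun w : R * X => `|phi w.2| `^ P)}.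
  apply: (@continuous_comp _ _ _ (fun w : R * X => phi w.2) (absP P)); last exact: absP_continuous.
  by apply: (continuous_comp c2); exact: C1_continuous.
have cv : {for w, continuous (fun w : R * X => vol w.2)}.
  by apply: (continuous_comp c2); exact: vol_continuous.
exact: (continuousM cv (continuousM cphi (continuousM ccut cW))).
Qed.

(** The absolute value extends the family to negative parameters; eps = 0 becomes an interior point,
    at which lower semicontinuity can be applied. *)
Lemma nnlsc_weighted : nnlsc (fun w : R * X => (weighted `|w.1| w.2)%:E).
Proof.
apply: nnlsc_EFin => [w|w]; first exact: weighted_ge0.
have [U1|U1] := leP (U w.2) 1; last by right; exact: weighted_continuous.
by left; rewrite /weighted cutoff1// mul0r !mulr0.
Qed.

(** Three comparisons remain once the divergence is expanded: the derivative of phi is absorbed by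
    Cauchy-Schwarz and Young ([T1], [T3]), the derivative of the cut-off is dropped by its sign
    ([T2]), and the energy gets the factor c <= 1 ([T3]). *)
Lemma weighted_le_energy eps x : 0 < eps ->
  weighted eps x <= energy x + \sum_(k : DRidx p q)
    'D_(DRbasis R k) (fun y => vol y * (cutkappa p q P eps (U y) * absP P (phi y)) * DRcoord (DRgradU br y) k) x.
Proof.
move=> e0; have PP := P2.
pose psi y := cutkappa p q P eps (U y) * absP P (phi y).
have Cpsi : C1 psi.
  apply: C1M.
    apply: (@C1_comp _ _ (cutkappa p q P eps) (dcutkappa p q P eps) U _ _ (C1_DRU _ _ _)).
      by move=> y; exact: is_derive_cutkappa.
    exact: dcutkappa_continuous.
  apply: (@C1_comp _ _ (absP P) (dabsP P) phi _ _ hphi).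
    by move=> y; exact: is_derive_absP.
  exact: dabsP_continuous.
rewrite (divergence_gradU hbr _ Cpsi).
pose v := DRgradU br x.
have hD : 'D_v psi x = dcutkappa p q P eps (U x) * (U x ^+ 2 - U x) * absP P (phi x) +
    cutkappa p q P eps (U x) * (dabsP P (phi x) * 'D_v phi x).
  have h1 := is_derive_comp1 (is_derive_gradU_U hbr x) (is_derive_cutkappa q1 P2 dimP (U x) e0).
  have h2 := is_derive_comp1 (C1_derive x v hphi) (is_derive_absP P2 (phi x)).
  by have [_ ->] := is_derive_mul h1 h2.
rewrite hD /energy /weighted /psi -mulrDr ler_pM2l ?vol_gt0//.
(* U x <= 1 happens at the identity, where the cut-off field and its derivative vanish and only the
   energy is left. *)
have [U1|U1] := leP (U x) 1.
  have m0 : Num.max 0 (U x - (1 + eps)) = 0 by apply/max_idPl; lra.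
  rewrite cutoff1 ?(ltW e0)// mul0r mulr0 /dcutkappa /cutkappa m0 expr0n/= !mulr0 !mul0r !addr0 !mul0r addr0.
  exact: powR_ge0.
set u := U x in U1 *; set c := cutoff eps u; have /andP[c0 c1] := cutoff_itv (ltW e0) U1.
rewrite -/c in c0 c1.
set k := DRkappa p q P u; set s := DRs p q P u.
have s0 : 0 < s by exact: DRs_gt0.
have w0 := DRw_gt0 U1.
have kE : k = s `^ (P - 1) / DRw u by [].
rewrite cutkappaE -/c -/k.
set a := grad_norm br phi x; set f := `|phi x|.
have a0 : 0 <= a by exact: grad_norm_ge0.
have f0 : 0 <= f by exact: normr_ge0.
have Dle : `|'D_v phi x| <= DRw u * a by apply: derive_gradU_le => //; exact: hphi.1.
have Y := young P2 a0 f0 (ltW s0).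
have dle := dcutkappa_ge q1 P2 dimP (ltW e0) U1.
rewrite -/c in dle.
(* As kappa |grad U| = s^(P-1), the term with the derivative of phi is at most c times the left side
   of [young]. *)
have T1 : - (c * (P * a * (f `^ (P - 1) * s `^ (P - 1)))) <= c * k * (dabsP P (phi x) * 'D_v phi x).
  rewrite lerNl -mulrN; apply: (le_trans (ler_norm _)).
  rewrite normrM (ger0_norm (_ : 0 <= c * k)); last by rewrite mulr_ge0// ltW// kappa_gt0.
  rewrite -[c * k * _]mulrA ler_wpM2l// normrN normrM.
  have -> : P * a * (f `^ (P - 1) * s `^ (P - 1)) = k * (P * f `^ (P - 1) * (DRw u * a)).
    by rewrite kE; field; rewrite gt_eqF.
  rewrite ler_wpM2l ?(ltW (kappa_gt0 q1 P2 dimP U1))// ler_pM//.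
  rewrite /dabsP !normrM normr_sg (ger0_norm (powR_ge0 _ _)) gtr0_norm; last by lra.
  rewrite -/f ler_piMr//; first by rewrite mulr_ge0 ?powR_ge0//; lra.
  by case: (phi x != 0).
have T2 : c * dDRkappa p q P u * (u ^+ 2 - u) * f `^ P <= dcutkappa p q P eps u * (u ^+ 2 - u) * f `^ P.
  rewrite ler_wpM2r ?powR_ge0// ler_wpM2r// -DRw_sqr ?sqr_ge0// ltW//.
have T3 : c * (P * a * (f `^ (P - 1) * s `^ (P - 1))) <= a `^ P + c * ((P - 1) * (f `^ P * s `^ P)).
  by apply: (le_trans (ler_wpM2l c0 Y)); rewrite mulrDr lerD2r ler_piMl// powR_ge0.
rewrite /absP -/f /DRW -/k -/s.
have := T1; have := T2; have := T3.
set D := 'D_v phi x; set dk := dcutkappa _ _ _ _ _; set d := dDRkappa _ _ _ _; set fP := f `^ P; set sP := s `^ P.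
set aP := a `^ P; set Z := P * a * _; set dd := dabsP P _.
set uu := u ^+ 2 - u; set L := (1 + (p%:R / 2 + q%:R)) * u - _.
move=> H3 H2 H1.
have -> : fP * (c * (d * uu + k * L - (P - 1) * sP)) = c * d * uu * fP + c * k * fP * L - c * ((P - 1) * (fP * sP)) by ring.
lra.
Qed.

Lemma hardy_cutoff eps : 0 < eps ->
  (DRleb (fun x => (weighted eps x)%:E) <= DRleb (fun x => (energy x)%:E))%E.
Proof.
move=> e0.
apply: (@divergence_le _ _ _ _ (index_enum (DRidx p q)) (@DRbasis R p q)
  (fun k y => vol y * (cutkappa p q P eps (U y) * absP P (phi y)) * DRcoord (DRgradU br y) k) K) => //.
- move=> k x /phiK ->.
  have PP := P2.
  by rewrite /absP normr0 powR0 ?mulr0 ?mul0r// gt_eqF//; lra.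
- move=> k; apply: C1M; last exact: C1_gradU.
  apply: C1M; first exact: C1_DRexp.
  apply: C1M.
    apply: (@C1_comp _ _ (cutkappa p q P eps) (dcutkappa p q P eps) U _ _ (C1_DRU _ _ _)).
      by move=> y; exact: is_derive_cutkappa.
    exact: dcutkappa_continuous.
  apply: (@C1_comp _ _ (absP P) (dabsP P) phi _ _ hphi).
    by move=> y; exact: is_derive_absP.
  exact: dabsP_continuous.
- exact: energy_continuous.
- exact: energy_ge0.
- by have := nnlsc_slice eps nnlsc_weighted; rewrite /= gtr0_norm.
- by move=> x; exact: weighted_le_energy.
Qed.

(** If it failed, lower semicontinuity at eps = 0 would make it fail for some small positive eps,
    against [hardy_cutoff]. *)
Lemma hardy_identity :
  (DRleb (fun x => (weighted 0 x)%:E) <= DRleb (fun x => (energy x)%:E))%E.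
Proof.
rewrite leNgt; apply/negP => lt.
have fin : DRleb (fun x => (energy x)%:E) \is a fin_num.
  rewrite ge0_fin_numE; first exact: lt_le_trans lt (leey _).
  by apply: DRleb_ge0 => x; rewrite lee_fin energy_ge0.
have lsc := (nnlsc_DRleb nnlsc_weighted).2 0.
rewrite -(fineK fin) in lt.
have [|W /nbhs_ballP[d /= d0 dW] HW] := lsc (fine (DRleb (fun x => (energy x)%:E))).
  by rewrite /= normr0.
have d2 : 0 < d / 2 by rewrite divr_gt0.
have := HW (d / 2); rewrite /= gtr0_norm// (fineK fin) => /(_ _)/wrap[].
  by apply: dW; rewrite -ball_normE/= sub0r normrN gtr0_norm//; lra.
by rewrite ltNge hardy_cutoff.
Qed.

End HardyAtIdentity.

(** * The distance to the identity *)

Section DistanceLower.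
Variables (R : realType) (p q : nat) (br : 'rV[R]_p -> 'rV[R]_p -> 'rV[R]_q).
Hypothesis hbr : is_DR_bracket br.
Local Notation X := (DRpt R p q).
Local Notation U := (@DRU R p q).

Definition frame_coef (x w : X) (k : DRidx p q) : R :=
  match k with
  | inl (inl i) => (expR (- (x.2 / 2)) *: w.1.1) 0 i
  | inl (inr j) => (expR (- x.2) *: (w.1.2 - 2^-1 *: br x.1.1 w.1.1)) 0 j
  | inr _ => w.2
  end.

Lemma frame_coefE x w : w = \sum_(k : DRidx p q) frame_coef x w k *: DRframe br x k.
Proof.
rewrite !big_sumType/= big_ord1 (sum_frameE hbr) sum_frameF /frameH.
case: w => [[V Z] t] /=; congr (_, _, _); rewrite /= ?scaler0 ?addr0 ?add0r.
- by rewrite scalerA expRN divff ?scale1r// gt_eqF// expR_gt0.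
- rewrite (brZr hbr) scalerA [_ / 2 * _]mulrAC expRN divff; last by rewrite gt_eqF// expR_gt0.
  rewrite scalerA expRN divff; last by rewrite gt_eqF// expR_gt0.
  by rewrite scale1r mul1r addrC subrK.
- by rewrite /GRing.scale/= mulr1.
Qed.

Lemma speedE x w : speed br x w = Num.sqrt (\sum_(k : DRidx p q) frame_coef x w k ^+ 2).
Proof.
rewrite !big_sumType/= big_ord1 -!sqnE !sqnZ /speed; congr Num.sqrt.
have -> : expR (- x.2) = expR (- (x.2 / 2)) ^+ 2 by rewrite expr2 -expRD; congr expR; field.
have -> : expR (- (2 * x.2)) = (expR (- (x.2 / 2)) ^+ 2) ^+ 2.
  by rewrite !expr2 -!expRD; congr expR; field.
by [].
Qed.

(** Identifies [DRgradU] as the gradient for the metric: its coefficients in the orthonormal frame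
    are the derivatives of U along the frame. *)
Lemma derive_frame_U x k : 'D_(DRframe br x k) U x = DRgradU_frame br x k.
Proof.
have [_ ->] := is_derive_DRU x (DRframe br x k).
have e1 : expR (x.2 / 2) * DRexp (-1) x = DRexp (- 2^-1) x.
  by rewrite /DRexp -expRD; congr expR; field.
have e2 : expR x.2 * DRexp (-1) x = 1.
  by rewrite /DRexp -expRD -[RHS]expR0; congr expR; field.
have e3 : DRexp 1 x * DRexp (-1) x = 1.
  by rewrite /DRexp -expRD -[RHS]expR0; congr expR; field.
case: k => [[i|j]|k] /=.
- rewrite !dotvZr dotv_deltar -(dotv_Jop hbr) dotv_deltar -e1.
  by field.
- rewrite (dotvC x.1.1 0) dotv0l dotvZr dotv_deltar.
  transitivity (2^-1 * (expR x.2 * DRexp (-1) x) * x.1.2 0 j); [by field|by rewrite e2; field].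
- rewrite !(dotvC _ 0) !dotv0l.
  transitivity (2^-1 * DRN x * (DRexp 1 x * DRexp (-1) x) - DRU x); [by field|by rewrite e3; field].
Qed.

(** Cauchy-Schwarz in the orthonormal frame. As |grad U| = dU/dr, this is |grad r| <= 1 written
    without dividing by a quantity that vanishes at the identity. *)
Lemma derive_U_le x w : `|'D_w U x| <= Num.sqrt (U x ^+ 2 - U x) * speed br x w.
Proof.
rewrite speedE -sqrtrM; last first.
  by rewrite -(DRgradU_frame_norm hbr) sumr_ge0// => k _; rewrite sqr_ge0.
rewrite -sqrtr_sqr ler_wsqrtr// -(DRgradU_frame_norm hbr).
rewrite {1}(frame_coefE x w) derive_lin; last exact: (C1_DRU _ _ _).1.
rewrite (eq_bigr (fun k => DRgradU_frame br x k * frame_coef x w k)); last first.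
  by move=> k _; rewrite derive_frame_U mulrC.
exact: cauchy_schwarz_sum.
Qed.

Lemma continuous_dotv (T : topologicalType) n (f g : T -> 'rV[R]_n) :
  continuous f -> continuous g -> continuous (fun s => dotv (f s) (g s)).
Proof.
move=> cf cg; apply: cvg_bigsum => i s.
have cfi : {for s, continuous (fun s => f s 0 i)}.
  by apply: (@continuous_comp _ _ _ f (fun v : 'rV[R]_n => v 0 i)); [exact: cf|exact: coord_continuous].
have cgi : {for s, continuous (fun s => g s 0 i)}.
  by apply: (@continuous_comp _ _ _ g (fun v : 'rV[R]_n => v 0 i)); [exact: cg|exact: coord_continuous].
exact: (continuous_mul cfi cgi).
Qed.

Lemma continuous_br (T : topologicalType) (f g : T -> 'rV[R]_p) :
  continuous f -> continuous g -> continuous (fun s => br (f s) (g s)).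
Proof.
move=> cf cg s; apply: cvg_mx => i j; rewrite (ord1 i).
have cfi k : continuous (fun s => f s 0 k).
  by move=> x; apply: (@continuous_comp _ _ _ f (fun v : 'rV[R]_p => v 0 k)); [exact: cf|exact: coord_continuous].
have cgi k : continuous (fun s => g s 0 k).
  by move=> x; apply: (@continuous_comp _ _ _ g (fun v : 'rV[R]_p => v 0 k)); [exact: cg|exact: coord_continuous].
suff : continuous (fun s => br (f s) (g s) 0 j) by apply.
rewrite (_ : (fun s => _) = (fun s => \sum_(i < p) \sum_(k < p) f s 0 i * g s 0 k * br (delta_mx 0 i) (delta_mx 0 k) 0 j)); last first.
  by apply/funext => x; rewrite (brE hbr).
apply: cvg_bigsum => k; apply: cvg_bigsum => l x.
have ccst : continuous (fun _ : T => br (delta_mx 0 k) (delta_mx 0 l) 0 j) by move=> z; exact: cst_continuous.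
exact: (continuous_mul (continuous_mul (cfi k x) (cgi l x)) (ccst x)).
Qed.

Section Curve.
Variables (a b : X) (c : R -> X).
Hypothesis hc : C1_curve a b c.

Let dc s : differentiable c s. Proof. by case: hc. Qed.
Let cc : continuous c. Proof. by move=> s; exact: differentiable_continuous. Qed.
Let cd : continuous ('D_1 c). Proof. by case: hc. Qed.

Let contV (f : R -> X) : continuous f -> continuous (fun s => (f s).1.1).
Proof. by move=> cf s; exact: continuous_fst_comp (continuous_fst_comp (cf s)). Qed.
Let contZ (f : R -> X) : continuous f -> continuous (fun s => (f s).1.2).
Proof. by move=> cf s; exact: continuous_snd_comp (continuous_fst_comp (cf s)). Qed.
Let contt (f : R -> X) : continuous f -> continuous (fun s => (f s).2).
Proof. by move=> cf s; exact: continuous_snd_comp (cf s). Qed.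

Let cexp (k : R) : continuous (fun s => expR (k * (c s).2)).
Proof.
move=> s; apply: (@continuous_comp _ _ _ (fun s => k * (c s).2) expR); last exact: continuous_expR.
by apply: continuous_mul; [exact: cst_continuous|exact: contt].
Qed.

Lemma speed_continuous : continuous (fun s => speed br (c s) ('D_1 c s)).
Proof.
move=> s; apply: (@continuous_comp _ _ _ (fun s => expR (- (c s).2) * sqn ('D_1 c s).1.1
          + expR (- (2 * (c s).2)) * sqn (('D_1 c s).1.2 - 2^-1 *: br (c s).1.1 ('D_1 c s).1.1)
          + ('D_1 c s).2 ^+ 2) Num.sqrt); last exact: sqrt_continuous.
have h1 : continuous (fun s => expR (- (c s).2)).
  rewrite (_ : (fun s => _) = (fun s => expR (-1 * (c s).2))); first exact: (@cexp (-1)).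
  by apply/funext => x; rewrite mulN1r.
have h2 : continuous (fun s => expR (- (2 * (c s).2))).
  rewrite (_ : (fun s => _) = (fun s => expR (- 2 * (c s).2))); first exact: (@cexp (- 2)).
  by apply/funext => x; rewrite mulNr.
have h3 : continuous (fun s => sqn ('D_1 c s).1.1) by apply: continuous_dotv; exact: contV.
have h4 : continuous (fun s => ('D_1 c s).1.2 - 2^-1 *: br (c s).1.1 ('D_1 c s).1.1).
  move=> x; apply: (@continuousB _ _ _ (fun s => ('D_1 c s).1.2)); first exact: contZ.
  apply: (@continuousZl_tmp _ _ _ (fun s => br (c s).1.1 ('D_1 c s).1.1)).
  by apply: continuous_br; exact: contV.
have h5 : continuous (fun s => sqn (('D_1 c s).1.2 - 2^-1 *: br (c s).1.1 ('D_1 c s).1.1)).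
  by apply: continuous_dotv.
have h6 := contt cd.
exact: (continuousD (continuousD (continuous_mul (h1 s) (h3 s)) (continuous_mul (h2 s) (h5 s))) (continuous_sqr (h6 s))).
Qed.

Lemma U_curve_continuous : continuous (fun s => U (c s)).
Proof. by move=> s; apply: (@continuous_comp _ _ _ c U); [exact: cc|exact: U_continuous]. Qed.

Lemma derive_U_curve_continuous : continuous (fun s => 'D_('D_1 c s) U (c s)).
Proof.
rewrite (_ : (fun s => _) = (fun s =>
  2^-1 * (DRN (c s) * (('D_1 c s).2 * DRexp 1 (c s) + 2^-1 * dotv (c s).1.1 ('D_1 c s).1.1) + dotv (c s).1.2 ('D_1 c s).1.2)
    * DRexp (-1) (c s) - ('D_1 c s).2 * U (c s))); last first.
  by apply/funext => s; have [_ ->] := is_derive_DRU (c s) ('D_1 c s).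
have cst (k : R) : continuous (fun _ : R => k) by move=> x; exact: cst_continuous.
have h1 := contt cd; have h2 := @cexp 1; have h3 := @cexp (-1).
have h4 : continuous (fun s => dotv (c s).1.1 ('D_1 c s).1.1) by apply: continuous_dotv; exact: contV.
have h5 : continuous (fun s => dotv (c s).1.2 ('D_1 c s).1.2) by apply: continuous_dotv; exact: contZ.
have h6 : continuous (fun s => DRN (c s)).
  by move=> s; apply: (@continuous_comp _ _ _ c (@DRN R p q)); [exact: cc|apply: C1_continuous; exact: C1_DRN].
have h7 := U_curve_continuous.
move=> s.
exact: (continuousB (continuous_mul (continuous_mul (cst _ s) (continuousD (continuous_mul (h6 s)
  (continuousD (continuous_mul (h1 s) (h2 s)) (continuous_mul (cst _ s) (h4 s)))) (h5 s))) (h3 s))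
  (continuous_mul (h1 s) (h7 s))).
Qed.

(* [DRr (U + eps)] is a smooth approximation of the distance with gradient at most 1. *)
Lemma DRr_shift_le_length (eps : R) : 0 < eps ->
  DRr (U b + eps) - DRr (U a + eps) <= curve_length br c.
Proof.
move=> e0; have [_ _ c0 c1] := hc; rewrite -c0 -c1.
pose f s := 'D_('D_1 c s) U (c s) / DRw (U (c s) + eps).
have Ue s : 1 < U (c s) + eps by have := DRU_ge1 (c s); lra.
have hF s : is_derive s (1 : R) (fun s => DRr (U (c s) + eps)) (f s).
  have h1 := is_derive_chain (1 : R) (dc s) ((C1_DRU R p q).1 (c s)).
  have h2 := is_derive_add h1 (is_derive_const eps s 1).
  apply: (is_derive_eq (is_derive_comp1 h2 (is_derive_DRr (Ue s)))).
  by rewrite addr0 mulrC.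
have cf : continuous f.
  move=> s.
  suff cw : {for s, continuous (fun s => DRw (U (c s) + eps))}.
    by apply: (continuous_mul (@derive_U_curve_continuous s)); apply: continuousV => //; rewrite gt_eqF// DRw_gt0.
  apply: (@continuous_comp _ _ _ (fun s => U (c s) + eps) (@DRw R)).
    by apply: (continuousD (@U_curve_continuous s)); exact: cst_continuous.
  exact: is_derive_continuous (is_derive_DRw (Ue s)).
have cF : continuous (fun s => DRr (U (c s) + eps)) by move=> s; exact: is_derive_continuous (hF s).
have FTC := @continuous_FTC2 R f (fun s => DRr (U (c s) + eps)) 0 1 ltr01 (continuous_subspaceT cf).
have {FTC}E : (\int[lebesgue_measure]_(x in `[0%R, 1%R]) (f x)%:E = (DRr (U (c 1) + eps))%:E - (DRr (U (c 0) + eps))%:E)%E.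
  apply: FTC.
  - split.
    + by move=> x _; case: (hF x).
    + by apply: cvg_at_right_filter; exact: cF.
    + by apply: cvg_at_left_filter; exact: cF.
  - by move=> x _; rewrite derive1E; have [_ ->] := hF x.
rewrite -[leLHS]/(fine ((DRr (U (c 1) + eps))%:E - (DRr (U (c 0) + eps))%:E)%E) -E.
apply: le_Rintegral => //.
- by apply: continuous_compact_integrable; [exact: segment_compact|exact: continuous_subspaceT].
- apply: continuous_compact_integrable; first exact: segment_compact.
  by apply: continuous_subspaceT; exact: speed_continuous.
move=> s _; rewrite /f ler_pdivrMr ?DRw_gt0//.
apply: (le_trans (ler_norm _)); apply: (le_trans (derive_U_le _ _)).
rewrite mulrC ler_wpM2l ?sqrtr_ge0//.
(* The shift can only enlarge the denominator: u^2 - u grows by eps (2 u - 1 + eps) when u is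
   replaced by u + eps. *)
rewrite /DRw ler_wsqrtr//.
have := DRU_ge1 (c s); move: (U (c s)) => u u1.
by rewrite -subr_ge0 (_ : _ - _ = eps * (2 * u - 1 + eps)); [rewrite mulr_ge0//; lra|ring].
Qed.

End Curve.

Lemma DRr_continuous_ge1 u : 1 <= u -> {for u, continuous (@DRr R)}.
Proof.
move=> u1.
have c1 : {for u, continuous (fun u : R => Num.sqrt u + Num.sqrt (u - 1))}.
  apply: continuousD; first exact: sqrt_continuous.
  apply: (@continuous_comp _ _ _ (fun u : R => u - 1) Num.sqrt); last exact: sqrt_continuous.
  apply: (@continuousB _ _ _ (fun u : R => u) (fun=> 1)); [exact: id|exact: cst_continuous].
have y0 : 0 < Num.sqrt u + Num.sqrt (u - 1).
  by rewrite ltr_wpDr ?sqrtr_ge0// sqrtr_gt0; lra.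
apply: continuous_mul; first exact: cst_continuous.
exact: (continuous_comp c1 (is_derive_continuous (is_derive1_ln y0))).
Qed.

(** The shift eps of [DRr_shift_le_length] tends to 0: [DRr] is continuous up to u = 1, although it
    is not differentiable there. *)
Lemma DRr_le_length (a b : X) (c : R -> X) : U a = 1 -> C1_curve a b c ->
  DRr (U b) <= curve_length br c.
Proof.
move=> Ua hc; rewrite leNgt; apply/negP => lt.
have cont : {for (0 : R), continuous (fun eps => DRr (U b + eps) - DRr (U a + eps))}.
  have cadd (u : R) : 1 <= u -> {for (0 : R), continuous (fun eps => DRr (u + eps))}.
    move=> u1; apply: (@continuous_comp _ _ _ (fun eps => u + eps) (@DRr R)).
      by apply: (@continuousD _ _ _ (fun=> u) (fun x : R => x)); [exact: cst_continuous|exact: id].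
    by rewrite addr0; exact: DRr_continuous_ge1.
  by apply: (continuousB (cadd _ _) (cadd _ _)); [exact: DRU_ge1|rewrite Ua].
have pos : curve_length br c < DRr (U b + 0) - DRr (U a + 0).
  by rewrite !addr0 Ua DRr1 subr0.
have /nbhs_ballP[d /= d0 dP] := cont [set z | curve_length br c < z] (lt_nbhsr pos).
have d2 : 0 < d / 2 by rewrite divr_gt0.
have : curve_length br c < DRr (U b + d / 2) - DRr (U a + d / 2).
  by apply: dP; rewrite -ball_normE/= sub0r normrN gtr0_norm//; lra.
by rewrite ltNge (DRr_shift_le_length hc).
Qed.

End DistanceLower.

(** * Explicit geodesics from the identity and the value of the distance *)

Section DistanceUpper.
Variables (R : realType) (p q : nat) (br : 'rV[R]_p -> 'rV[R]_p -> 'rV[R]_q).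
Hypothesis hbr : is_DR_bracket br.
Local Notation X := (DRpt R p q).
Local Notation U := (@DRU R p q).

(** Such a curve is a combination of four fixed vectors with scalar coefficients, which are
    differentiated one by one. *)
Lemma is_derive_product_curve (f g h k : R -> R) (df dg dh dk : R) (A B : 'rV[R]_p) (C : 'rV[R]_q) s :
  is_derive s (1 : R) f df -> is_derive s (1 : R) g dg ->
  is_derive s (1 : R) h dh -> is_derive s (1 : R) k dk ->
  is_derive s (1 : R) (fun s => (f s *: A + g s *: B, h s *: C, k s) : X)
    (df *: A + dg *: B, dh *: C, dk).
Proof.
move=> hf hg hh hk.
have E (a b c d : R) : (a *: A + b *: B, c *: C, d) =
    a *: ((A, 0, 0) : X) + b *: ((B, 0, 0) : X) + c *: ((0, C, 0) : X) + d *: ((0, 0, 1) : X).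
  by congr (_, _, _); rewrite /= ?scaler0 ?addr0 ?add0r// /GRing.scale/= mulr1.
rewrite (_ : (fun s => _) = (fun s => f s *: ((A, 0, 0) : X) + g s *: ((B, 0, 0) : X)
   + h s *: ((0, C, 0) : X) + k s *: ((0, 0, 1) : X))); last by apply/funext => z; exact: E.
rewrite E.
exact: (is_deriveD (is_deriveD (is_deriveD (is_derive_scalel _ hf) (is_derive_scalel _ hg)) (is_derive_scalel _ hh)) (is_derive_scalel _ hk)).
Qed.

Lemma continuous_product_curve (f g h k : R -> R) (A B : 'rV[R]_p) (C : 'rV[R]_q) :
  continuous f -> continuous g -> continuous h -> continuous k ->
  continuous (fun s => (f s *: A + g s *: B, h s *: C, k s) : X).
Proof.
move=> cf cg ch ck s; apply: cvg_to_pair; last exact: ck.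
apply: cvg_to_pair; last by apply: cvgZr_tmp; exact: ch.
by apply: cvgD; apply: cvgZr_tmp; [exact: cf|exact: cg].
Qed.

Section Geodesic.
Variables (rho sigma : R) (V0 : 'rV[R]_p) (Z0 : 'rV[R]_q).
Hypothesis rho0 : 0 <= rho.
Hypothesis unit_speed : sqn V0 + sqn Z0 + sigma ^+ 2 = 1.

Let S (s : R) := sinh (rho / 2 * s).
Let C (s : R) := cosh (rho / 2 * s).
Let D s := C s - sigma * S s.
Let z := sqn Z0.
(** In terms of theta = tanh (rho s / 2) this is cosh^2 (rho s / 2) times (1 - sigma theta)^2 +
    |Z0|^2 theta^2, the denominator in the usual formulas for these geodesics. Along the curve
    e^(-t) = chi. *)
Let chi s := D s ^+ 2 + z * S s ^+ 2.

(* The geodesic issuing from the identity with velocity [rho (V0, Z0, sigma)]. *)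
Definition geodesic (s : R) : X :=
  ((2 * S s * D s / chi s) *: V0 + (2 * S s ^+ 2 / chi s) *: Jop br Z0 V0,
   (2 * S s * C s / chi s) *: Z0, - ln (chi s)).

Let dgeodesic (s : R) : X :=
  ((rho * (D s ^+ 2 - z * S s ^+ 2) / chi s ^+ 2) *: V0 + (rho * (2 * S s * D s) / chi s ^+ 2) *: Jop br Z0 V0,
   (rho * (2 * C s * D s - chi s) / chi s ^+ 2) *: Z0,
   - (rho * (D s * (S s - sigma * C s) + z * S s * C s) / chi s)).

Let CS s : C s ^+ 2 = 1 + S s ^+ 2.
Proof.
rewrite /C /S /cosh /sinh expRN; have := expR_gt0 (rho / 2 * s); move: (expR _) => E E0.
by field; rewrite gt_eqF.
Qed.

Let z0 : 0 <= z. Proof. exact: sqn_ge0. Qed.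
Let sg1 : sigma ^+ 2 <= 1.
Proof. by move: unit_speed; have := sqn_ge0 V0; have := z0; rewrite /z; lra. Qed.

(** D never vanishes, since C^2 = 1 + S^2 exceeds sigma^2 S^2 when sigma^2 <= 1. *)
Lemma geodesic_chi_gt0 s : 0 < chi s.
Proof.
have h : 0 < D s ^+ 2.
  rewrite lt_neqAle sqr_ge0 andbT eq_sym sqrf_eq0 /D subr_eq0; apply/negP => /eqP e.
  have := CS s; rewrite e exprMn => e2.
  have : sigma ^+ 2 * S s ^+ 2 <= 1 * S s ^+ 2 by rewrite ler_wpM2r// sqr_ge0.
  by lra.
by rewrite /chi ltr_wpDr// mulr_ge0// sqr_ge0.
Qed.

Let dS s : is_derive s (1 : R) S (rho / 2 * C s).
Proof.
have h := is_derive_mul (is_derive_const (rho / 2) s 1) (is_derive_id s (1 : R)).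
by apply: (is_derive_eq (is_derive_comp1 h (is_derive_sinh _))); rewrite /C; ring.
Qed.

Let dC s : is_derive s (1 : R) C (rho / 2 * S s).
Proof.
have h := is_derive_mul (is_derive_const (rho / 2) s 1) (is_derive_id s (1 : R)).
by apply: (is_derive_eq (is_derive_comp1 h (is_derive_cosh _))); rewrite /S; ring.
Qed.

Let dD s : is_derive s (1 : R) D (rho / 2 * (S s - sigma * C s)).
Proof.
by apply: (is_derive_eq (is_derive_sub (dC s) (is_derive_mul (is_derive_const sigma s 1) (dS s)))); ring.
Qed.

Let dchi s : is_derive s (1 : R) chi (rho * (D s * (S s - sigma * C s) + z * S s * C s)).
Proof.
have h := is_derive_add (is_derive_mul (dD s) (dD s)) (is_derive_mul (is_derive_const z s 1) (is_derive_mul (dS s) (dS s))).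
rewrite (_ : chi = (fun y => D y * D y + z * (S y * S y))); first by apply: (is_derive_eq h); field.
by apply/funext => y; rewrite /chi !expr2.
Qed.

Let dchiV s : is_derive s (1 : R) (fun s => (chi s)^-1)
  (- (rho * (D s * (S s - sigma * C s) + z * S s * C s)) / chi s ^+ 2).
Proof.
have c0 := geodesic_chi_gt0 s.
apply: (is_derive_eq (is_derive_inv (lt0r_neq0 c0) (dchi s))).
by rewrite ?mulNr.
Qed.

Lemma is_derive_geodesic s : is_derive s (1 : R) geodesic (dgeodesic s).
Proof.
have c0 := geodesic_chi_gt0 s; have cs := CS s.
apply: is_derive_product_curve.
- have h := is_derive_mul (is_derive_mul (is_derive_mul (is_derive_const 2 s 1) (dS s)) (dD s)) (dchiV s).
  apply: (is_derive_eq h).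
  (* With the factor C^2 - S^2 inserted the identity becomes a formal one, which [field] verifies;
     the factor is then replaced by 1. *)
  transitivity (rho * (D s ^+ 2 - z * S s ^+ 2) * (C s ^+ 2 - S s ^+ 2) / chi s ^+ 2).
    by rewrite /chi in c0 *; rewrite /D in c0 *; field; rewrite gt_eqF.
  by rewrite cs addrK mulr1.
- have h := is_derive_mul (is_derive_mul (is_derive_const 2 s 1) (is_derive_mul (dS s) (dS s))) (dchiV s).
  rewrite (_ : (fun s => _) = (fun s => 2 * (S s * S s) / chi s)); last by apply/funext => y; rewrite expr2.
  apply: (is_derive_eq h).
  transitivity (rho * (2 * S s * D s) * (C s ^+ 2 - S s ^+ 2) / chi s ^+ 2).
    by rewrite /chi in c0 *; rewrite /D in c0 *; field; rewrite gt_eqF.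
  by rewrite cs addrK mulr1.
- have h := is_derive_mul (is_derive_mul (is_derive_mul (is_derive_const 2 s 1) (dS s)) (dC s)) (dchiV s).
  apply: (is_derive_eq h).
  transitivity (rho * (2 * C s * D s - chi s) * (C s ^+ 2 - S s ^+ 2) / chi s ^+ 2).
    by rewrite /chi in c0 *; rewrite /D in c0 *; field; rewrite gt_eqF.
  by rewrite cs addrK mulr1.
- have h := is_derive_sub (is_derive_const 0 s 1) (is_derive_comp1 (dchi s) (is_derive1_ln c0)).
  rewrite (_ : (fun s => _) = (fun s => 0 - ln (chi s))); last by apply/funext => y; rewrite sub0r.
  by apply: (is_derive_eq h); rewrite sub0r mulrC.
Qed.

(** As e^(-t) = chi, the metric coefficients are chi and chi^2. By [T3] the two vectors V0 and J V0
    combine to a multiple of |V0|^2; after subtraction of half the bracket the central part is a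
    multiple of Z0, whose coefficient [T1] simplifies; [T2] adds the three squares up to rho^2. *)
Lemma speed_geodesic s : speed br (geodesic s) (dgeodesic s) = rho.
Proof.
have c0 := geodesic_chi_gt0 s; have cs := CS s.
rewrite /speed /geodesic /dgeodesic /=.
rewrite mulrN !opprK (_ : 2 * ln (chi s) = ln (chi s) + ln (chi s)); last by ring.
rewrite expRD lnK ?posrE//.
rewrite (brDl hbr) !(brDr hbr) !(brZl hbr) !(brZr hbr) !(brVV hbr) (br_Jop hbr).
rewrite (brC hbr _ V0) (br_Jop hbr) !scaler0 add0r addr0.
rewrite (sqnD (_ *: V0)) !sqnZ dotvZl dotvZr (dotvC V0) (dotv_Jop_self hbr) (sqn_Jop hbr) -/z.
rewrite !scalerN !scalerA -scalerBl scalerA -scalerBl sqnZ -/z.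
have sV : sqn V0 = 1 - z - sigma ^+ 2 by move: unit_speed; rewrite /z; lra.
move: (geodesic_chi_gt0 s); rewrite -/z sV {sV}.
have T1 : 2 * C s * D s - chi s - S s ^+ 2 * (1 - z - sigma ^+ 2) = 1.
  by transitivity (C s ^+ 2 - S s ^+ 2); [rewrite /chi /D; ring|rewrite cs addrK].
have T2 : (1 - z - sigma ^+ 2) * chi s + z + (D s * (S s - sigma * C s) + z * S s * C s) ^+ 2 = chi s ^+ 2.
  have k1 : C s ^+ 2 - S s ^+ 2 = 1 by rewrite cs addrK.
  transitivity ((1 - z - sigma ^+ 2) * chi s * (C s ^+ 2 - S s ^+ 2) + z * (C s ^+ 2 - S s ^+ 2) ^+ 2 +
    (D s * (S s - sigma * C s) + z * S s * C s) ^+ 2); first by rewrite k1 expr1n !mulr1.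
  by rewrite /chi /D; ring.
have T3 : (D s ^+ 2 - z * S s ^+ 2) ^+ 2 + (2 * S s * D s) ^+ 2 * z = chi s ^+ 2.
  by rewrite /chi; ring.
rewrite (_ : _ + _ = rho ^+ 2); first by rewrite sqrtr_sqr ger0_norm.
have {}c0 := lt0r_neq0 c0.
transitivity (rho ^+ 2 / chi s ^+ 2 * (chi s * (1 - z - sigma ^+ 2) * (((D s ^+ 2 - z * S s ^+ 2) ^+ 2 + (2 * S s * D s) ^+ 2 * z) / chi s ^+ 2)
   + z * (2 * C s * D s - chi s - S s ^+ 2 * (1 - z - sigma ^+ 2) * (D s ^+ 2 + z * S s ^+ 2) / chi s) ^+ 2 +
   (D s * (S s - sigma * C s) + z * S s * C s) ^+ 2)).
  by field.
have chiE : D s ^+ 2 + z * S s ^+ 2 = chi s by [].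
rewrite T3 chiE divff ?expf_neq0// (mulfK c0) T1 expr1n !mulr1 (mulrC (chi s)) T2.
by rewrite mulfVK// expf_neq0.
Qed.

Lemma geodesic_C1 : (forall s, differentiable geodesic s) /\ continuous ('D_1 geodesic).
Proof.
split=> [s|]; first by apply/derivable1_diffP; case: (is_derive_geodesic s).
rewrite (_ : 'D_1 geodesic = dgeodesic); last by apply/funext => s; have [_ ->] := is_derive_geodesic s.
have cS : continuous S by move=> s; exact: is_derive_continuous (dS s).
have cC : continuous C by move=> s; exact: is_derive_continuous (dC s).
have cD : continuous D by move=> s; exact: is_derive_continuous (dD s).
have cchi : continuous chi by move=> s; exact: is_derive_continuous (dchi s).
have cV : continuous (fun s => (chi s)^-1) by move=> s; exact: is_derive_continuous (dchiV s).
have ck (k : R) : continuous (fun _ : R => k) by move=> s; exact: cst_continuous.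
have cchi2 : continuous (fun s => (chi s ^+ 2)^-1).
  move=> s; rewrite (_ : (fun s => _) = (fun s => (chi s)^-1 ^+ 2)); last by apply/funext => y; rewrite exprVn.
  exact: continuous_sqr (cV s).
apply: continuous_product_curve => s.
- exact: (continuous_mul (continuous_mul (ck rho s) (continuousB (continuous_sqr (cD s)) (continuous_mul (ck z s) (continuous_sqr (cS s))))) (cchi2 s)).
- exact: (continuous_mul (continuous_mul (ck rho s) (continuous_mul (continuous_mul (ck 2 s) (cS s)) (cD s))) (cchi2 s)).
- exact: (continuous_mul (continuous_mul (ck rho s) (continuousB (continuous_mul (continuous_mul (ck 2 s) (cC s)) (cD s)) (cchi s))) (cchi2 s)).
- exact: (continuousN (continuous_mul (continuous_mul (ck rho s) (continuousD (continuous_mul (cD s) (continuousB (cS s) (continuous_mul (ck sigma s) (cC s)))) (continuous_mul (continuous_mul (ck z s) (cS s)) (cC s)))) (cV s))).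
Qed.

Lemma geodesic0 : geodesic 0 = (0, 0, 0).
Proof.
have S0 : S 0 = 0 by rewrite /S mulr0 /sinh oppr0 subrr mul0r.
have C0 : C 0 = 1 by rewrite /C mulr0 /cosh oppr0 expR0; field.
rewrite /geodesic /chi /D S0 C0 ?expr0n/= !mulr0 !mul0r subr0 expr1n addr0 ln1 oppr0.
by rewrite !scale0r addr0.
Qed.

Lemma length_geodesic : curve_length br geodesic = rho.
Proof.
rewrite /curve_length (@eq_Rintegral _ _ _ _ _ (fun=> rho)); last first.
  by move=> s _; have [_ ->] := is_derive_geodesic s; exact: speed_geodesic.
rewrite Rintegral_cst//= lebesgue_measure_itv/= lte_fin ltr01 oppr0 adde0/= mulr1.
by [].
Qed.

End Geodesic.

(** The formulas for the geodesic at time 1 are solved for the initial velocity: S and C are sinh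
    (r/2) and cosh (r/2), and [chi] has to be 1 / a with a = e^t. *)
Lemma geodesic_to (x : X) : 1 < U x -> exists c, C1_curve (0, 0, 0) x c /\ curve_length br c = DRr (U x).
Proof.
move=> U1; have U1' := ltW U1.
pose S := Num.sqrt (U x - 1); pose C := Num.sqrt (U x).
have S0 : S != 0 by rewrite gt_eqF// sqrtr_gt0; lra.
have C0 : C != 0 by rewrite gt_eqF// sqrtr_gt0; lra.
have S2 : S ^+ 2 = U x - 1 by rewrite sqr_sqrtr//; lra.
have C2 : C ^+ 2 = U x by rewrite sqr_sqrtr//; lra.
pose a := DRexp 1 x; have a0 : a != 0 by rewrite gt_eqF// DRexp_gt0.
(* Forced by unit speed: multiplied by S^2, that relation reads S^2 = |V|^2 / (4 a) + 1 / a + C^2 -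
   2 C D, whence 2 C D = N / a. *)
pose D := DRN x / (2 * a * C).
pose Z0 := (2 * a * S * C)^-1 *: x.1.2.
pose sigma := (C - D) / S.
(* The equation is V = 2 a S (D + S J) V0 with J = J_{Z0}. Since J^2 = - |Z0|^2 and D^2 + |Z0|^2 S^2
   = 1 / a, the inverse of D + S J is a (D - S J). *)
pose V0 := (2 * S)^-1 *: (D *: x.1.1 - S *: Jop br Z0 x.1.1).
have UE : U x = (DRN x ^+ 2 + sqn x.1.2) / (4 * a).
  by rewrite /DRU DRexpN1 -/a; field.
have chiE : D ^+ 2 + sqn Z0 * S ^+ 2 = a^-1.
  rewrite /Z0 sqnZ; transitivity ((DRN x ^+ 2 + sqn x.1.2) / (4 * a) / (a * C ^+ 2)).
    by rewrite /D; field; rewrite C0 S0 a0.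
  by rewrite -UE C2; field; rewrite a0/= gt_eqF//; lra.
have V0E : sqn V0 = sqn x.1.1 / (4 * a * S ^+ 2).
  rewrite /V0 sqnZ sqnD sqnZ -scaleNr dotvZl dotvZr (dotvC x.1.1) (dotv_Jop_self hbr) !mulr0 addr0.
  rewrite sqnZ (sqn_Jop hbr).
  transitivity ((D ^+ 2 + sqn Z0 * S ^+ 2) * sqn x.1.1 / (4 * S ^+ 2)); first by field.
  by rewrite chiE; field; rewrite a0 S0.
have unit : sqn V0 + sqn Z0 + sigma ^+ 2 = 1.
  apply: (@mulfI _ (S ^+ 2)); first by rewrite expf_neq0.
  rewrite mulr1 V0E.
  transitivity (sqn x.1.1 / (4 * a) + (D ^+ 2 + sqn Z0 * S ^+ 2) + C ^+ 2 - 2 * (C * D)).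
    by rewrite /sigma; field; rewrite S0 a0.
  rewrite chiE C2 S2 (_ : C * D = DRN x / (2 * a)); last by rewrite /D; field; rewrite C0 a0.
  by rewrite /DRN -/a; field.
have r0 := DRr_ge0 U1'.
exists (geodesic (DRr (U x)) sigma V0 Z0); split; last exact: length_geodesic.
have [h1 h2] := geodesic_C1 (DRr (U x)) unit.
split => //; first exact: geodesic0.
have s1 : sinh (DRr (U x) / 2 * 1) = S by rewrite mulr1 sinh_DRr.
have c1 : cosh (DRr (U x) / 2 * 1) = C by rewrite mulr1 cosh_DRr.
rewrite /geodesic s1 c1.
have DE : C - sigma * S = D by rewrite /sigma; field.
rewrite DE chiE lnV ?posrE ?DRexp_gt0// opprK invrK.
have -> : ln a = x.2 by rewrite /a /DRexp mul1r expRK.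
have xE : x = (x.1.1, x.1.2, x.2) by case: (x) => [[]].
rewrite [RHS]xE; congr (_, _, _).
- have JV : Jop br Z0 V0 = (2 * S)^-1 *: (D *: Jop br Z0 x.1.1 + (S * sqn Z0) *: x.1.1).
    rewrite {1}/V0 (JopZr hbr) -scaleNr (JopDr hbr) !(JopZr hbr) (JopJop hbr).
    by rewrite scalerN -scaleNr opprK scalerA.
  rewrite JV {1}/V0 !scalerA !scalerDr -scaleNr !scalerA.
  rewrite [X in _ + X]addrC addrACA -!scalerDl.
  rewrite (_ : 2 * S * D * a / (2 * S) * - S + 2 * S ^+ 2 * a / (2 * S) * D = 0); last by field.
  rewrite scale0r addr0 -[RHS]scale1r; congr (_ *: _).
  transitivity ((D ^+ 2 + sqn Z0 * S ^+ 2) * a); first by field.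
  by rewrite chiE mulVf.
- rewrite /Z0 scalerA -[RHS]scale1r; congr (_ *: _).
  by field; rewrite C0 a0 S0.
Qed.

Lemma DRU_identity : U (0, 0, 0) = 1.
Proof.
rewrite /DRU /DRN /DRexp /= !mulr0 expR0 /sqn !dotv0l.
by field.
Qed.

Lemma DRdist_identity (x : X) : DRdist br (0, 0, 0) x = DRr (U x).
Proof.
have [c [hc lc]] : exists c, C1_curve (0, 0, 0) x c /\ curve_length br c = DRr (U x).
  have := DRU_ge1 x; rewrite le_eqVlt => /predU1P[/esym U1|]; last exact: geodesic_to.
  (* At the identity itself the constant curve serves: rho = 0, with the t direction as unit
     vector. *)
  have unit : sqn (0 : 'rV[R]_p) + sqn (0 : 'rV[R]_q) + 1 ^+ 2 = 1 by rewrite /sqn !dotv0l !add0r expr1n.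
  have [h1 h2] := geodesic_C1 0 unit.
  exists (geodesic 0 1 0 0); split; last by rewrite U1 DRr1; exact: length_geodesic.
  split => //; first exact: geodesic0.
  rewrite (DRU_eq1 U1) -(geodesic0 0 1 0 0) /geodesic.
  by rewrite !mul0r.
have lb : lbound [set L | exists c, C1_curve (0, 0, 0) x c /\ L = curve_length br c] (DRr (U x)).
  by move=> _ [c' [hc' ->]]; apply: (DRr_le_length hbr) hc'; exact: DRU_identity.
apply/eqP; rewrite eq_le; apply/andP; split.
  by apply: ge_inf; [exists (DRr (U x))|exists c; split => //; rewrite lc].
by apply: lb_le_inf => //; exists (DRr (U x)), c; rewrite lc.
Qed.

End DistanceUpper.

(** * Left translations *)

Section Translation.
Variables (R : realType) (p q : nat) (br : 'rV[R]_p -> 'rV[R]_p -> 'rV[R]_q).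
Hypothesis hbr : is_DR_bracket br.
Local Notation X := (DRpt R p q).

Definition DRmul (o x : X) : X :=
  (o.1.1 + expR (o.2 / 2) *: x.1.1,
   o.1.2 + expR o.2 *: x.1.2 + (expR (o.2 / 2) / 2) *: br o.1.1 x.1.1,
   o.2 + x.2).

Definition DRinv (o : X) : X :=
  (- (expR (- (o.2 / 2)) *: o.1.1), - (expR (- o.2) *: o.1.2), - o.2).

(** The differential of the left translation by o. It is the same at every point, left translations
    being affine in these coordinates. *)
Definition dDRmul (o w : X) : X :=
  (expR (o.2 / 2) *: w.1.1,
   expR o.2 *: w.1.2 + (expR (o.2 / 2) / 2) *: br o.1.1 w.1.1, w.2).

Lemma expR_half_sqr (t : R) : expR t = expR (t / 2) ^+ 2.
Proof. by rewrite expr2 -expRD; congr expR; field. Qed.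

Lemma DRmulE o x : DRmul o x = o + dDRmul o x.
Proof. by rewrite /DRmul -addrA; case: o => [[]]. Qed.

Lemma DRmulV o x : DRmul o (DRmul (DRinv o) x) = x.
Proof.
have e0 := expR_gt0 (o.2 / 2).
have e1 : expR (- (o.2 / 2)) = (expR (o.2 / 2))^-1 by rewrite expRN.
have xE : x = (x.1.1, x.1.2, x.2) by case: x => [[]].
rewrite [RHS]xE /DRmul /DRinv /=; congr (_, _, _); last by rewrite addrA subrr add0r.
  rewrite mulNr e1 scalerDr scalerN !scalerA divff ?gt_eqF// !scale1r.
  by rewrite addrA subrr add0r.
have brNr V W : br V (- W) = - br V W by rewrite (brC hbr) (brNl hbr) -(brC hbr).
rewrite mulNr (expRN o.2) !(expR_half_sqr o.2) !e1.
rewrite (brDr hbr) brNr !(brZr hbr) (brVV hbr) (brNl hbr) (brZl hbr).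
apply/rowP => j; rewrite !mxE; field.
by rewrite gt_eqF.
Qed.

Lemma DRinvK o : DRinv (DRinv o) = o.
Proof.
have oE : o = (o.1.1, o.1.2, o.2) by case: o => [[]].
rewrite [RHS]oE /DRinv /= mulNr !scalerN !opprK; congr (_, _, _).
  by rewrite scalerA -expRD subrr expR0 scale1r.
by rewrite scalerA -expRD subrr expR0 scale1r.
Qed.

Lemma DRmulKV o x : DRmul (DRinv o) (DRmul o x) = x.
Proof. by rewrite -{2}(DRinvK o) DRmulV. Qed.

Lemma DRmul0 o : DRmul o (0, 0, 0) = o.
Proof.
have oE : o = (o.1.1, o.1.2, o.2) by case: o => [[]].
by rewrite /DRmul /= (br0r hbr) !scaler0 !addr0 -oE.
Qed.

Lemma DRmul_inv o : DRmul (DRinv o) o = (0, 0, 0).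
Proof. by rewrite -{2}(DRmul0 o) DRmulKV. Qed.

Lemma dDRmul_is_linear o : linear (dDRmul o).
Proof.
move=> a x y; rewrite /dDRmul /=; congr (_, _, _) => /=.
- by rewrite scalerDr !scalerA mulrC.
- rewrite (brDr hbr) (brZr hbr) !scalerDr !scalerA -!addrA; congr (_ + _).
    by rewrite mulrC.
  by rewrite addrCA; congr (_ + (_ + _)); rewrite mulrC.
Qed.

Lemma dDRmul_continuous o : continuous (dDRmul o).
Proof.
move=> x; apply: cvg_to_pair; last exact: (@DRt_continuous R p q).
apply: cvg_to_pair; first by apply: cvgZl_tmp; exact: (@DRV_continuous R p q).
apply: cvgD; apply: cvgZl_tmp; first exact: (@DRZ_continuous R p q).
have ck : continuous (fun _ : X => o.1.1) by move=> y; exact: cst_continuous.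
exact: (continuous_br hbr ck (@DRV_continuous R p q)).
Qed.

Lemma DRmul_continuous o : continuous (DRmul o).
Proof.
rewrite (_ : DRmul o = (fun x => o + dDRmul o x)); last by apply/funext => x; exact: DRmulE.
move=> x; apply: (@continuousD _ _ _ (fun=> o) (dDRmul o)); first exact: cst_continuous.
exact: dDRmul_continuous.
Qed.

Lemma DRmul_differentiable o x : differentiable (DRmul o) x /\ forall v, 'D_v (DRmul o) x = dDRmul o v.
Proof.
pose Lm := GRing.isLinear.Build _ _ _ _ _ (dDRmul_is_linear o).
pose L : {linear X -> X} := HB.pack (dDRmul o) Lm.
have hd : differentiable (dDRmul o) x by apply: (@linear_differentiable _ _ _ L); exact: dDRmul_continuous.
rewrite (_ : DRmul o = (fun x => o + dDRmul o x)); last by apply/funext => y; exact: DRmulE.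
have hd' : differentiable (fun x => o + dDRmul o x) x by apply: differentiableD.
split => // v.
have h : is_derive x v (dDRmul o) (dDRmul o v).
  apply: DeriveDef; first exact: diff_derivable.
  by have cL := @dDRmul_continuous o; rewrite (deriveE _ hd) (@diff_lin _ _ _ L).
have [_ ->] := is_deriveD (is_derive_cst o x v) h.
by rewrite add0r.
Qed.

Lemma speed_DRmul o x w : speed br (DRmul o x) (dDRmul o w) = speed br x w.
Proof.
have e0 := expR_gt0 (o.2 / 2).
rewrite /speed /=; congr (Num.sqrt (_ + _ + _)).
  by rewrite sqnZ mulrA -expR_half_sqr -expRD; congr (expR _ * _); ring.
rewrite (_ : _ + _ - _ = expR o.2 *: (w.1.2 - 2^-1 *: br x.1.1 w.1.1)).
  by rewrite sqnZ mulrA expr2 -!expRD; congr (expR _ * _); ring.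
rewrite (brDl hbr) !(brZr hbr) (brZl hbr) (expR_half_sqr o.2).
by apply/rowP => j; rewrite !mxE; field.
Qed.

Lemma C1_curve_DRmul o a b c : C1_curve a b c -> C1_curve (DRmul o a) (DRmul o b) (DRmul o \o c) /\
  curve_length br (DRmul o \o c) = curve_length br c.
Proof.
move=> [dc cc c0 c1].
have E : 'D_1 (DRmul o \o c) = dDRmul o \o 'D_1 c.
  apply/funext => s; have [_ ->] := is_derive_chain (1 : R) (dc s) (DRmul_differentiable o (c s)).1.
  by rewrite (DRmul_differentiable o (c s)).2.
split; first split.
- by move=> s; apply: differentiable_comp => //; exact: (DRmul_differentiable o (c s)).1.
- by rewrite E => s; apply: continuous_comp; [exact: cc|exact: dDRmul_continuous].
- by rewrite /= c0.
- by rewrite /= c1.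
apply: eq_Rintegral => s _.
transitivity (speed br (DRmul o (c s)) (dDRmul o ('D_1 c s))); last exact: speed_DRmul.
exact: (congr1 (fun f => speed br (DRmul o (c s)) (f s)) E).
Qed.

(** Composing curves with the translations by o and by its inverse identifies the two sets of
    lengths. *)
Lemma DRdist_DRmul o x : DRdist br o (DRmul o x) = DRdist br (0, 0, 0) x.
Proof.
congr inf; apply/seteqP; split=> [_ [c [hc ->]]|_ [c [hc ->]]].
  have := C1_curve_DRmul (DRinv o) hc; rewrite DRmul_inv DRmulKV => -[h1 <-].
  by exists (DRmul (DRinv o) \o c).
have := C1_curve_DRmul o hc; rewrite DRmul0 => -[h1 <-].
by exists (DRmul o \o c).
Qed.

(** Left invariance of the frame, from which that of the norm of the gradient follows. *)
Lemma dDRmul_frame o x k : dDRmul o (DRframe br x k) = DRframe br (DRmul o x) k.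
Proof.
case: k => [[i|j]|k] /=; rewrite /dDRmul /frameE /frameF /frameH /=; congr (_, _, _) => //.
- by rewrite scalerA -expRD; congr (expR _ *: _); field.
- rewrite (brDl hbr) (brZl hbr) (brZr hbr) (expR_half_sqr o.2).
  have -> : expR ((o.2 + x.2) / 2) = expR (o.2 / 2) * expR (x.2 / 2) by rewrite -expRD; congr expR; field.
  by apply/rowP => j; rewrite !mxE; field.
- by rewrite scaler0.
- by rewrite (br0r hbr) scaler0 addr0 scalerA -expRD.
- by rewrite scaler0.
- by rewrite (br0r hbr) !scaler0 addr0.
Qed.

Lemma C1_DRmul o (f : X -> R) : C1 f -> C1 (fun x => f (DRmul o x)).
Proof.
move=> hf; apply: (@C1_intro _ _ _ (fun x v => 'D_(dDRmul o v) f (DRmul o x))) => [x|x v|v x].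
- by apply: differentiable_comp; [exact: (DRmul_differentiable o x).1|exact: hf.1].
- rewrite -(DRmul_differentiable o x).2.
  by apply: is_derive_chain; [exact: (DRmul_differentiable o x).1|exact: hf.1].
- by apply: (@continuous_comp _ _ _ (DRmul o) ('D_(dDRmul o v) f)); [exact: DRmul_continuous|exact: hf.2].
Qed.

Lemma grad_norm_DRmul o (f : X -> R) x : C1 f ->
  grad_norm br (fun x => f (DRmul o x)) x = grad_norm br f (DRmul o x).
Proof.
move=> hf; rewrite !grad_normE; apply: (congr1 Num.sqrt); apply: eq_bigr => k _.
apply: (congr1 (fun z => z ^+ 2)).
have [_ ->] := is_derive_chain (DRframe br x k) (DRmul_differentiable o x).1 (hf.1 (DRmul o x)).
by rewrite (DRmul_differentiable o x).2 dDRmul_frame.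
Qed.

Local Open Scope ereal_scope.

(** For fixed V the bracket in the group law only translates Z, so the change of variables is affine
    block by block: a factor exp (o.2 / 2) for each coordinate of V, exp (o.2) for each coordinate
    of Z, and 1 for t. *)
Lemma DRleb_DRmul o (F : X -> \bar R) : nnlsc F ->
  DRleb F = (expR ((p%:R / 2 + q%:R) * o.2))%:E * DRleb (fun x => F (DRmul o x)).
Proof.
move=> lF.
have lFo : nnlsc (fun x => F (DRmul o x)) by apply: (nnlsc_comp _ lF); exact: DRmul_continuous.
have e0 := expR_gt0 o.2; have e2 := expR_gt0 (o.2 / 2).
have E1 V Z : \int[lebesgue_measure]_(t in setT) F (V, Z, t) =
   \int[lebesgue_measure]_(t in setT) F (V, Z, (o.2 + t)%R).
  rewrite (@ge0_integral_affine _ 1%R o.2)//; last 2 first.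
  - by apply: nnlsc_measurable; exact: nnlsc_DRt.
  - by move=> t; exact: nnlsc_ge0.
  by rewrite mul1e; apply: eq_integral => t _; rewrite mul1r addrC.
have E2 V : lebN (fun Z : 'rV[R]_q => \int[lebesgue_measure]_(t in setT) F ((o.1.1 + expR (o.2 / 2) *: V)%R, Z, t)) =
   (expR o.2 ^+ q)%:E * lebN (fun Z : 'rV[R]_q => \int[lebesgue_measure]_(t in setT) F (DRmul o (V, Z, t))).
  rewrite (@lebN_affine _ _ (expR o.2) (o.1.2 + (expR (o.2 / 2) / 2) *: br o.1.1 V)%R)//; last exact: nnlsc_DRZ.
  congr (_ * _); congr lebN; apply/funext => Z; rewrite E1.
  by apply: eq_integral => t _; rewrite /DRmul /= addrA [(_ + o.1.2)%R]addrC.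
rewrite {1}/DRleb (@lebN_affine _ _ (expR (o.2 / 2)) o.1.1)//; last exact: nnlsc_DRV.
rewrite (_ : (fun V => _) = (fun V : 'rV[R]_p => (expR o.2 ^+ q)%:E *
   lebN (fun Z : 'rV[R]_q => \int[lebesgue_measure]_(t in setT) F (DRmul o (V, Z, t))))); last first.
  by apply/funext => V; rewrite addrC E2.
rewrite lebNZ; [|by rewrite exprn_ge0 ?ltW|exact: (nnlsc_DRV lFo)].
rewrite muleA -EFinM; congr (_%:E * _).
rewrite -!expRM_natl -expRD; congr expR.
by field.
Qed.

Lemma DRvol_DRmul o x : DRvol (DRmul o x) = (expR (- ((p%:R / 2 + q%:R) * o.2)) * DRvol x)%R.
Proof. by rewrite /DRvol /DRexp -expRD; congr expR; rewrite /=; ring. Qed.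

(** Left invariance of the Riemannian volume: the density is multiplied by the inverse of the
    Jacobian factor of [DRleb_DRmul]. *)
Lemma DRleb_vol_DRmul o (f : X -> R) : (forall x, 0 <= f x)%R -> nnlsc (fun x => (DRvol x * f x)%:E) ->
  DRleb (fun x => (DRvol x * f x)%:E) = DRleb (fun x => (DRvol x * f (DRmul o x))%:E).
Proof.
move=> f0 lf; rewrite (DRleb_DRmul o lf).
pose k : R := expR ((p%:R / 2 + q%:R) * o.2).
have k0 : (0 < k)%R by exact: expR_gt0.
have lg : nnlsc (fun x => (DRvol (DRmul o x) * f (DRmul o x))%:E).
  by apply: (nnlsc_comp _ lf); exact: DRmul_continuous.
rewrite -(DRlebZ (ltW k0) lg).
congr DRleb; apply/funext => x; rewrite -EFinM; congr EFin.
by rewrite DRvol_DRmul expRN -/k -!mulrA mulVKf// gt_eqF.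
Qed.

End Translation.

(** * Transfer to an arbitrary base point *)

Section Assembly.
Variables (R : realType) (p q : nat) (br : 'rV[R]_p -> 'rV[R]_p -> 'rV[R]_q) (P : R).
Hypothesis hbr : is_DR_bracket br.
Hypothesis q1 : (1 <= q)%N.
Hypothesis P2 : 2 <= P.
Hypothesis dimP : 1 + P * (P - 1) <= (p + q + 1)%:R.
Variable o : DRpt R p q.
Local Notation X := (DRpt R p q).
Local Notation U := (@DRU R p q).
Local Notation vol := (@DRvol R p q).
Local Notation h := (DR_h R p q).
Local Notation g := (DR_g p q).

Lemma DR_g_continuous (r : R) : 0 < r -> {for r, continuous (@DR_g R p q)}.
Proof.
move=> r0.
have ck (k : R) : {for r, continuous (fun _ : R => k)} by exact: cst_continuous.
have cid : {for r, continuous (fun x : R => x)} by exact: id.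
have ch : {for r, continuous (fun x : R => x / 2)} by exact: continuous_mul cid (ck _).
have cs : {for r, continuous (@sinh R)} by exact: is_derive_continuous (is_derive_sinh r).
have cs2 : {for r, continuous (fun x : R => sinh (x / 2))}.
  by apply: (continuous_comp ch); exact: is_derive_continuous (is_derive_sinh _).
have cc2 : {for r, continuous (fun x : R => cosh (x / 2))}.
  by apply: (continuous_comp ch); exact: is_derive_continuous (is_derive_cosh _).
have vs2 : {for r, continuous (fun x : R => (sinh (x / 2))^-1)}.
  by apply: continuousV cs2; rewrite gt_eqF// sinh_gt0// divr_gt0.
have vs : {for r, continuous (fun x : R => (sinh x)^-1)}.
  by apply: continuousV cs; rewrite gt_eqF// sinh_gt0.
have vid : {for r, continuous (fun x : R => x^-1)} by apply: continuousV cid; rewrite gt_eqF.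
exact: (continuousB (continuous_mul cc2 vs2) (continuous_mul (ck _) (continuousD (continuous_mul (ck _) vs) vid))).
Qed.

Lemma weights_continuous (r : R) : 0 < r ->
  [/\ {for r, continuous (fun r => g r `^ (P - 2))},
      {for r, continuous (fun r => g r `^ (P - 2) / r ^+ 2)},
      {for r, continuous (fun r => g r `^ (P - 2) * (g r + (h * r)^-1) / r)} &
      {for r, continuous (fun r => g r `^ (P - 2) * ((q%:R ^+ 2 - q%:R * P * (P - 1)) / sinh r ^+ 2
         + p%:R * (2 * h - P * (P - 1)) / (4 * sinh (r / 2) ^+ 2)))}].
Proof.
move=> r0; have g0 := DR_g_gt0 q1 P2 dimP r0; have h0 := DR_h_gt0 R p q1.
have ck (k : R) : {for r, continuous (fun _ : R => k)} by exact: cst_continuous.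
have cid : {for r, continuous (fun x : R => x)} by exact: id.
have cg := DR_g_continuous r0.
have cgP : {for r, continuous (fun r => g r `^ (P - 2))}.
  exact: (continuous_comp cg (is_derive_continuous (is_derive1_powR (P - 2) g0))).
have vid : {for r, continuous (fun x : R => x^-1)} by apply: continuousV cid; rewrite gt_eqF.
have vid2 : {for r, continuous (fun x : R => (x ^+ 2)^-1)}.
  by apply: continuousV (continuous_sqr cid); rewrite gt_eqF// exprn_gt0.
have vh : {for r, continuous (fun x : R => (h * x)^-1)}.
  by apply: continuousV (continuous_mul (ck h) cid); rewrite gt_eqF// mulr_gt0.
have ch : {for r, continuous (fun x : R => x / 2)} by exact: continuous_mul cid (ck _).
have cs : {for r, continuous (@sinh R)} by exact: is_derive_continuous (is_derive_sinh r).
have cs2 : {for r, continuous (fun x : R => sinh (x / 2))}.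
  by apply: (continuous_comp ch); exact: is_derive_continuous (is_derive_sinh _).
have vs : {for r, continuous (fun x : R => (sinh x ^+ 2)^-1)}.
  by apply: continuousV (continuous_sqr cs); rewrite gt_eqF// exprn_gt0// sinh_gt0.
have vs2 : {for r, continuous (fun x : R => (4 * sinh (x / 2) ^+ 2)^-1)}.
  apply: continuousV (continuous_mul (ck 4) (continuous_sqr cs2)).
  by rewrite gt_eqF// mulr_gt0// exprn_gt0// sinh_gt0// divr_gt0.
split => //.
- exact: continuous_mul cgP vid2.
- exact: continuous_mul (continuous_mul cgP (continuousD cg vh)) vid.
- exact: (continuous_mul cgP (continuousD (continuous_mul (ck _) vs) (continuous_mul (ck _) vs2))).
Qed.

Lemma DRdistE x : DRdist br o x = DRr (U (DRmul br (DRinv o) x)).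
Proof. by rewrite -{1}(DRmulV hbr o x) (DRdist_DRmul hbr) (DRdist_identity hbr). Qed.

Lemma DRintE (f : X -> R) : DRint f = DRleb (fun x => (vol x * f x)%:E).
Proof.
transitivity (DRleb (fun x : X => (f x * expR (- ((p%:R / 2 + q%:R) * x.2)))%:E)) => //.
by congr DRleb; apply/funext => x; rewrite mulrC -mulNr.
Qed.

Section Phi.
Variable phi : X -> R.
Hypothesis cphi : C1 phi.

(* The weights are singular at the base point, where the distance vanishes;
   there the integrand is replaced by 0. *)
Definition masked (w : R -> R) (x : X) : R :=
  if 1 < U (DRmul br (DRinv o) x) then w (DRdist br o x) * `|phi x| `^ P else 0.

Section Weight.
Variable w : R -> R.
Hypothesis w_ge0 : forall r, 0 < r -> 0 <= w r.
Hypothesis w_continuous : forall r, 0 < r -> {for r, continuous w}.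

Lemma masked_ge0 x : 0 <= masked w x.
Proof.
rewrite /masked; case: ifPn => // U1; rewrite mulr_ge0 ?powR_ge0// w_ge0//.
by rewrite DRdistE DRr_gt0.
Qed.

Lemma nnlsc_masked : nnlsc (fun x => (vol x * masked w x)%:E).
Proof.
pose V x := U (DRmul br (DRinv o) x).
have cV : continuous V.
  by move=> x; apply: (@continuous_comp _ _ _ (DRmul br (DRinv o)) U); [exact: DRmul_continuous|exact: U_continuous].
apply: nnlsc_EFin => x.
  by rewrite mulr_ge0 ?masked_ge0// ltW// vol_gt0.
have [V1|V1] := ltP 1 (V x); last by left; rewrite /masked ltNge V1/= mulr0.
right; apply: (continuous_mul (@vol_continuous _ _ _ x)).
have V1near : \forall y \near x, 1 < V y.
  by apply: (cV x [set u | 1 < u]); exact: lt_nbhsr.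
have E : \forall y \near x, w (DRr (V y)) * `|phi y| `^ P = masked w y.
  by apply: filterS V1near => y y1; rewrite /masked DRdistE -/(V y) y1.
have c1 : {for x, continuous (fun y => DRr (V y))}.
  by apply: (continuous_comp (cV x)); exact: is_derive_continuous (is_derive_DRr V1).
have c2 : {for x, continuous (fun y => w (DRr (V y)))}.
  by apply: (continuous_comp c1); apply: w_continuous; exact: DRr_gt0.
have c3 : {for x, continuous (fun y => `|phi y| `^ P)}.
  by apply: (@continuous_comp _ _ _ phi (absP P)); [exact: C1_continuous|exact: absP_continuous].
rewrite /prop_for /continuous_at -(nbhs_singleton E).
exact: (cvg_trans (near_eq_cvg E) (continuous_mul c2 c3)).
Qed.

(** A point whose height differs from o.2 is not the base point, so the mask does nothing there; the
    slice t = o.2 is removed by [eq_DRleb_mask]. *)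
Lemma DRint_masked : DRint (fun x => w (DRdist br o x) * `|phi x| `^ P) = DRleb (fun x => (vol x * masked w x)%:E).
Proof.
rewrite DRintE; apply: (@eq_DRleb_mask _ _ _ _ _ o.2); first exact: nnlsc_masked.
move=> x xo; rewrite /masked.
have : U (DRmul br (DRinv o) x) != 1.
  apply: contra xo => /eqP/DRU_eq1 E.
  by rewrite -(DRmulV hbr o x) E (DRmul0 hbr).
by move=> U1; rewrite lt_neqAle eq_sym U1 DRU_ge1.
Qed.

End Weight.

Lemma nnlsc_energy : nnlsc (fun x => (energy br P phi x)%:E).
Proof.
apply: nnlsc_EFin => x; first exact: energy_ge0.
by right; exact: energy_continuous.
Qed.

Lemma DRleb_energy_DRmul :
  DRleb (fun x => (energy br P phi x)%:E) = DRleb (fun x => (energy br P (fun x => phi (DRmul br o x)) x)%:E).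
Proof.
pose f x := grad_norm br phi x `^ P.
have f0 x : 0 <= f x by exact: powR_ge0.
have lf : nnlsc (fun x => (vol x * f x)%:E) := nnlsc_energy.
transitivity (DRleb (fun x => (vol x * f (DRmul br o x))%:E)); first exact: (DRleb_vol_DRmul hbr o f0 lf).
apply: (congr1 (@DRleb R p q)); apply/funext => x.
exact: (congr1 (fun z => (vol x * z `^ P)%:E) (esym (grad_norm_DRmul hbr o x cphi))).
Qed.

(** Needed for the difference on the left of the inequality, which is taken in the extended
    reals. *)
Lemma DRleb_energy_lty (K : set X) : compact K -> (forall x, ~ K x -> phi x = 0) ->
  (DRleb (fun x => (energy br P phi x)%:E) < +oo)%E.
Proof.
move=> cptK phiK.
have energyK x : ~ K x -> energy br P phi x = 0.
  move=> Kx; rewrite /energy grad_normE big1 ?sqrtr0 ?powR0 ?mulr0//.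
    by have PP := P2; rewrite gt_eqF//; lra.
  move=> k _; rewrite (derive_off_support _ _ phiK)// ?expr0n//.
  by apply: compact_closed cptK; exact: norm_hausdorff.
have cE : continuous (energy br P phi) by exact: energy_continuous.
have [rho r0 Krho] := compact_norm_le cptK.
have [M M0 EM] := compact_support_norm_le cptK cE energyK.
have r1 : 0 <= rho + 1 by rewrite addr_ge0.
apply: (DRleb_lty M0 r1 nnlsc_energy) => x.
  by rewrite lee_fin (le_trans (ler_norm _)).
move=> xr; rewrite energyK// => /Krho xr'.
by move: (le_trans xr xr'); rewrite gerDl ler10.
Qed.

End Phi.

(** The four weighted integrals are merged into one with weight [target_weight], and the translation
    by o carries it, together with the energy, to the identity, where [hardy_identity] applies to
    the translate of phi. *)
Lemma hardy_inequality (phi : X -> R) (K : set X) : C1 phi -> compact K -> (forall x, ~ K x -> phi x = 0) ->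
  (DRint (fun x => (grad_norm br phi x `^ P)%R)
   - ((h / P) `^ P)%R%:E * DRint (fun x => (g (DRdist br o x) `^ (P - 2) * `|phi x| `^ P)%R)
   >= (h `^ (P - 2) * (P - 1) ^+ 2 / P `^ P)%R%:E
       * DRint (fun x => (g (DRdist br o x) `^ (P - 2) / (DRdist br o x) ^+ 2 * `|phi x| `^ P)%R)
   + (h `^ (P - 1) * (P - 2) / P `^ P)%R%:E
       * DRint (fun x => (g (DRdist br o x) `^ (P - 2) * (g (DRdist br o x) + (h * DRdist br o x)^-1)
                                / DRdist br o x * `|phi x| `^ P)%R)
   + (h `^ (P - 2) / P `^ P)%R%:E
       * DRint (fun x => (g (DRdist br o x) `^ (P - 2)
                  * ((q%:R ^+ 2 - q%:R * P * (P - 1)) / sinh (DRdist br o x) ^+ 2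
                     + p%:R * (2 * h - P * (P - 1)) / (4 * sinh (DRdist br o x / 2) ^+ 2))
                  * `|phi x| `^ P)%R))%E.
Proof.
move=> cphi cptK phiK.
have [k1 k2 k3 k4] := coefficients_ge0 p q P2.
have energyE : DRint (fun x => grad_norm br phi x `^ P) = DRleb (fun x => (energy br P phi x)%:E).
  exact: DRintE.
have Afin := DRleb_energy_lty cphi cptK phiK.
pose w1 r := g r `^ (P - 2).
pose w2 r := g r `^ (P - 2) / r ^+ 2.
pose w3 r := g r `^ (P - 2) * (g r + (h * r)^-1) / r.
pose w4 r := g r `^ (P - 2) * ((q%:R ^+ 2 - q%:R * P * (P - 1)) / sinh r ^+ 2
         + p%:R * (2 * h - P * (P - 1)) / (4 * sinh (r / 2) ^+ 2)).
have p1 r : 0 < r -> 0 <= w1 r by move=> _; exact: powR_ge0.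
have p2 r : 0 < r -> 0 <= w2 r by move=> /(integrands_ge0 q1 P2 dimP)[].
have p3 r : 0 < r -> 0 <= w3 r by move=> /(integrands_ge0 q1 P2 dimP)[].
have p4 r : 0 < r -> 0 <= w4 r by move=> /(integrands_ge0 q1 P2 dimP)[].
have c1 r : 0 < r -> {for r, continuous w1} by move=> /weights_continuous[].
have c2 r : 0 < r -> {for r, continuous w2} by move=> /weights_continuous[].
have c3 r : 0 < r -> {for r, continuous w3} by move=> /weights_continuous[].
have c4 r : 0 < r -> {for r, continuous w4} by move=> /weights_continuous[].
rewrite (@DRint_masked _ cphi w1)// (@DRint_masked _ cphi w2)// (@DRint_masked _ cphi w3)// (@DRint_masked _ cphi w4)//.
have l1 := nnlsc_masked cphi p1 c1; have l2 := nnlsc_masked cphi p2 c2.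
have l3 := nnlsc_masked cphi p3 c3; have l4 := nnlsc_masked cphi p4 c4.
have m1 := nnlscZ k1 l1; have m2 := nnlscZ k2 l2; have m3 := nnlscZ k3 l3; have m4 := nnlscZ k4 l4.
rewrite energyE -(DRlebZ k1 l1) -(DRlebZ k2 l2) -(DRlebZ k3 l3) -(DRlebZ k4 l4).
suff le : (DRleb (fun x => ((h / P) `^ P)%:E * (vol x * masked phi w1 x)%:E +
    (h `^ (P - 2) * (P - 1) ^+ 2 / P `^ P)%:E * (vol x * masked phi w2 x)%:E +
    (h `^ (P - 1) * (P - 2) / P `^ P)%:E * (vol x * masked phi w3 x)%:E +
    (h `^ (P - 2) / P `^ P)%:E * (vol x * masked phi w4 x)%:E) <= DRleb (fun x => (energy br P phi x)%:E))%E.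
  rewrite (DRlebD (nnlscD (nnlscD m1 m2) m3) m4) (DRlebD (nnlscD m1 m2) m3) (DRlebD m1 m2) in le.
  have n1 := DRleb_ge0 m1.1; have n2 := DRleb_ge0 m2.1; have n3 := DRleb_ge0 m3.1; have n4 := DRleb_ge0 m4.1.
  rewrite leeBrDl ?addeA//.
  (* The subtracted integral is finite by the inequality [le] itself, which bounds it by the
     energy. *)
  rewrite ge0_fin_numE//; apply: le_lt_trans Afin; apply: le_trans le.
  by rewrite -!addeA leeDl// !adde_ge0.
pose tot x := masked phi (target_weight p q P) x.
have totE : (fun x => ((h / P) `^ P)%:E * (vol x * masked phi w1 x)%:E +
    (h `^ (P - 2) * (P - 1) ^+ 2 / P `^ P)%:E * (vol x * masked phi w2 x)%:E +
    (h `^ (P - 1) * (P - 2) / P `^ P)%:E * (vol x * masked phi w3 x)%:E +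
    (h `^ (P - 2) / P `^ P)%:E * (vol x * masked phi w4 x)%:E)%E = (fun x => (vol x * tot x)%:E).
  apply/funext => x; rewrite -!EFinM -!EFinD; congr EFin.
  rewrite /tot /masked; case: ifP => _; last by rewrite !mulr0 !addr0.
  by rewrite /target_weight /w1 /w2 /w3 /w4; ring.
rewrite totE.
have lt : nnlsc (fun x => (vol x * tot x)%:E).
  by rewrite -totE; exact: (nnlscD (nnlscD (nnlscD m1 m2) m3) m4).
have t0 x : 0 <= tot x by apply: masked_ge0 => r; exact: target_weight_ge0.
rewrite (DRleb_vol_DRmul hbr o t0 lt) (DRleb_energy_DRmul cphi).
pose psi x := phi (DRmul br o x).
have cpsi : C1 psi by exact: C1_DRmul.
have -> : (fun x => (vol x * tot (DRmul br o x))%:E) = (fun x => (@weighted _ p q P psi 0 x)%:E).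
  apply/funext => x; congr EFin; rewrite /weighted /tot /masked DRdistE (DRmulKV hbr) -/(psi x).
  case: ifPn => U1; last by rewrite cutoff1 ?mul0r ?mulr0// leNgt.
  rewrite DRW_target// (_ : cutoff 0 (U x) = 1); first by rewrite mul1r [in LHS](mulrC (target_weight _ _ _ _)).
  rewrite /cutoff addr0 (max_idPr _); last by rewrite subr_ge0 ltW.
  by rewrite divff// expf_neq0// gt_eqF// subr_gt0.
apply: (@hardy_identity _ _ _ _ _ hbr q1 P2 dimP _ (DRmul br (DRinv o) @` K) cpsi).
  by apply: continuous_compact cptK; apply: continuous_subspaceT; exact: DRmul_continuous.
move=> x Kx; apply: phiK => Kox; apply: Kx; exists (DRmul br o x) => //.
exact: DRmulKV.
Qed.

End Assembly.

Lemma smooth_cpt_C1 (R : realType) (p q : nat) (phi : DRpt R p q -> R) : smooth_cpt phi -> C1 phi.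
Proof.
move=> [hphi _]; split => [x|v x]; first exact: (hphi [::]).
exact: differentiable_continuous (hphi [:: v] x).
Qed.

Theorem theorem3p5 (R : realType) (p q : nat)
  (br : 'rV[R]_p -> 'rV[R]_p -> 'rV[R]_q) (P : R) (o : DRpt R p q) :
  (1 <= q)%N -> is_DR_bracket br -> 2 <= P ->
  1 + P * (P - 1) <= (p + q + 1)%:R ->
  [/\ (forall r : R, 0 < r -> (p%:R + q%:R - 1) / (DR_h R p q * r) <= DR_g p q r),
      DR_g p q r @[r --> +oo] --> (1 : R),
      (forall phi : DRpt R p q -> R, smooth_cpt phi ->
        (DRint (fun x => (grad_norm br phi x `^ P)%R)
         - ((DR_h R p q / P) `^ P)%R%:E
           * DRint (fun x => (DR_g p q (DRdist br o x) `^ (P - 2) * `|phi x| `^ P)%R)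
         >= (DR_h R p q `^ (P - 2) * (P - 1) ^+ 2 / P `^ P)%R%:E
              * DRint (fun x => (DR_g p q (DRdist br o x) `^ (P - 2)
                                / (DRdist br o x) ^+ 2 * `|phi x| `^ P)%R)
            + (DR_h R p q `^ (P - 1) * (P - 2) / P `^ P)%R%:E
              * DRint (fun x => (DR_g p q (DRdist br o x) `^ (P - 2)
                                * (DR_g p q (DRdist br o x)
                                   + (DR_h R p q * DRdist br o x)^-1)
                                / DRdist br o x * `|phi x| `^ P)%R)
            + (DR_h R p q `^ (P - 2) / P `^ P)%R%:E
              * DRint (fun x => (DR_g p q (DRdist br o x) `^ (P - 2)
                  * ((q%:R ^+ 2 - q%:R * P * (P - 1)) / sinh (DRdist br o x) ^+ 2
                     + p%:R * (2 * DR_h R p q - P * (P - 1))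
                       / (4 * sinh (DRdist br o x / 2) ^+ 2))
                  * `|phi x| `^ P)%R))%E) &
      (forall (phi : DRpt R p q -> R) (x : DRpt R p q), 0 < DRdist br o x ->
        [/\ 0 <= DR_g p q (DRdist br o x) `^ (P - 2)
                  / (DRdist br o x) ^+ 2 * `|phi x| `^ P,
            0 <= DR_g p q (DRdist br o x) `^ (P - 2)
                  * (DR_g p q (DRdist br o x) + (DR_h R p q * DRdist br o x)^-1)
                  / DRdist br o x * `|phi x| `^ P &
            0 <= DR_g p q (DRdist br o x) `^ (P - 2)
                  * ((q%:R ^+ 2 - q%:R * P * (P - 1)) / sinh (DRdist br o x) ^+ 2
                     + p%:R * (2 * DR_h R p q - P * (P - 1))
                       / (4 * sinh (DRdist br o x / 2) ^+ 2))
                  * `|phi x| `^ P])].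
Proof.
move=> q1 hbr P2 dimP; split.
- by move=> r r0; exact: DR_g_ge.
- exact: DR_g_cvg1.
- move=> phi hphi.
  have phiK x : ~ closure [set x | phi x != 0] x -> phi x = 0.
    by move=> Kx; apply/eqP/negPn/negP => phix; apply: Kx; exact: subset_closure.
  exact: (hardy_inequality hbr q1 P2 dimP o (smooth_cpt_C1 hphi) hphi.2 phiK).
- move=> phi x r0; have [i1 i2 i3] := integrands_ge0 q1 P2 dimP r0.
  by split; rewrite mulr_ge0 ?powR_ge0.
Qed.
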